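(* Let $h,k\geq 1$, let $c_{ij}>0$ for $i\in\{1,\ldots,h\}$, $j\in\{1,\ldots,k\}$, and let $\nu\in(0,1)$. Let $\{S_1(t)\}_{t\ge 0},\ldots,\{S_h(t)\}_{t\ge 0}$ be real-valued Lévy processes such that each $\kappa_{S_i}(\theta):=\log\mathbb{E}[e^{\theta S_i(1)}]$ is finite in a neighborhood of $\theta=0$, put $m=(m_1,\ldots,m_h):=(\kappa_{S_1}'(0),\ldots,\kappa_{S_h}'(0))$, and let $\{L_1^\nu(t)\}_{t\ge 0},\ldots,\{L_k^\nu(t)\}_{t\ge 0}$ be inverse stable subordinators of parameter $\nu$; all these $h+k$ processes are independent. Set $\alpha_m(\nu):=1-\nu/2$ if $m=0$ and $\alpha_m(\nu):=1-\nu$ if $m\neq 0$, where $0\in\mathbb{R}^h$ is the null vector. Then, as $t\to\infty$: - If $m=0$, then $\left(t^{\alpha_m(\nu)}\frac{S_i\left(\sum_{j=1}^kc_{ij}L_j^\nu(t)\right)}{t}\right)_{i\in\{1,\ldots,h\}}$ converges weakly to $$\left(\sqrt{\sum_{j=1}^kc_{ij}L_j^\nu(1)\kappa_{S_i}''(0)}\;Z_i\right)_{i\in\{1,\ldots,h\}},$$ where $Z_1,\ldots,Z_h$ are independent standard Normal random variables, independent of all the other random variables. - If $m\neq 0$, then $\left(t^{\alpha_m(\nu)}\frac{S_i\left(\sum_{j=1}^kc_{ij}L_j^\nu(t)\right)}{t}\right)_{i\in\{1,\ldots,h\}}$ converges weakly to $$\left(m_i\sum_{j=1}^kc_{ij}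L_j^\nu(1)\right)_{i\in\{1,\ldots,h\}}.$$
   Context: Inverse stable subordinator: for $\nu\in(0,1)$, the stable subordinator of order $\nu$ is the nondecreasing Lévy process $\{S_\nu(t)\}_{t\ge0}$ with $\mathbb{E}[e^{-\lambda S_\nu(t)}]=e^{-t\lambda^\nu}$ for $\lambda\ge 0$; its inverse is $L^\nu(t):=\inf\{s\geq 0:S_\nu(s)>t\}$. *)

(* Defs.v *)
From HB Require Import structures.
From mathcomp Require Import all_boot all_order all_algebra.
From mathcomp Require Import all_classical all_reals all_analysis.

Set Implicit Arguments.
Unset Strict Implicit.
Unset Printing Implicit Defensive.

Import Order.TTheory GRing.Theory Num.Theory.
Import numFieldNormedType.Exports.

Local Open Scope classical_set_scope.
Local Open Scope ring_scope.

(* Processes are families [X : R -> {RV P >-> R}]; only the times [t >= 0]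
   are ever constrained or used. *)

Section independence.
Context d (T : measurableType d) (R : realType) (P : probability T R).

Definition mutually_independent (I : finType) (G : I -> set (set T)) : Prop :=
  forall (J : {set I}) (A : I -> set T),
    (forall i, i \in J -> G i (A i)) ->
    P (\bigcap_(i in [set i | i \in J]) A i) = (\prod_(i in J) P (A i))%E.

Definition sigma_of_variable (X : T -> R) : set (set T) :=
  preimage_set_system setT X measurable.

Definition sigma_of_process (X : R -> T -> R) : set (set T) :=
  <<s \bigcup_(t in [set t : R | 0 <= t]) sigma_of_variable (X t) >>.

End independence.

(* Equality of laws is required on measurable sets only: the value of a measure
   on other sets is meaningless. *)
Definition has_law d (T : measurableType d) (R : realType)
    (P : probability T R) (X : T -> R) (mu : set R -> \bar R) : Prop :=
  forall B : set R, measurable B -> pushforward P X B = mu B.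

Definition cadlag (R : realType) (f : R -> R) : Prop :=
  (forall t : R, 0 <= t -> f x @[x --> t^'+] --> f t) /\
  (forall t : R, 0 < t -> cvg (f x @[x --> t^'-])).

Section processes.
Context d (T : measurableType d) (R : realType) (P : probability T R).
Implicit Type X : R -> {RV P >-> R}.

Definition independent_increments X : Prop :=
  forall (n : nat) (t : nat -> R), 0 <= t 0%N -> (forall i, t i <= t i.+1) ->
    mutually_independent P
      (fun i : 'I_n => sigma_of_variable (X (t i.+1) \- X (t i))).

Definition stationary_increments X : Prop :=
  forall s t : R, 0 <= s -> 0 <= t ->
    has_law P (X (s + t) \- X s) (distribution P (X t)).

Definition levy_process X : Prop :=
  [/\ {ae P, forall w, X 0 w = 0},
      independent_increments X,
      stationary_increments X &
      {ae P, forall w, cadlag (fun t => X t w)}].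

Definition stable_subordinator (nu : R) X : Prop :=
  [/\ levy_process X,
      {ae P, forall w, forall s t : R, 0 <= s -> s <= t -> X s w <= X t w} &
      forall t lambda : R, 0 <= t -> 0 <= lambda ->
        ('E_P[fun w => expR (- lambda * X t w)%R])%E =
        (expR (- t * lambda `^ nu))%:E].

Definition inverse_stable_subordinator (nu : R) X : Prop :=
  exists D : R -> {RV P >-> R}, stable_subordinator nu D /\
    {ae P, forall w, forall t : R, 0 <= t ->
      X t w = inf [set s : R | 0 <= s /\ t < D s w]}.

(* [fine] is harmless where the moment generating function is finite. *)
Definition cumulant_gen_fun (X : T -> R) (theta : R) : R :=
  ln (fine ('M_P X theta)).

End processes.

(* Weak convergence as [t --> +oo] of random vectors, given by their [h]
   coordinates.  Paths being only almost surely cadlag, [X t] is required to be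
   a random vector up to a [P]-null set; expectations are those of measurable
   versions [V t] and hence do not depend on the version.  The limit may live
   on another probability space. *)
Definition cvg_weakly (R : realType) (h : nat)
    d (T : measurableType d) (P : probability T R) (X : R -> T -> 'rV[R]_h)
    d' (T' : measurableType d') (P' : probability T' R) (Y : T' -> 'rV[R]_h)
    : Prop :=
  (forall i, measurable_fun setT (fun w => Y w ord0 i)) /\
  exists V : R -> 'I_h -> {RV P >-> R},
    (\forall t \near +oo, {ae P, forall w, X t w = \row_i V t i w}) /\
    forall f : 'rV[R]_h -> R, continuous f ->
      (exists M : R, forall x, `|f x| <= M) ->
      ('E_P[fun w => f (\row_i V t i w)])%E @[t --> +oo] -->
      ('E_P'[fun w => f (Y w)])%E.

(* [pi] exhibits [(T', P')] as an extension of the probability space [(T, P)]: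
   a variable [X] on [T] becomes [X \o pi] on [T']. *)
Definition space_extension (R : realType)
    d (T : measurableType d) (P : probability T R)
    d' (T' : measurableType d') (P' : probability T' R) (pi : T' -> T) : Prop :=
  measurable_fun setT pi /\
  forall A, measurable A -> P' (pi @^-1` A) = P A.

Definition index_alpha (R : realType) (h : nat) (m : 'rV[R]_h) (nu : R) : R :=
  if m == 0 then 1 - nu / 2 else 1 - nu.

Definition rescaled_time_change (R : realType) (h k : nat) (T : Type)
    (c : 'I_h -> 'I_k -> R) (alpha : R)
    (S : 'I_h -> R -> T -> R) (L : 'I_k -> R -> T -> R) (t : R) (w : T)
    : 'rV[R]_h :=
  \row_i (t `^ alpha * (S i (\sum_j c i j * L j t w) w / t)).

(* Main.v *)
(** Discretizing the inverse subordinators shows that, for independent time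
    changes, E prod_i f_i (S_i (sum_j c_ij L_j)) depends on the S_i only through
    the functions s |-> E f_i (S_i s), and on the L_j only through their laws.
    Since L_j(t) has the law of t^nu L_j(1) -- the law of a nonnegative variable
    is determined by its Laplace transform, and that of the subordinator is
    self-similar -- the problem reduces to the limit of E f (S (r s) / a) as
    r = t^nu goes to infinity, with a = sqrt r if m = 0 and a = r otherwise.
    Lindeberg's replacement of the increments of S by Gaussian ones gives this
    limit, the central limit theorem or the law of large numbers, for f with a
    uniform third-order Taylor estimate.  The same reduction read backwards
    identifies the limit vector.  Products of such f suffice for weak
    convergence: spline partitions of unity approximate every bounded continuous
    function uniformly on boxes. *)
Require Import Defs.
From HB Require Import structures.
From mathcomp Require Import all_boot all_order all_algebra.
From mathcomp Require Import all_classical all_reals all_analysis.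
From mathcomp Require Import measurable_realfun.
From mathcomp Require Import lra ring.

Set Implicit Arguments.
Unset Strict Implicit.
Unset Printing Implicit Defensive.

Import Order.TTheory GRing.Theory Num.Theory.
Import numFieldNormedType.Exports.

Local Open Scope classical_set_scope.
Local Open Scope ring_scope.

(** * Expectations and independence *)

(** The obstacle is that [S i] at a random time is not visibly measurable: paths are only almost
    surely cadlag, and conditioning on the clocks would need joint measurability in time and chance.
    Hence the [S i] are first evaluated at grid points only, where expectations are finite sums, and
    the passage to the clock itself rests on almost sure right continuity. The coordinates remain
    coupled through the shared [L j], so no coordinate is treated alone. Once each [S i] is averaged
    out, its mean is a deterministic function of the clock; these functions converge at each fixed
    clock value, and bounded convergence integrates their product over the clocks. Test functions
    take values in [0, 1] so that the constant 1 dominates everywhere. The Gaussian substitute in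
    the Lindeberg step may have standard deviation 0, which lets one estimate serve both regimes. *)

Section bounded_integrals.
Context d (T : measurableType d) (R : realType) (P : probability T R).
Implicit Types f g : T -> R.

Lemma integrable_bounded f (M : R) : measurable_fun setT f ->
  (forall w, `|f w| <= M) -> P.-integrable setT (EFin \o f).
Proof.
move=> mf fM; apply: measurable_bounded_integrable => //.
  by have /= -> := probability_setT P; rewrite ltry.
exists M; split; first by rewrite num_real.
by move=> x Mx w _ /=; apply: le_trans (fM w) _; exact: ltW.
Qed.

Lemma EFin_Rintegral f : P.-integrable setT (EFin \o f) ->
  (\int[P]_w f w)%:E = 'E_P[f]%E.
Proof.
by move=> If; rewrite unlock /Rintegral fineK//; exact: integrable_fin_num.
Qed.

Lemma Rintegral_cstT (c : R) : \int[P]_w c = c.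
Proof. by rewrite Rintegral_cst//= probability_setT mulr1. Qed.

Lemma Rintegral_bounds f (a b : R) : measurable_fun setT f ->
  (forall w, a <= f w <= b) -> a <= \int[P]_w f w <= b.
Proof.
move=> mf ab.
have If : P.-integrable setT (EFin \o f).
  apply: (@integrable_bounded _ (`|a| + `|b|)) => // w.
  have /andP[h1 h2] := ab w.
  rewrite ler_norml; apply/andP; split.
    rewrite (le_trans _ h1)// lerNl (le_trans (ler_norm (- a)))//.
    by rewrite normrN lerDl.
  by rewrite (le_trans h2)// (le_trans (ler_norm b))// lerDr.
have Ic (c : R) : P.-integrable setT (EFin \o (fun _ => c)).
  by apply: (@integrable_bounded _ `|c|) => //.
by apply/andP; split; [rewrite -[leLHS]Rintegral_cstT|rewrite -[leRHS]Rintegral_cstT];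
  apply: le_Rintegral => //= w _; have /andP[] := ab w.
Qed.

Lemma ae_eq_Rintegral f g : measurable_fun setT f -> measurable_fun setT g ->
  {ae P, forall w, f w = g w} -> \int[P]_w f w = \int[P]_w g w.
Proof.
move=> mf mg fg; congr fine; apply: ae_eq_integral => //.
- exact/measurable_EFinP.
- exact/measurable_EFinP.
- by apply: filterS fg => w /= + _; move=> ->.
Qed.

Lemma bounded_convergence (f : nat -> T -> R) g (M : R) :
  (forall n, measurable_fun setT (f n)) -> measurable_fun setT g ->
  (forall n w, `|f n w| <= M) ->
  {ae P, forall w, f n w @[n --> \oo] --> g w} ->
  \int[P]_w f n w @[n --> \oo] --> \int[P]_w g w.
Proof.
move=> mf mg fM fg.
have [] := @dominated_convergence _ _ _ P setT measurableT
  (fun n => EFin \o f n) (EFin \o g) (EFin \o cst M).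
- by move=> n; exact/measurable_EFinP.
- exact/measurable_EFinP.
- by apply: filterS fg => w /= + _; move=> fg; apply/cvg_EFin => //; apply: nearW.
- apply: (@integrable_bounded _ `|M|) => //.
- by apply: aeW => w n _ /=; rewrite lee_fin.
move=> Ig _ h.
apply: fine_cvg.
by rewrite fineK//; apply: integrable_fin_num.
Qed.

(* limsup is a measurable candidate; it equals the limit wherever that exists *)
Lemma measurable_version_of_limit (X : nat -> T -> R) (Y : T -> R) :
  (forall n, measurable_fun setT (X n)) ->
  {ae P, forall w, X n w @[n --> \oo] --> Y w} ->
  exists2 V : T -> R, measurable_fun setT V & {ae P, forall w, V w = Y w}.
Proof.
move=> mX XY.
exists (fun w => fine (limn_esup (fun n => (X n w)%:E))).
  apply: (measurableT_comp (fine_measurable measurableT)).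
  apply: measurable_fun_limn_esup => // n; exact/measurable_EFinP.
apply: filterS XY => w /= XY.
have h : (X n w)%:E @[n --> \oo] --> (Y w)%:E by apply/cvg_EFin => //; exact: nearW.
by rewrite (cvg_limn_einf_sup h).2.
Qed.

End bounded_integrals.

Section finite_sums.
Context d (T : measurableType d) (R : realType) (P : probability T R).

Lemma Rintegral_sum (I : Type) (s : seq I) (F : I -> T -> R) :
  (forall i, P.-integrable setT (EFin \o F i)) ->
  \int[P]_w (\sum_(i <- s) F i w) = \sum_(i <- s) \int[P]_w F i w.
Proof.
move=> IF; elim: s => [|a s IHs].
  rewrite big_nil -[RHS](Rintegral_cstT P).
  by apply: eq_Rintegral => w _; rewrite big_nil.
rewrite big_cons -IHs -RintegralD//; first by apply: eq_Rintegral => w _; rewrite big_cons.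
suff -> : EFin \o (fun w => \sum_(i <- s) F i w) =
    (fun w => \sum_(i <- s) (EFin \o F i) w)%E by apply: integrable_sum.
by apply/funext => w /=; rewrite sumEFin.
Qed.

Lemma Rintegral_bool (b : T -> bool) : measurable [set w | b w] ->
  \int[P]_w (b w)%:R = fine (P [set w | b w]).
Proof.
move=> mb; rewrite /Rintegral; congr fine.
rewrite -[in RHS](setIT [set w | b w]) -integral_indic//.
by apply: eq_integral => w _; rewrite indicE mem_setE.
Qed.

Lemma measurable_bool (b : T -> bool) : measurable [set w | b w] ->
  measurable_fun setT (fun w => (b w)%:R : R).
Proof.
move=> mb; rewrite (_ : (fun w => _) = \1_[set w | b w]); first exact: measurable_indic.
by apply/funext => w; rewrite indicE mem_setE.
Qed.

Lemma measurable_preimage (f : T -> R) (B : set R) : measurable_fun setT f ->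
  measurable B -> measurable (f @^-1` B).
Proof. by move=> mf mB; rewrite -[_ @^-1` _]setTI; exact: mf. Qed.

End finite_sums.

Section products.
Variable R : realType.

Lemma cvg_prodr (I : finType) (U : Type) (F : set_system U) (FF : Filter F)
    (f : I -> U -> R) (l : I -> R) :
  (forall i, f i x @[x --> F] --> l i) ->
  \prod_i f i x @[x --> F] --> \prod_i l i.
Proof. by move=> fl; apply: cvg_big => //; exact: mul_continuous. Qed.

Lemma measurable_prodr d (T : measurableType d) (I : finType) (f : I -> T -> R) :
  (forall i, measurable_fun setT (f i)) ->
  measurable_fun setT (fun w => \prod_i f i w).
Proof.
move=> mf; elim: (index_enum I) => [|a s IHs].
  by under eq_fun do rewrite big_nil; exact: measurable_cst.
by under eq_fun do rewrite big_cons; exact: measurable_funM.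
Qed.

End products.

(* [bin n N x] is the index of the cell of width [1 / n.+1] containing [x],
   all points outside [0, N / n.+1] being absorbed by the two extreme cells. *)
Section binning.
Variable R : realType.

Definition bin (n N : nat) (x : R) : 'I_N.+1 :=
  inord (minn (Num.truncn (x * n.+1%:R)) N).

Lemma val_bin n N x : bin n N x = minn (Num.truncn (x * n.+1%:R)) N :> nat.
Proof. by rewrite inordK// ltnS geq_minr. Qed.

(** Cells are written as differences of nested open left rays so that their probabilities can be
    read off from s -> P[X < s], the form in which laws of clocks are compared. *)
Lemma bin_setE n N (q : 'I_N.+1) : [set x | bin n N x == q] =
  (if (q < N)%N then `]-oo, q.+1%:R / n.+1%:R[%classic else setT) `\`
  (if (0 < q)%N then `]-oo, q%:R / n.+1%:R[%classic else set0).
Proof.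
have n0 : 0 < n.+1%:R :> R by rewrite ltr0n.
have lowE (m : nat) (x : R) : (Num.truncn (x * n.+1%:R) <= m)%N = (x < m.+1%:R / n.+1%:R).
  by rewrite truncn_le_nat ltr_pdivlMr.
apply/seteqP; split=> x /=.
  rewrite -val_eqE/= val_bin => /eqP qE; split.
    case: ifPn => // qN /=; rewrite in_itv/= -lowE -qE.
    move: qN; rewrite -qE gtn_min ltnn orbF => /ltnW h.
    by rewrite (minn_idPl h).
  case: ifPn => [q0|_]; last by [].
  rewrite /= in_itv/= -qE; apply/negP; rewrite -leNgt ler_pdivrMr//.
  move: q0; rewrite -qE => q0.
  have : (0 < Num.truncn (x * n.+1%:R))%N by rewrite (leq_trans q0)// geq_minl.
  rewrite truncn_gt0 => x1.
  apply: (@le_trans _ _ (Num.truncn (x * n.+1%:R))%:R).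
    by rewrite ler_nat geq_minl.
  by rewrite truncn_le (le_trans _ x1).
move=> [hi lo]; apply/eqP/val_inj => /=; rewrite val_bin.
have h1 : (q <= Num.truncn (x * n.+1%:R))%N.
  move: lo; case: ifPn => /= [q0|]; last by rewrite -leqNgt leqn0 => /eqP ->.
  rewrite in_itv/= => /negP; rewrite -leNgt; case: (nat_of_ord q) q0 => // m _.
  by rewrite truncn_gt_nat ler_pdivrMr.
move: hi; case: ifPn => /= [qN|].
  rewrite in_itv/= -lowE => h2; have -> : Num.truncn (x * n.+1%:R) = q.
    by apply/eqP; rewrite eqn_leq h1 h2.
  by apply/minn_idPl; exact: ltnW.
rewrite -leqNgt => Nq _; have -> : nat_of_ord q = N.
  by apply/eqP; rewrite eqn_leq Nq -ltnS ltn_ord.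
by apply/minn_idPr; rewrite (leq_trans Nq).
Qed.

Lemma measurable_bin n N (q : 'I_N.+1) : measurable [set x | bin n N x == q].
Proof. by rewrite bin_setE; apply: measurableD; case: ifP. Qed.

Lemma bin_bounds n N x : 0 <= x -> x * n.+1%:R < N.+1%:R ->
  (bin n N x)%:R / n.+1%:R <= x < (bin n N x).+1%:R / n.+1%:R.
Proof.
move=> x0 xN; have n0 : 0 < n.+1%:R :> R by rewrite ltr0n.
rewrite ler_pdivrMr// ltr_pdivlMr// val_bin (minn_idPl _) ?truncn_itv ?mulr_ge0//.
by rewrite truncn_le_nat.
Qed.

End binning.

Section independence_products.
Context d (T : measurableType d) (R : realType) (P : probability T R).

Lemma mutually_independent_inj (I J : finType) (G : I -> set (set T)) (phi : J -> I) :
  injective phi -> mutually_independent P G -> mutually_independent P (G \o phi).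
Proof.
move=> phi_inj indG K A GA.
(* The left inverse [psi] of [phi] needs a default index, which only a nonempty [K] provides. *)
have [->|K0] := eqVneq K finset.set0.
  rewrite big_set0 (_ : \bigcap_(_ in _) _ = setT) ?probability_setT//.
  by apply/seteqP; split => // w _ i /=; rewrite inE.
have [j0 _] := set0Pn _ K0.
pose psi (i : I) := odflt j0 [pick j | phi j == i].
have psiK j : psi (phi j) = j.
  rewrite /psi; case: pickP => [j' /eqP /phi_inj //|/(_ j)]; by rewrite eqxx.
have := indG (phi @: K)%SET (A \o psi).
rewrite big_imset/=; last by move=> x y _ _; exact: phi_inj.
under eq_bigr do rewrite psiK.
move=> <-.
  congr (P _); apply/seteqP; split => w /=.
    by move=> h i /= /imsetP[j jK ->]; rewrite psiK; apply: h.
  by move=> h j /= jK; rewrite -[j]psiK; apply: h => /=; apply: imset_f.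
by move=> i /imsetP[j jK ->]; rewrite psiK; apply: GA.
Qed.

(** Rounding each [W i] down to a grid gives simple functions; the expectation of their product
    expands into probabilities of finite intersections, which is where mutual independence applies.
    The mesh then tends to 0. *)
Lemma Rintegral_prod_independent (I : finType) (G : I -> set (set T)) (W : I -> T -> R) :
  mutually_independent P G ->
  (forall i, measurable_fun setT (W i)) -> (forall i w, 0 <= W i w <= 1) ->
  (forall i B, measurable B -> G i (W i @^-1` B)) ->
  \int[P]_w \prod_i W i w = \prod_i \int[P]_w W i w.
Proof.
move=> indG mW W01 GW.
(* There are [n.+2] cells, so that even the value 1 has a cell of its own and nothing is absorbed.
   [e n i q] is the part of [D n i] carried by cell [q]. *)
pose D n i w : R := (bin n n.+1 (W i w))%:R / n.+1%:R.
pose e n i (q : 'I_n.+2) w : R := q%:R / n.+1%:R * (bin n n.+1 (W i w) == q)%:R.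
have DE n i w : D n i w = \sum_q e n i q w.
  rewrite (bigD1 (bin n n.+1 (W i w)))//= /e eqxx mulr1 big1 ?addr0// => q.
  by rewrite eq_sym => /negbTE ->; rewrite mulr0.
have mcell n i q : measurable [set w | bin n n.+1 (W i w) == q].
  rewrite (_ : [set w | _] = W i @^-1` [set x | bin n n.+1 x == q])//.
  by apply: measurable_preimage => //; exact: measurable_bin.
have me n i q : measurable_fun setT (e n i q).
  by apply: measurable_funM => //; exact: measurable_bool.
have e01 n i q w : 0 <= e n i q w <= 2.
  rewrite /e mulr_ge0//= ?divr_ge0//; case: eqP => _; rewrite ?mulr1 ?mulr0//.
  rewrite ler_pdivrMr ?ltr0n// -natrM ler_nat (leq_trans (ltnW (ltn_ord q)))//.
  by rewrite mul2n -addnn addSn ltnS leq_addl.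
have mD n i : measurable_fun setT (D n i).
  rewrite (_ : D n i = fun w => \sum_q e n i q w); first exact: measurable_sum.
  by apply/funext => w; exact: DE.
have bounds n i w : D n i w <= W i w /\ W i w <= D n i w + n.+1%:R^-1.
  have /andP[h1 h2] := W01 i w.
  have /andP[h3 h4] : D n i w <= W i w < (bin n n.+1 (W i w)).+1%:R / n.+1%:R.
    apply: bin_bounds => //.
    by rewrite (le_lt_trans (ler_wpM2r _ h2))// mul1r ltr_nat.
  by split=> //; rewrite (le_trans (ltW h4))// -natr1 mulrDl mul1r.
have D01 n i w : 0 <= D n i w <= 1.
  have /andP[h1 h2] := W01 i w.
  by rewrite divr_ge0//= (le_trans _ h2)//; have [] := bounds n i w.
have intD n : \int[P]_w \prod_i D n i w = \prod_i \int[P]_w D n i w.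
  have -> : \prod_i \int[P]_w D n i w = \prod_i \sum_q \int[P]_w e n i q w.
    apply: eq_bigr => i _; rewrite -Rintegral_sum; last first.
      move=> q; apply: (@integrable_bounded _ _ _ _ _ 2) => // w.
      by rewrite ger0_norm; have /andP[] := e01 n i q w.
    by apply: eq_Rintegral => w _; rewrite DE.
  (* Both sides become sums over the choices [f] of one cell per index, and are compared term by
     term. *)
  rewrite bigA_distr_bigA/=.
  have -> : \int[P]_w \prod_i D n i w =
      \int[P]_w \sum_(f : {ffun I -> 'I_n.+2}) \prod_i e n i (f i) w.
    apply: eq_Rintegral => w _; rewrite -(bigA_distr_bigA (fun i q => e n i q w)).
    by apply: eq_bigr => i _; rewrite DE.
  have prodE (f : {ffun I -> 'I_n.+2}) w : \prod_i e n i (f i) w =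
      (\prod_i ((f i)%:R / n.+1%:R)) * [forall i, bin n n.+1 (W i w) == f i]%:R.
    rewrite /e big_split/=; congr (_ * _).
    case: forallP => [h|/forallP]; first by rewrite big1// => i _; rewrite h.
    by rewrite negb_forall => /existsP[i /negbTE h]; rewrite (bigD1 i)//= h mul0r.
  have mall (f : {ffun I -> 'I_n.+2}) :
      measurable [set w | [forall i, bin n n.+1 (W i w) == f i]].
    rewrite (_ : [set w | _] =
        \bigcap_(i in [set` enum I]) [set w | bin n n.+1 (W i w) == f i]).
      exact: fin_bigcap_measurable.
    apply/seteqP; split=> w /=; first by move/forallP => h i _; exact: h.
    by move=> h; apply/forallP => i; apply: h => /=; rewrite mem_enum.
  rewrite Rintegral_sum; last first.
    move=> f; apply: (@integrable_bounded _ _ _ _ _ (\prod_(i : I) 2)).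
      exact: measurable_prodr.
    move=> w; rewrite normr_prod; apply: ler_prod => i _.
    by rewrite normr_ge0 ger0_norm; have /andP[] := e01 n i (f i) w.
  apply: eq_bigr => f _.
  transitivity (\int[P]_w ((\prod_i ((f i)%:R / n.+1%:R)) *
      [forall i, bin n n.+1 (W i w) == f i]%:R)).
    by apply: eq_Rintegral => w _; exact: prodE.
  rewrite RintegralZl//; last first.
    apply: (@integrable_bounded _ _ _ _ _ 1); first exact: measurable_bool.
    by move=> w; case: forallP; rewrite ?normr1 ?normr0.
  rewrite Rintegral_bool//.
  have eE i : \int[P]_w e n i (f i) w =
      (f i)%:R / n.+1%:R * fine (P [set w | bin n n.+1 (W i w) == f i]).
    rewrite RintegralZl//; last first.
      apply: (@integrable_bounded _ _ _ _ _ 1); first exact: measurable_bool.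
      by move=> w; case: eqP; rewrite ?normr1 ?normr0.
    by rewrite Rintegral_bool.
  rewrite (eq_bigr _ (fun i _ => eE i)).
  rewrite [RHS]big_split/=; congr (_ * _).
  have := indG finset.setT (fun i => [set w | bin n n.+1 (W i w) == f i]).
  rewrite (_ : \bigcap_(i in _) _ =
      [set w | [forall i, bin n n.+1 (W i w) == f i]]); last first.
    apply/seteqP; split=> w /=; last by move/forallP => h i _; exact: h.
    by move=> h; apply/forallP => i; apply: h; rewrite /= inE.
  move=> ->; last first.
    move=> i _; rewrite (_ : [set w | _] = W i @^-1` [set x | bin n n.+1 x == f i])//.
    by apply: GW; exact: measurable_bin.
  rewrite (eq_bigr (fun i => (fine (P [set w | bin n n.+1 (W i w) == f i]))%:E)); last first.
    by move=> i _; rewrite fineK// fin_num_measure.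
  by rewrite prodEFin/=; apply: eq_bigl => i; rewrite inE.
have DW i w : D n i w @[n --> \oo] --> W i w.
  apply: (@squeeze_cvgr _ _ _ _ (fun n => W i w - n.+1%:R^-1) (fun=> W i w)).
  - apply: nearW => n; have [h1 h2] := bounds n i w.
    by rewrite h1 andbT lerBlDr.
  - rewrite -[X in _ --> X]subr0; apply: cvgB; first exact: cvg_cst.
    exact: cvg_harmonic.
  - exact: cvg_cst.
have cvgl : \int[P]_w \prod_i D n i w @[n --> \oo] --> \int[P]_w \prod_i W i w.
  apply: (@bounded_convergence _ _ _ _ _ _ 1).
  - by move=> n; exact: measurable_prodr.
  - exact: measurable_prodr.
  - move=> n w; rewrite normr_prod prodr_ile1// => i _.
    by have /andP[D0 D1] := D01 n i w; rewrite normr_ge0 ger0_norm.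
  - by apply: aeW => w; exact: cvg_prodr.
have cvgr : \prod_i \int[P]_w D n i w @[n --> \oo] --> \prod_i \int[P]_w W i w.
  apply: cvg_prodr => i; apply: (@bounded_convergence _ _ _ _ _ _ 1) => //.
    by move=> n w; have /andP[D0 D1] := D01 n i w; rewrite ger0_norm.
  exact: aeW.
have := cvg_unique (@Rhausdorff R) cvgl; apply.
by move: cvgr; under eq_fun do rewrite -intD.
Qed.

End independence_products.

(** * Independent time changes *)

Section time_change.
Variables (R : realType) (k : nat).

(* Right endpoints, so that the discretized clock decreases strictly to the
   clock and right continuity of the paths suffices. *)
Definition clock_grid n (q : 'I_(n.+1 ^ 2).+1) : R := q.+1%:R / n.+1%:R.

Definition clock (c : 'I_k -> R) n (q : 'I_k -> 'I_(n.+1 ^ 2).+1) : R :=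
  \sum_j c j * clock_grid (q j).

Definition clock_bin (l : 'I_k -> R) n j : 'I_(n.+1 ^ 2).+1 :=
  bin n (n.+1 ^ 2) (l j).

(** With (n+1)^2 cells of width 1/(n+1) the mesh shrinks while the grid reaches n+1, hence
    eventually passes any given [x]. *)
Lemma clock_grid_cvg (x : R) : 0 <= x ->
  clock_grid (bin n (n.+1 ^ 2) x) @[n --> \oo] --> x /\
  \forall n \near \oo, x < clock_grid (bin n (n.+1 ^ 2) x).
Proof.
move=> x0.
have H : \forall n \near \oo, x < clock_grid (bin n (n.+1 ^ 2) x) <= x + n.+1%:R^-1.
  near=> n.
  have xn : x < n.+1%:R.
    rewrite (lt_trans (truncnS_gt x))// ltr_nat ltnS.
    by near: n; exists (Num.truncn x).+1.
  have n0 : 0 < n.+1%:R :> R by rewrite ltr0n.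
  have /andP[h1 h2] : (bin n (n.+1 ^ 2) x)%:R / n.+1%:R <= x < clock_grid (bin n (n.+1 ^ 2) x).
    apply: bin_bounds => //; rewrite -[(_ ^ 2).+1]addn1 natrD natrX expr2.
    by rewrite (lt_le_trans (_ : _ < n.+1%:R * n.+1%:R))// ?ltr_pM2r// lerDl.
  by rewrite h2 /clock_grid -natr1 mulrDl mul1r lerD2r.
split; last by apply: filterS H => n /andP[].
apply: (@squeeze_cvgr _ _ _ _ (fun=> x) (fun n => x + n.+1%:R^-1)).
- by apply: filterS H => n /andP[/ltW -> ->].
- exact: cvg_cst.
- rewrite -[X in _ --> X]addr0; apply: cvgD; first exact: cvg_cst.
  exact: cvg_harmonic.
Unshelve. all: by end_near. Qed.

(** Each grid point eventually exceeds [l j] strictly; this survives in the sum because there is at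
    least one summand and the coefficients are positive. Convergence to the right filter is what
    right-continuous paths can be composed with. *)
Lemma clock_cvg_right (c l : 'I_k -> R) : (0 < k)%N -> (forall j, 0 < c j) ->
  (forall j, 0 <= l j) ->
  clock c (clock_bin l n) @[n --> \oo] --> (\sum_j c j * l j)^'+.
Proof.
move=> k0 c0 l0.
have cv : clock c (clock_bin l n) @[n --> \oo] --> \sum_j c j * l j.
  apply: cvg_big => //; first exact: add_continuous.
  move=> j _; apply: cvgM; first exact: cvg_cst.
  by have [] := clock_grid_cvg (l0 j).
have gt : \forall n \near \oo, \sum_j c j * l j < clock c (clock_bin l n).
  have : \forall n \near \oo, forall j, l j < clock_grid (clock_bin l n j).
    apply: filter_forall => j; by have [] := clock_grid_cvg (l0 j).
  apply: filterS => n h; rewrite /clock; apply: ltr_sum => //.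
    by apply/hasP; exists (Ordinal k0) => //; rewrite mem_index_enum.
  by move=> j _; rewrite ltr_pM2l.
by move=> A sA; apply: filterS2 gt (cv _ sA) => n h1; exact.
Qed.

Lemma clock_ge0 (c : 'I_k -> R) n (q : 'I_k -> 'I_(n.+1 ^ 2).+1) :
  (forall j, 0 < c j) -> 0 <= clock c q.
Proof. by move=> c0; apply: sumr_ge0 => j _; rewrite mulr_ge0 ?divr_ge0// ltW. Qed.

Variables (d : measure_display) (T : measurableType d) (L : 'I_k -> T -> R).
Hypothesis mL : forall j, measurable_fun setT (L j).

Lemma measurable_clock_bin n j q :
  measurable [set w | clock_bin (fun j => L j w) n j == q].
Proof.
rewrite (_ : [set w | _] = L j @^-1` [set x | bin n (n.+1 ^ 2) x == q])//.
by apply: measurable_preimage => //; exact: measurable_bin.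
Qed.

(** Trades a random index for a finite sum over deterministic ones. This gives both the
    measurability of a process at a discretized clock and the factorization of its expectation. *)
Lemma sum_over_bins n (F : ('I_k -> 'I_(n.+1 ^ 2).+1) -> R) (l : 'I_k -> R) :
  F (clock_bin l n) = \sum_(q : {ffun 'I_k -> 'I_(n.+1 ^ 2).+1})
    F q * \prod_j (clock_bin l n j == q j)%:R.
Proof.
rewrite (bigD1 [ffun j => clock_bin l n j])//= [X in _ + X]big1 ?addr0 => [|q qN].
  rewrite big1 ?mulr1 => [|j _]; last by rewrite ffunE eqxx.
  by congr F; apply/funext => j; rewrite ffunE.
suff [j /negbTE jN] : exists j, clock_bin l n j != q j.
  by rewrite (bigD1 j)//= jN mul0r mulr0.
apply/existsP; rewrite -negb_forall; apply: contra qN => /forallP h.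
by apply/eqP/ffunP => j; rewrite ffunE; apply/esym/eqP.
Qed.

Lemma measurable_time_change n (Y : R -> T -> R) (c : 'I_k -> R) :
  (forall j, 0 < c j) -> (forall s, 0 <= s -> measurable_fun setT (Y s)) ->
  measurable_fun setT (fun w => Y (clock c (clock_bin (fun j => L j w) n)) w).
Proof.
move=> c0 mY; under eq_fun do rewrite (sum_over_bins (fun q => Y (clock c q) _)).
apply: measurable_sum => q; apply: measurable_funM.
  exact/mY/clock_ge0.
by apply: measurable_prodr => j; exact/measurable_bool/measurable_clock_bin.
Qed.

End time_change.

Section time_change_expectation.
Variables (R : realType) (h k : nat) (c : 'I_h -> 'I_k -> R).
Hypotheses (k_gt0 : (0 < k)%N) (c_gt0 : forall i j, 0 < c i j).

(** The probability of cell [q] for a variable with F s = P[X < s]; the values 1 and 0 at the two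
    ends are the mass absorbed by the extreme cells. *)
Definition bin_weight (F : R -> R) n N (q : 'I_N.+1) : R :=
  (if (q < N)%N then F (q.+1%:R / n.+1%:R) else 1) -
  (if (0 < q)%N then F (q%:R / n.+1%:R) else 0).

Definition time_change_sum (y : 'I_h -> R -> R) (F : 'I_k -> R -> R) n : R :=
  \sum_(q : {ffun 'I_k -> 'I_(n.+1 ^ 2).+1})
    (\prod_i y i (clock (c i) q)) * \prod_j bin_weight (F j) n (q j).

Section one_space.
Context d (T : measurableType d) (P : probability T R).
Variables (Y : 'I_h -> R -> T -> R) (L : 'I_k -> T -> R).
Variables (GY : 'I_h -> set (set T)) (GL : 'I_k -> set (set T)).
Hypothesis ind : mutually_independent P
  (fun a : 'I_h + 'I_k => match a with inl i => GY i | inr j => GL j end).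
Hypotheses (mL : forall j, measurable_fun setT (L j))
  (GLL : forall j B, measurable B -> GL j (L j @^-1` B))
  (L_ge0 : forall j, {ae P, forall w, 0 <= L j w}).
Hypotheses (mY : forall i s, 0 <= s -> measurable_fun setT (Y i s))
  (GYY : forall i s B, 0 <= s -> measurable B -> GY i (Y i s @^-1` B))
  (Y01 : forall i s w, 0 <= Y i s w <= 1)
  (Y_right : forall i, {ae P, forall w s, 0 <= s -> Y i x w @[x --> s^'+] --> Y i s w}).

Lemma bin_weightE n j (q : 'I_(n.+1 ^ 2).+1) :
  fine (P [set w | clock_bin (fun j => L j w) n j == q]) =
  bin_weight (fun s => fine (P [set w | L j w < s])) n q.
Proof.
rewrite (_ : [set w | _] = L j @^-1` [set x | bin n (n.+1 ^ 2) x == q])//.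
have mlt s : measurable [set w | L j w < s].
  rewrite (_ : [set w | _] = L j @^-1` `]-oo, s[%classic); first exact: measurable_preimage.
  by apply/seteqP; split => w /=; rewrite in_itv.
have ltE s : L j @^-1` `]-oo, s[%classic = [set w | L j w < s].
  by apply/seteqP; split => w /=; rewrite in_itv.
pose A := L j @^-1`
  (if (q < n.+1 ^ 2)%N then `]-oo, q.+1%:R / n.+1%:R[%classic else setT).
pose B := L j @^-1` (if (0 < q)%N then `]-oo, q%:R / n.+1%:R[%classic else set0).
rewrite bin_setE -[X in P X]/(A `\` B) /bin_weight.
have mA : measurable A by rewrite /A; case: ifP => _; rewrite ?preimage_setT// ltE.
have mB : measurable B by rewrite /B; case: ifP => _; rewrite ?preimage_set0// ltE.
have BA : B `<=` A.
  rewrite /A /B => w; case: ifPn => // q0; case: ifPn => // qN.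
  move: (congr1 (@^~ w) (ltE (q%:R / n.+1%:R))) (congr1 (@^~ w) (ltE (q.+1%:R / n.+1%:R))).
  move=> /= -> -> /lt_le_trans; apply.
  by rewrite ler_pM2r ?invr_gt0 ?ltr0n// ler_nat.
rewrite measureD//; last by rewrite ltey_eq fin_num_measure.
rewrite (setIidr BA) fineB ?fin_num_measure//; congr (_ - _).
  rewrite /A; case: ifP => _; first by rewrite ltE.
  by rewrite preimage_setT; have /= -> := probability_setT P.
by rewrite /B; case: ifP => _; rewrite ?preimage_set0 ?measure0// ltE.
Qed.

(** With the bins frozen at [q], every factor is a function of one of the independent families:
    [Y i] at a deterministic time, or the indicator that [L j] falls in cell [q j]. *)
Lemma time_change_sumE n :
  \int[P]_w \prod_i Y i (clock (c i) (clock_bin (fun j => L j w) n)) w =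
  time_change_sum (fun i s => \int[P]_w Y i s w)
    (fun j s => fine (P [set w | L j w < s])) n.
Proof.
pose N := (n.+1 ^ 2)%N.
pose W (q : 'I_k -> 'I_N.+1) (a : 'I_h + 'I_k) w : R := match a with
  | inl i => Y i (clock (c i) q) w
  | inr j => (clock_bin (fun j => L j w) n j == q j)%:R end.
have mW q a : measurable_fun setT (W q a).
  case: a => [i|j]; first exact/mY/clock_ge0.
  exact/measurable_bool/measurable_clock_bin.
have W01 q a w : 0 <= W q a w <= 1.
  by case: a => [i|j] /=; [exact: Y01|case: eqP; rewrite /= ?ler01 ?lexx].
have prodE q w : \prod_a W q a w = (\prod_i Y i (clock (c i) q) w) *
    \prod_j (clock_bin (fun j => L j w) n j == q j)%:R.
  by rewrite big_sumType.
transitivity (\sum_(q : {ffun 'I_k -> 'I_N.+1}) \int[P]_w \prod_a W q a w).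
  rewrite -Rintegral_sum; last first.
    move=> q; apply: (@integrable_bounded _ _ _ _ _ 1); first exact: measurable_prodr.
    move=> w; rewrite normr_prod prodr_ile1// => a _.
    by have /andP[h1 h2] := W01 q a w; rewrite normr_ge0 ger0_norm.
  apply: eq_Rintegral => w _.
  rewrite (sum_over_bins (fun q => \prod_i Y i (clock (c i) q) w)).
  by apply: eq_bigr => q _; rewrite prodE.
apply: eq_bigr => q _.
rewrite (Rintegral_prod_independent ind)//; last first.
  case=> [i|j] B mB; first by apply: GYY => //; exact: clock_ge0.
  rewrite (_ : W q (inr j) @^-1` B =
    L j @^-1` [set x | B (bin n N x == q j)%:R])//; apply: GLL.
  rewrite (_ : [set x | _] = (fun x => (bin n N x == q j)%:R : R) @^-1` B)//.
  by apply: measurable_preimage => //; apply/measurable_bool; exact: measurable_bin.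
rewrite big_sumType/=; congr (_ * _); apply: eq_bigr => j _.
by rewrite Rintegral_bool ?bin_weightE//; exact: measurable_clock_bin.
Qed.

(* By independence the discretized expectation involves the processes only
   through their means and the laws of the [L j]; any two systems that share
   these therefore share the limit. *)
Lemma time_change_limit W : measurable_fun setT W ->
  {ae P, forall w, W w = \prod_i Y i (\sum_j c i j * L j w) w} ->
  time_change_sum (fun i s => \int[P]_w Y i s w)
    (fun j s => fine (P [set w | L j w < s])) n @[n --> \oo] --> \int[P]_w W w.
Proof.
move=> mW WE; under eq_fun do rewrite -time_change_sumE.
apply: (@bounded_convergence _ _ _ _ _ _ 1) => //.
- by move=> n; apply: measurable_prodr => i; apply: measurable_time_change => //; exact: mY.
- move=> n w; rewrite normr_prod prodr_ile1// => i _.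
  by have /andP[h1 h2] := Y01 i (clock (c i) (clock_bin (fun j => L j w) n)) w;
    rewrite normr_ge0 ger0_norm.
have L0 : {ae P, forall w, forall j, 0 <= L j w} by exact: filter_forall.
have Yr : {ae P, forall w, forall i s, 0 <= s -> Y i x w @[x --> s^'+] --> Y i s w}.
  exact: filter_forall.
apply: filterS3 WE L0 Yr => w -> {}L0 Yr.
apply: cvg_prodr => i.
have h1 := clock_cvg_right k_gt0 (c_gt0 i) L0.
apply: (@cvg_comp _ _ _ _ (fun x => Y i x w) _ _ _ h1).
apply: Yr; apply: sumr_ge0 => j _; by rewrite mulr_ge0// ltW.
Qed.

End one_space.
End time_change_expectation.

(** * Inverse stable subordinators *)

Section laplace_tails.
Variable R : realType.

(** Bernoulli's inequality; with the next lemma it decides the limit of (1 - v)^N from that of N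
    v. *)
Lemma onem_exp_ge (v : R) N : 0 <= v <= 1 -> 1 - N%:R * v <= (1 - v) ^+ N.
Proof.
move=> /andP[v0 v1]; elim: N => [|N IHN]; first by rewrite mul0r subr0 expr0.
rewrite exprS; have h : 0 <= 1 - v by rewrite subr_ge0.
apply: le_trans (ler_wpM2l h IHN).
rewrite -natr1; have N0 : (0 : R) <= N%:R by [].
by have := mulr_ge0 N0 (mulr_ge0 v0 v0); lra.
Qed.

Lemma onem_exp_le (v : R) N : v <= 1 -> (1 - v) ^+ N <= expR (- (N%:R * v)).
Proof.
move=> v1; rewrite -mulrN expRM_natl lerXn2r ?nnegrE ?expR_ge0 ?subr_ge0//.
exact: expR_ge1Dx.
Qed.

(** This is (1 - 2^(-n x))^N with N = n 2^n, a linear combination of exponentials, so its mean is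
    determined by the Laplace transform. Since N 2^(-n x) = n 2^(n (1 - x)), it tends to 1 for x > 1
    and to 0 for x <= 1. *)
Definition tail_kernel (n : nat) (x : R) : R :=
  (1 - expR (- (n%:R * ln 2) * x)) ^+ (n * 2 ^ n).

Let ln2_gt0 : 0 < ln 2 :> R.
Proof. by rewrite ln_gt0// ltr1n. Qed.

Lemma tail_kernel01 n x : 0 <= x -> 0 <= tail_kernel n x <= 1.
Proof.
move=> x0; have h : 0 <= expR (- (n%:R * ln 2) * x) <= 1.
  rewrite expR_ge0 -[leRHS]expR0 ler_expR mulNr oppr_le0.
  by rewrite !mulr_ge0// ltW.
rewrite exprn_ge0 ?exprn_ile1//; move: h; lra.
Qed.

(* The exponent n 2^n puts the jump at x = 1 itself on the side of the limit 0:
   there the kernel is (1 - 2^-n)^(n 2^n) <= exp (- n). *)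
Lemma tail_kernel_cvg (x : R) : 0 <= x ->
  tail_kernel n x @[n --> \oo] --> ((1 < x)%R%:R : R).
Proof.
move=> x0.
pose v n := expR (- (n%:R * ln 2) * x).
have v01 n : 0 <= v n <= 1.
  rewrite /v expR_ge0 -[leRHS]expR0 ler_expR mulNr oppr_le0.
  by rewrite !mulr_ge0// ltW.
have NvE n : (n * 2 ^ n)%:R * v n = n%:R * expR (n%:R * (ln 2 * (1 - x))).
  rewrite natrM natrX -mulrA; congr (_ * _).
  have {1}-> : (2 : R) = expR (ln 2) by rewrite lnK// posrE.
  by rewrite -expRM_natl /v -expRD; congr expR; ring.
case: ltP => [x1|x1] /=.
- pose c := ln 2 * (x - 1); have c0 : 0 < c by rewrite mulr_gt0// subr_gt0.
  (* Here N v = n e^(-c n), and e^y >= 1 + y^2 / 2 bounds it by 2 / (c^2 n); [n.-1.+1] equals [n]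
     for positive [n] and avoids a zero denominator. *)
  apply: (@squeeze_cvgr _ _ _ _ (fun n => 1 - (2 / c ^+ 2) * n.-1.+1%:R^-1) (fun=> 1)).
  + near=> n; have [_ ->] := andP (tail_kernel01 n x0); rewrite andbT.
    apply: le_trans (onem_exp_ge _ (v01 n)).
    have n0 : (0 < n)%N by near: n; exists 1%N.
    rewrite prednK// NvE lerB//.
    have -> : n%:R * (ln 2 * (1 - x)) = - (n%:R * c) by rewrite /c; ring.
    have n0' : 0 < n%:R :> R by rewrite ltr0n.
    have cn : 0 < c * n%:R by rewrite mulr_gt0.
    have h := expR_ge1Dxn 1 (ltW cn).
    rewrite expRN (mulrC _ c) ler_pdivrMr ?expR_gt0//.
    apply: le_trans (ler_wpM2l _ h); last by rewrite !mulr_ge0// ?invr_ge0 ?exprn_ge0// ltW.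
    rewrite (_ : 2`!%:R = 2)//.
    have -> : 2 / c ^+ 2 / n%:R * (1 + (c * n%:R) ^+ 2 / 2) = 2 / c ^+ 2 / n%:R + n%:R.
      by field; rewrite !gt_eqF.
    by rewrite lerDr !mulr_ge0// ?invr_ge0 ?exprn_ge0// ltW.
  + rewrite -[X in _ --> X]subr0; apply: cvgB; first exact: cvg_cst.
    rewrite -(mulr0 (2 / c ^+ 2)); apply: cvgM; first exact: cvg_cst.
    rewrite -(cvg_shiftS (fun n : nat => n.-1.+1%:R^-1 : R)) /=.
    exact: cvg_harmonic.
  + exact: cvg_cst.
- apply: (@squeeze_cvgr _ _ _ _ (fun=> 0) (fun n => expR (- 1) ^+ n)).
  + apply: nearW => n; have [-> _] := andP (tail_kernel01 n x0) => /=.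
    have [_ v1] := andP (v01 n).
    apply: le_trans (onem_exp_le _ v1) _; rewrite -expRM_natl ler_expR mulrN1 lerN2.
    rewrite NvE ler_peMr// -[leLHS]expR0 ler_expR !mulr_ge0 ?subr_ge0//; exact: ltW.
  + exact: cvg_cst.
  + by apply: cvg_expr; rewrite ger0_norm ?expR_ge0// -expR0 ltr_expR; lra.
Unshelve. all: by end_near. Qed.

Lemma Rintegral_tail_kernel d (T : measurableType d) (P : probability T R) (X : T -> R) n :
  measurable_fun setT X -> (forall w, 0 <= X w) ->
  \int[P]_w tail_kernel n (X w) = \sum_(i < (n * 2 ^ n).+1)
    (-1) ^+ i *+ 'C(n * 2 ^ n, i) * \int[P]_w expR (- (i%:R * (n%:R * ln 2)) * X w).
Proof.
move=> mX X0.
have me (a : R) : 0 <= a -> P.-integrable setT (EFin \o (fun w => expR (- a * X w))).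
  move=> a0; apply: (@integrable_bounded _ _ _ _ _ 1).
    by apply: measurableT_comp => //; exact: measurable_funM.
  move=> w; rewrite ger0_norm ?expR_ge0// -expR0 ler_expR mulNr oppr_le0.
  exact: mulr_ge0.
have pos i : 0 <= i%:R * (n%:R * ln 2) :> R by rewrite !mulr_ge0// ltW.
transitivity (\int[P]_w \sum_(i < (n * 2 ^ n).+1)
    (-1) ^+ i *+ 'C(n * 2 ^ n, i) * expR (- (i%:R * (n%:R * ln 2)) * X w)).
  apply: eq_Rintegral => w _; rewrite /tail_kernel exprDn.
  apply: eq_bigr => i _; rewrite expr1n mul1r (exprNn (expR _)) -(expRM_natl i) [RHS]mulrnAl.
  by congr (_ * expR _ *+ _); ring.
rewrite Rintegral_sum; last first.
  by move=> i; rewrite /comp; under eq_fun do rewrite EFinM; apply: integrableZl => //; exact: me.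
by apply: eq_bigr => i _; rewrite RintegralZl//; exact: me.
Qed.

(** Level 1 suffices: other positive levels are reached by dividing the variable. Both tails are
    limits of the same sequence of means of [tail_kernel]. *)
Lemma laplace_tail d (T : measurableType d) (P : probability T R) (X : T -> R)
  d' (T' : measurableType d') (P' : probability T' R) (X' : T' -> R) :
  measurable_fun setT X -> (forall w, 0 <= X w) ->
  measurable_fun setT X' -> (forall w, 0 <= X' w) ->
  (forall l, 0 <= l -> \int[P]_w expR (- l * X w) = \int[P']_w expR (- l * X' w)) ->
  \int[P]_w ((1 < X w)%R%:R : R) = \int[P']_w (1 < X' w)%R%:R.
Proof.
move=> mX X0 mX' X'0 XX'.
have lim d0 (T0 : measurableType d0) (P0 : probability T0 R) (Y : T0 -> R) :
    measurable_fun setT Y -> (forall w, 0 <= Y w) ->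
    \int[P0]_w tail_kernel n (Y w) @[n --> \oo] --> \int[P0]_w ((1 < Y w)%R%:R : R).
  move=> mY Y0; apply: (@bounded_convergence _ _ _ _ _ _ 1).
  - move=> n; apply: measurable_funX; apply: measurable_funB => //.
    by apply: measurableT_comp => //; exact: measurable_funM.
  - apply: measurable_bool; rewrite (_ : [set w | _] = Y @^-1` `]1, +oo[%classic).
      exact: measurable_preimage.
    by apply/seteqP; split => w /=; rewrite in_itv/= andbT.
  - by move=> n w; have /andP[h1 h2] := tail_kernel01 n (Y0 w); rewrite ger0_norm.
  - by apply: aeW => w; exact: tail_kernel_cvg.
have := cvg_unique (@Rhausdorff R) (lim _ _ P _ mX X0); apply => /=.
have := lim _ _ P' _ mX' X'0; apply: cvg_trans.
apply: near_eq_cvg; apply: nearW => n; rewrite !Rintegral_tail_kernel//.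
by apply: eq_bigr => i _; congr (_ * _); apply/esym/XX'; rewrite !mulr_ge0// ltW.
Qed.

End laplace_tails.

Section stable_subordinators.
Context d (T : measurableType d) (R : realType) (P : probability T R).
Variable nu : R.
Variables (D : R -> {RV P >-> R}) (D_stable : stable_subordinator nu D).

Lemma stable_subordinator_laplace (t l : R) : 0 <= t -> 0 <= l ->
  \int[P]_w expR (- l * D t w) = expR (- t * l `^ nu).
Proof.
move=> t0 l0; have [_ _ /(_ _ _ t0 l0)] := D_stable.
by rewrite unlock /Rintegral => ->.
Qed.

Lemma stable_subordinator_mono :
  {ae P, forall w, forall s t : R, 0 <= s -> s <= t -> 0 <= D s w <= D t w}.
Proof.
have [[D0 _ _ _] Dmono _] := D_stable.
apply: filterS2 D0 Dmono => w D0 Dmono s t s0 st.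
by rewrite Dmono// andbT -D0 Dmono.
Qed.

(** Markov's inequality for e^(-D n) bounds the probability of D n <= K by e^(K - n). The lemma
    makes the set defining the inverse nonempty, so that its [inf] is not the default value 0. *)
Lemma stable_subordinator_unbounded :
  {ae P, forall w, forall K, exists2 s, 0 <= s & K < D s w}.
Proof.
have H (K : nat) : {ae P, forall w, exists2 s, 0 <= s & K%:R < D s w}.
  pose b n w := D n%:R w <= K%:R.
  have mle n : measurable [set w | b n w].
    rewrite (_ : [set w | _] = D n%:R @^-1` `]-oo, K%:R]%classic).
      exact: measurable_preimage.
    by apply/seteqP; split => w /=; rewrite in_itv.
  exists (\bigcap_n [set w | b n w]); split.
  - exact: bigcap_measurable.
  - have mI : measurable (\bigcap_n [set w | b n w]) by exact: bigcap_measurable.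
    have le n : (P (\bigcap_n [set w | b n w]) <= (expR (K%:R - n%:R))%:E)%E.
      apply: (@le_trans _ _ (P [set w | b n w])).
        by apply: le_measure; rewrite ?inE// => w; exact.
      rewrite -(@fineK _ (P _)) ?fin_num_measure// lee_fin -Rintegral_bool//.
      have := stable_subordinator_laplace (ler0n R n) ler01.
      rewrite powR1 mulr1 expRD => <-.
      have mexp : measurable_fun setT (fun w => expR (- 1 * D n%:R w)).
        by apply: measurableT_comp => //; exact: measurable_funM.
      have Iexp : P.-integrable setT (EFin \o (fun w => expR (- 1 * D n%:R w))).
        apply/integrableP; split; first exact/measurable_EFinP.
        rewrite (_ : (\int[P]_x _)%E = (expR (- n%:R * 1 `^ nu))%:E) ?ltry//.
        have [_ _ /(_ _ _ (ler0n R n) ler01)] := D_stable.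
        rewrite unlock => <-; apply: eq_integral => w _ /=.
        by rewrite ger0_norm ?expR_ge0.
      rewrite -RintegralZl//; apply: le_Rintegral => //.
      + apply: (@integrable_bounded _ _ _ _ _ 1); first exact: measurable_bool.
        by move=> w; case: (b n w); rewrite ?normr1 ?normr0.
      + rewrite /comp; under eq_fun do rewrite EFinM; exact: integrableZl.
      + move=> w _; rewrite -expRD; case: (boolP (b n w)) => [|_]; last exact: expR_ge0.
        by rewrite /b => h; rewrite -[leLHS]expR0 ler_expR mulN1r subr_ge0.
    have cv : (expR (K%:R - n%:R))%:E @[n --> \oo] --> (0%R%:E : \bar R).
      apply: cvg_EFin; first exact: nearW.
      rewrite -(mulr0 (expR K%:R)) /comp /=; under eq_fun do rewrite expRD.
      apply: cvgM; first exact: cvg_cst.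
      under eq_fun do rewrite -mulrN1 expRM_natl.
      by apply: cvg_expr; rewrite ger0_norm ?expR_ge0// -[ltRHS]expR0 ltr_expR; lra.
    apply/eqP; rewrite eq_le measure_ge0 andbT.
    by apply: (cvge_to_ge cv); exact: nearW.
  - move=> w /= wN n _ /=; rewrite /b leNgt; apply/negP => h; apply: wN.
    by exists n%:R.
have : {ae P, forall w (K : nat), exists2 s, 0 <= s & K%:R < D s w}.
  exact: ae_foralln.
apply: filterS => w h K; have [s s0 sK] := h (Num.truncn K).+1.
by exists s => //; rewrite (lt_trans (truncnS_gt K)).
Qed.

(** The Laplace transforms of D (t^nu s) / t and of D s agree, because t^nu s (l / t)^nu = s
    l^nu. *)
Lemma stable_subordinator_scaling (s t : R) : 0 <= s -> 0 < t ->
  \int[P]_w ((t < D (t `^ nu * s) w)%R%:R : R) = \int[P]_w ((1 < D s w)%R%:R : R).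
Proof.
move=> s0 t0.
(* [D u] is nonnegative only almost surely while [laplace_tail] asks for it everywhere; taking the
   positive part does not change the event that a positive level is exceeded. *)
have mm (a : R) u : measurable_fun setT (fun w => Num.max 0 (D u w) / a).
  by apply: measurable_funM => //; exact: measurable_maxr.
have E1 (u a : R) : 0 < a -> forall w, (1 < Num.max 0 (D u w) / a) = (a < D u w).
  move=> a0 w; rewrite ltr_pdivlMr// mul1r lt_max.
  by rewrite ltNge (ltW a0).
have lap a u l : 0 < a -> 0 <= u -> 0 <= l ->
    \int[P]_w expR (- l * (Num.max 0 (D u w) / a)) = expR (- u * (l / a) `^ nu).
  move=> a0 u0 l0; rewrite -(@stable_subordinator_laplace u (l / a) u0); last by rewrite divr_ge0// ltW.
  apply: ae_eq_Rintegral.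
  - by apply: measurableT_comp => //; apply: measurable_funM.
  - by apply: measurableT_comp => //; apply: measurable_funM.
  - apply: filterS stable_subordinator_mono => w /(_ u u u0 (lexx _)) /andP[D0 _].
    by rewrite max_r// mulrA mulrAC mulNr.
transitivity (\int[P]_w ((1 < Num.max 0 (D (t `^ nu * s) w) / t)%R%:R : R)).
  by apply: eq_Rintegral => w _; rewrite E1.
transitivity (\int[P]_w ((1 < Num.max 0 (D s w) / 1)%R%:R : R)); last first.
  by apply: eq_Rintegral => w _; rewrite E1.
apply: laplace_tail; [exact: mm| |exact: mm| |].
- by move=> w; rewrite divr_ge0 ?le_max ?lexx// ltW.
- by move=> w; rewrite divr_ge0 ?le_max ?lexx.
- move=> l l0; rewrite (lap t (t `^ nu * s) l t0 _ l0) ?mulr_ge0 ?powR_ge0//.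
  rewrite (lap 1 s l ltr01 s0 l0) divr1; congr expR.
  rewrite !mulNr mulrAC -powRM ?divr_ge0// ?(ltW t0)//.
  by rewrite mulrCA divff ?gt_eqF// mulr1 mulrC.
Qed.

End stable_subordinators.

Section inverse_stable_subordinators.
Context d (T : measurableType d) (R : realType) (P : probability T R).
Variable nu : R.
Variables (L : R -> {RV P >-> R}) (L_inverse : inverse_stable_subordinator nu L).

Lemma inverse_stable_subordinator_ge0 :
  {ae P, forall w, forall t : R, 0 <= t -> 0 <= L t w}.
Proof.
have [D [_ LE]] := L_inverse; apply: filterS LE => w LE t t0; rewrite LE//.
have [A0|/set0P/negP/negPn/eqP ->] := pselect ([set s : R | 0 <= s /\ t < D s w] !=set0).
  by apply: lb_le_inf => // s [].
by rewrite inf0.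
Qed.

(** The sampled times increase strictly to [s]. If the infimum is below [s], some u < s has D u > t,
    and monotonicity extends this to all later times; conversely a sampled time r with D r > t
    bounds the infimum by r < s. *)
Lemma inverse_stable_subordinator_cdf (D : R -> {RV P >-> R}) (t s : R) :
  stable_subordinator nu D ->
  {ae P, forall w, forall t : R, 0 <= t ->
      L t w = inf [set s : R | 0 <= s /\ t < D s w]} ->
  0 < t -> 0 < s ->
  \int[P]_w ((t < D (s * (n%:R / n.+1%:R)) w)%R%:R : R) @[n --> \oo] -->
  fine (P [set w | L t w < s]).
Proof.
move=> D_stable LE t0 s0.
have mlt : measurable [set w | L t w < s].
  rewrite (_ : [set w | _] = L t @^-1` `]-oo, s[%classic); first exact: measurable_preimage.
  by apply/seteqP; split => w /=; rewrite in_itv.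
rewrite -Rintegral_bool//; apply: (@bounded_convergence _ _ _ _ _ _ 1).
- move=> n; apply: measurable_bool.
  rewrite (_ : [set w | _] = D (s * (n%:R / n.+1%:R)) @^-1` `]t, +oo[%classic).
    exact: measurable_preimage.
  by apply/seteqP; split => w /=; rewrite in_itv/= andbT.
- exact: measurable_bool.
- by move=> n w; case: ltP => _; rewrite ?normr1 ?normr0.
have mono := stable_subordinator_mono D_stable.
have unb := stable_subordinator_unbounded D_stable.
apply: filterS3 LE mono unb => w /(_ _ (ltW t0)) -> mono unb.
set A := [set u | _].
have A0 : A !=set0 by have [u u0 tu] := unb t; exists u.
have Alb : has_lbound A by exists 0 => u [].
pose r n : R := s * (n%:R / n.+1%:R).
have r_ge0 n : 0 <= r n by rewrite mulr_ge0 ?divr_ge0// ltW.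
have r_lt n : r n < s.
  by rewrite /r gtr_pMr// ltr_pdivrMr ?ltr0n// mul1r ltr_nat.
have rE n : r n = s - s * n.+1%:R^-1.
  by rewrite /r -natr1; field; rewrite natr1.
have rs : r n @[n --> \oo] --> s.
  rewrite (_ : r = fun n => s - s * n.+1%:R^-1); last exact/funext.
  rewrite -[X in _ --> X]subr0 -[X in _ - X](mulr0 s).
  apply: cvgB; first exact: cvg_cst.
  by apply: cvgM; [exact: cvg_cst|exact: cvg_harmonic].
have [lts|ges] := ltP (inf A) s.
  have [u [u0 tu] us] := inf_lt A0 lts.
  apply: (@cvg_trans _ ((fun=> 1 : R) @ \oo)); last exact: cvg_cst.
  apply: near_eq_cvg; near=> n.
  have ur : u <= r n.
    near: n; exact: (cvgr_ge _ rs).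
  have /andP[_ h] := mono _ _ u0 ur.
  by rewrite -/(r n) (lt_le_trans tu h).
apply: (@cvg_trans _ ((fun=> 0 : R) @ \oo)); last exact: cvg_cst.
apply: near_eq_cvg; apply: nearW => n; rewrite -/(r n).
case: ltP => // tr; exfalso.
have : inf A <= r n by apply: ge_inf.
by rewrite leNgt (lt_le_trans (r_lt n)).
Unshelve. all: by end_near. Qed.

(* Up to null sets [L t < s] is the increasing union of the events
   [t < D (s * (n / n.+1))], whose probabilities scale because the Laplace
   transform of the subordinator does. *)
Lemma inverse_stable_subordinator_scaling (t s : R) : 0 < t ->
  fine (P [set w | L t w < s]) = fine (P [set w | t `^ nu * L 1 w < s]).
Proof.
move=> t0.
have tnu0 : 0 < t `^ nu by rewrite powR_gt0.
have mlt u a : measurable [set w | a * L u w < s].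
  rewrite (_ : [set w | _] = (fun w => a * L u w) @^-1` `]-oo, s[%classic).
    by apply: measurable_preimage => //; exact: measurable_funM.
  by apply/seteqP; split => w /=; rewrite in_itv.
have mlt' : measurable [set w | L t w < s] by have := mlt t 1; under eq_set do rewrite mul1r.
(* For s <= 0 both events are null, by almost sure nonnegativity. *)
have [s0|s0] := leP s 0.
  rewrite -!Rintegral_bool//; apply: ae_eq_Rintegral; [exact: measurable_bool..|].
  apply: filterS inverse_stable_subordinator_ge0 => w L0.
  rewrite !ltNge !(le_trans s0)// ?mulr_ge0 ?L0// ?ltW//.
have [D [D_stable LE]] := L_inverse.
have s'0 : 0 < s / t `^ nu by rewrite divr_gt0.
have := cvg_unique (@Rhausdorff R) (inverse_stable_subordinator_cdf D_stable LE t0 s0).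
apply => /=.
rewrite (_ : [set w | t `^ nu * _ < _] = [set w | L 1 w < s / t `^ nu]); last first.
  by apply/seteqP; split => w /=; rewrite ltr_pdivlMr// mulrC.
have := inverse_stable_subordinator_cdf D_stable LE ltr01 s'0.
apply: cvg_trans; apply: near_eq_cvg; apply: nearW => n.
rewrite -(stable_subordinator_scaling D_stable _ t0); last first.
  by rewrite mulr_ge0 ?divr_ge0// ltW.
apply: eq_Rintegral => w _; congr ((_ < D _ w)%R%:R).
by rewrite mulrA; congr (_ * _); rewrite mulrCA divff ?mulr1 ?gt_eqF.
Qed.

End inverse_stable_subordinators.

(** * Central limit theorem for Levy processes *)

Section exponential_moments.
Context d (T : measurableType d) (R : realType) (P : probability T R).

Lemma pow_le_exp (n : nat) (delta x : R) : 0 < delta ->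
  `|x| ^+ n <= n`!%:R / delta ^+ n * expR (delta * `|x|).
Proof.
move=> d0; have dx0 : 0 <= delta * `|x| by rewrite mulr_ge0 // ltW.
rewrite mulrAC ler_pdivlMr ?exprn_gt0// -exprMn (mulrC `|x|).
rewrite (mulrC _%:R) -ler_pdivrMr ?ltr0n ?fact_gt0//.
case: n => [|n]; first by rewrite expr0 fact0 divr1 -[leLHS]expR0 ler_expR.
by apply: le_trans (expR_ge1Dxn n dx0); rewrite lerDr.
Qed.

Variables (X : T -> R) (e : R).
Hypotheses (mX : measurable_fun setT X) (e_gt0 : 0 < e).
Hypothesis exp_integrable : forall a : R, `|a| < e ->
  P.-integrable setT (EFin \o (fun w => expR (a * X w))).

(** Half of the gap between [b] and [e] absorbs the power, through |x|^n <= C e^(delta |x|); what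
    remains is dominated by e^(b' x) + e^(- b' x) with b' = b + delta < e. *)
Lemma integrable_pow_exp_abs n (b : R) : 0 <= b < e ->
  P.-integrable setT (EFin \o (fun w => `|X w| ^+ n * expR (b * `|X w|))).
Proof.
move=> /andP[b0 be].
pose b' := (b + e) / 2; pose delta := (e - b) / 2.
have d0 : 0 < delta by rewrite /delta; lra.
pose C : R := n`!%:R / delta ^+ n.
have b'e : `|b'| < e by rewrite ger0_norm /b'; lra.
have I1 : P.-integrable setT (EFin \o (fun w =>
    C * (expR (b' * X w) + expR (- b' * X w)))).
  rewrite /comp; under eq_fun do rewrite EFinM; apply: integrableZl => //.
  under eq_fun do rewrite EFinD.
  by apply: integrableD => //; apply: exp_integrable; rewrite ?normrN.
apply: le_integrable I1 => //.
- apply/measurable_EFinP; apply: measurable_funM.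
    by apply: measurable_funX; exact: measurableT_comp.
  apply: measurableT_comp => //; apply: measurable_funM => //.
  exact: measurableT_comp.
- move=> w _ /=; rewrite lee_fin [leLHS]ger0_norm ?mulr_ge0 ?exprn_ge0 ?expR_ge0//.
  have C0 : 0 <= C by rewrite divr_ge0// exprn_ge0// ltW.
  rewrite [leRHS]ger0_norm; last by rewrite mulr_ge0 ?addr_ge0 ?expR_ge0.
  apply: (@le_trans _ _ (C * expR (b' * `|X w|))).
    apply: le_trans (ler_wpM2r (expR_ge0 _) (pow_le_exp n (X w) d0)) _.
    rewrite -/C -(mulrA C) -expRD (_ : delta * _ + _ = b' * `|X w|)//.
    by rewrite /delta /b'; field.
  rewrite ler_wpM2l//; have [X0|X0] := leP 0 (X w).
    by rewrite ger0_norm// lerDl expR_ge0.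
  by rewrite ltr0_norm// mulrN -mulNr lerDr expR_ge0.
Qed.

Lemma integrable_pow_exp n (a : R) : `|a| < e ->
  P.-integrable setT (EFin \o (fun w => X w ^+ n * expR (a * X w))).
Proof.
move=> ae; have := @integrable_pow_exp_abs n `|a|; rewrite normr_ge0 ae => /(_ isT).
apply: le_integrable => //.
  apply/measurable_EFinP; apply: measurable_funM; first exact: measurable_funX.
  by apply: measurableT_comp => //; exact: measurable_funM.
move=> w _ /=; rewrite lee_fin !normrM !normrX !(ger0_norm (expR_ge0 _)) normr_id.
rewrite ler_wpM2l ?exprn_ge0//.
by rewrite ler_expR -normrM ler_norm.
Qed.

Lemma integrable_abs_pow n : P.-integrable setT (EFin \o (fun w => `|X w| ^+ n)).
Proof.
have := @integrable_pow_exp_abs n 0; rewrite lexx e_gt0 => /(_ isT).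
rewrite /comp; under eq_fun do rewrite mul0r expR0 mulr1.
exact.
Qed.

Lemma integrable_pow n : P.-integrable setT (EFin \o (fun w => X w ^+ n)).
Proof.
have e0 : `|0 : R| < e by rewrite normr0.
have := @integrable_pow_exp n 0 e0.
by rewrite /comp; under eq_fun do rewrite mul0r expR0 mulr1.
Qed.

Definition exp_moment n (a : R) : R := \int[P]_w (X w ^+ n * expR (a * X w)).

Lemma is_derive_exp_moment n (a : R) : `|a| < e ->
  is_derive a 1 (exp_moment n : R -> R) (exp_moment n.+1 a).
Proof.
move=> ae.
(* For parameters in ]-b, b[ the derivative of the integrand is dominated by |X|^(n+1) e^(b |X|),
   integrable because b < e. *)
pose b := (`|a| + e) / 2.
have b0 : 0 <= b by rewrite divr_ge0// addr_ge0// ltW.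
have be : b < e by rewrite /b; lra.
have ab : `|a| < b by rewrite /b; lra.
have Ia : `]-b, b[%classic a by rewrite /= in_itv/= -ltr_norml.
have Ilt x : `]-b, b[%classic x -> `|x| < b by rewrite /= in_itv/= -ltr_norml.
pose f x w : R := X w ^+ n * expR (x * X w).
have df (x : R) w : is_derive x 1 (f ^~ w) (X w ^+ n.+1 * expR (x * X w)).
  rewrite /f; apply: is_derive_eq.
  by rewrite ?scaler0 ?add0r ?addr0 /GRing.scale/= exprS; ring.
have dfE x w : partial1of2 f x w = X w ^+ n.+1 * expR (x * X w).
  by rewrite partial1of2E; exact: derive_val.
have h1 x : `]-b, b[%classic x -> P.-integrable setT (EFin \o f x).
  by move=> /Ilt xb; apply: integrable_pow_exp; exact: lt_trans be.
have h2 x w : `]-b, b[%classic x -> setT w -> derivable (f ^~ w) x 1.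
  by move=> _ _; exact: ex_derive.
have h3 : P.-integrable setT (EFin \o (fun w => `|X w| ^+ n.+1 * expR (b * `|X w|))).
  by apply: integrable_pow_exp_abs; rewrite b0.
have h4 x w : `]-b, b[%classic x -> setT w ->
    `|partial1of2 f x w| <= `|X w| ^+ n.+1 * expR (b * `|X w|).
  move=> /Ilt xb _; rewrite dfE normrM normrX ler_wpM2l ?exprn_ge0//.
  rewrite (ger0_norm (expR_ge0 _)) ler_expR (le_trans (ler_norm _))// normrM.
  by rewrite ler_wpM2r// ltW.
have h5 w : 0 <= `|X w| ^+ n.+1 * expR (b * `|X w|).
  by rewrite mulr_ge0 ?exprn_ge0 ?expR_ge0.
have D1 := @derivable_under_integral R _ T P f setT measurableT a (-b) b Ia h1 h2 _ h5 h3 h4.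
have D2 := @differentiation_under_integral R _ T P f setT measurableT a (-b) b Ia h1 h2 _ h5 h3 h4.
apply: DeriveDef; first exact: D1.
rewrite -derive1E D2; apply: eq_Rintegral => w _; exact: dfE.
Qed.

Lemma exp_moment0_gt0 (a : R) : `|a| < e -> 0 < exp_moment 0 a.
Proof.
move=> ae; rewrite lt_neqAle Rintegral_ge0 ?andbT; last first.
  by move=> w _; rewrite expr0 mul1r expR_ge0.
apply/negP => /eqP /esym E0.
have I0 := integrable_pow_exp 0 ae.
have : (\int[P]_w `|(X w ^+ 0 * expR (a * X w))%:E|)%E = 0%E.
  rewrite -[RHS]/(0%R%:E) -E0 EFin_Rintegral// unlock.
  by apply: eq_integral => w _; rewrite gee0_abs// lee_fin expr0 mul1r expR_ge0.
move/integrableP: (I0) => [mI _].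
move/ae_eq_integral_abs => /(_ measurableT mI).
case=> N [mN N0 sub].
have : P setT = 0%E.
  apply/eqP; rewrite -measure_le0 -N0; apply: le_measure; rewrite ?inE//.
  move=> w _; apply: sub => /= /(_ I) []; rewrite expr0 mul1r => /eqP.
  by rewrite gt_eqF ?expR_gt0.
by rewrite probability_setT => /eqP; rewrite onee_eq0.
Qed.

Lemma exp_moment00 : exp_moment 0 0 = 1.
Proof.
by rewrite -[RHS](Rintegral_cstT P); apply: eq_Rintegral => w _; rewrite expr0 mul0r expR0 mul1r.
Qed.

Lemma exp_moment_at0 n : exp_moment n 0 = \int[P]_w (X w ^+ n).
Proof. by apply: eq_Rintegral => w _; rewrite mul0r expR0 mulr1. Qed.

Lemma cumulant_gen_funE : cumulant_gen_fun P X = fun a => ln (exp_moment 0 a).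
Proof.
apply/funext => a; rewrite /cumulant_gen_fun /mmt_gen_fun unlock; congr (ln (fine _)).
by apply: eq_integral => w _ /=; rewrite expr0 mul1r mulrC.
Qed.

Lemma is_derive_cumulant (a : R) : `|a| < e ->
  is_derive a 1 (cumulant_gen_fun P X) (exp_moment 1 a / exp_moment 0 a).
Proof.
move=> ae; rewrite cumulant_gen_funE mulrC.
apply: (@is_derive1_comp _ (@ln R) (exp_moment 0)).
  exact/is_derive1_ln/exp_moment0_gt0.
exact: is_derive_exp_moment.
Qed.

Lemma cumulant_mean : (cumulant_gen_fun P X)^`()%classic 0 = \int[P]_w X w.
Proof.
have e0 : `|0 : R| < e by rewrite normr0.
rewrite derive1E; have -> := @derive_val _ _ _ _ _ _ _ (is_derive_cumulant e0).
rewrite exp_moment00 divr1 exp_moment_at0.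
by apply: eq_Rintegral => w _; rewrite expr1.
Qed.

Lemma cumulant_variance : (cumulant_gen_fun P X)^`(2)%classic 0 =
  \int[P]_w (X w ^+ 2) - (\int[P]_w X w) ^+ 2.
Proof.
have e0 : `|0 : R| < e by rewrite normr0.
rewrite derive1nS derive1n1 derive1E.
pose g a : R := exp_moment 1 a * (exp_moment 0 a)^-1.
have dg : is_derive (0 : R) 1 g (exp_moment 2 0 - exp_moment 1 0 ^+ 2).
  have M0 := exp_moment0_gt0 e0.
  have d1 := is_derive_exp_moment 1 e0.
  have d0 := is_derive_exp_moment 0 e0.
  have dv := is_deriveV (lt0r_neq0 M0) d0.
  apply: is_derive_eq; rewrite exp_moment00 /GRing.scale/= expr1n invr1; ring.
(* The quotient [g] is the first derivative only where exponential moments are known to be finite;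
   agreement near 0 is enough to differentiate once more at 0. *)
have gE : {near (0 : R), g =1 (cumulant_gen_fun P X)^`()%classic}.
  near=> a; rewrite derive1E.
  have ae : `|a| < e.
    near: a; have : `|a| @[a --> (0 : R)] --> `|0 : R| by apply: cvg_norm; exact: cvg_id.
    by rewrite normr0 => /cvgr_lt; apply.
  by rewrite (@derive_val _ _ _ _ _ _ _ (is_derive_cumulant ae)).
rewrite -(near_eq_derive _ gE) ?oner_neq0//.
rewrite (@derive_val _ _ _ _ _ _ _ dg) !exp_moment_at0.
by under [X in _ - X ^+ 2]eq_Rintegral do rewrite expr1.
Unshelve. all: by end_near. Qed.

End exponential_moments.


(** * Moments and convolution of the standard Gaussian *)

Section gaussian.
Variable R : realType.
Local Notation mu := (@lebesgue_measure R).
Local Notation TR := (measurableTypeR R).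
Local Notation gauss := (normal_prob (0 : R) 1 : probability TR R).

(** The Radon-Nikodym derivative agrees almost everywhere with [normal_pdf], as both have the same
    integral over every measurable set. *)
Lemma integral_normal_prob (f : TR -> \bar R) :
  measurable_fun setT f -> (forall x, 0 <= f x)%E ->
  (\int[gauss]_x f x = \int[mu]_x (f x * (normal_pdf 0 1 x)%:E))%E.
Proof.
move=> mf f0.
have dom := @normal_prob_dominates R 0 1.
rewrite -(Radon_Nikodym_SigmaFinite.change_of_variables dom f0 measurableT mf).
have If := Radon_Nikodym_SigmaFinite.f_integrable dom.
have mpdf : measurable_fun setT (fun x : R => (normal_pdf 0 1 x)%:E).
  by apply/measurable_EFinP; exact: measurable_normal_pdf.
apply: ae_eq_integral => //.
- by apply: emeasurable_funM => //; exact: (measurable_int mu).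
- exact: emeasurable_funM.
apply: ae_eqe_mul2l; apply: integral_ae_eq => // E _ mE.
by rewrite -Radon_Nikodym_SigmaFinite.f_integral.
Qed.

Lemma normal_pdf1E (m x : R) : normal_pdf m 1 x = normal_peak 1 * expR (- (x - m) ^+ 2 / 2).
Proof.
by rewrite normal_pdfE ?oner_neq0// /normal_fun expr1n mulr2n.
Qed.

Lemma measurable_expR_lin (a : R) : measurable_fun setT (fun x : TR => expR (a * x)).
Proof. by apply: measurableT_comp => //; exact: measurable_funM. Qed.

Lemma integral_gauss_exp (a : R) :
  (\int[gauss]_x (expR (a * x))%:E = (expR (a ^+ 2 / 2))%:E)%E.
Proof.
rewrite integral_normal_prob//; last first.
  by apply/measurable_EFinP; exact: measurable_expR_lin.
(* Completing the square turns e^(a x) times the density centred at 0 into e^(a^2 / 2) times the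
   density centred at [a]. *)
transitivity (\int[mu]_x ((expR (a ^+ 2 / 2))%:E * (normal_pdf a 1 x)%:E))%E.
  apply: eq_integral => x _; rewrite -!EFinM; congr EFin.
  rewrite !normal_pdf1E subr0 !(mulrCA _ (normal_peak 1)) -!expRD.
  by congr (_ * expR _); field.
rewrite ge0_integralZl//.
- by rewrite integral_normal_pdf mule1.
- by apply/measurable_EFinP; exact: measurable_normal_pdf.
- by move=> x _; rewrite lee_fin normal_pdf_ge0.
Qed.

Lemma integrable_gauss_exp (a : R) :
  gauss.-integrable setT (EFin \o (fun x : TR => expR (a * x))).
Proof.
apply/integrableP; split; first by apply/measurable_EFinP; exact: measurable_expR_lin.
under eq_integral do rewrite gee0_abs ?lee_fin ?expR_ge0//.
by rewrite integral_gauss_exp ltry.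
Qed.

(** The Gaussian mean and second moment are obtained by differentiating this closed form, with no
    direct integration of powers. *)
Let exp_moment0E : exp_moment gauss (idfun : TR -> R) 0 = (fun a : R => expR (a ^+ 2 / 2)).
Proof.
apply/funext => a; rewrite /exp_moment /Rintegral.
under eq_integral do rewrite expr0 mul1r.
by rewrite integral_gauss_exp.
Qed.

Let is_derive_gauss n (a : R) : is_derive a 1 (exp_moment gauss (idfun : TR -> R) n : R -> R)
  (exp_moment gauss (idfun : TR -> R) n.+1 a).
Proof.
apply: (@is_derive_exp_moment _ TR R gauss _ (`|a| + 1)) => //.
- exact: measurable_id.
- by move=> b _; exact: integrable_gauss_exp.
- by rewrite ltrDl.
Qed.

Let exp_moment1E : exp_moment gauss (idfun : TR -> R) 1 = (fun a : R => a * expR (a ^+ 2 / 2)).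
Proof.
apply/funext => a; have := is_derive_gauss 0 a.
rewrite exp_moment0E => /@derive_val <-.
apply: derive_val.
apply: is_derive_eq.
by rewrite /GRing.scale/=; field.
Qed.

Lemma gauss_mean : \int[gauss]_x x = 0.
Proof.
transitivity (exp_moment gauss (idfun : TR -> R) 1 0); last by rewrite exp_moment1E mul0r.
by rewrite exp_moment_at0; apply: eq_Rintegral => x _; rewrite expr1.
Qed.

Lemma gauss_second_moment : \int[gauss]_x (x ^+ 2) = 1.
Proof.
rewrite -[LHS](exp_moment_at0 gauss idfun 2).
have := is_derive_gauss 1 0; rewrite exp_moment1E => /@derive_val <-.
apply: derive_val.
apply: is_derive_eq.
rewrite /GRing.scale/= expr0n/= !mul0r expR0; ring.
Qed.

Lemma integrable_gauss_pow n : gauss.-integrable setT (EFin \o (fun x : TR => (x : R) ^+ n)).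
Proof.
apply: (@integrable_pow _ TR R gauss idfun 1) => //; first exact: measurable_id.
by move=> b _; exact: integrable_gauss_exp.
Qed.

Lemma integral_affine (G : R -> R) (a b : R) : 0 < a -> continuous G ->
  (forall x, 0 <= G x) ->
  (\int[mu]_x (G x)%:E = \int[mu]_x (G (a * x + b) * a)%:E)%E.
Proof.
move=> a0 cG G0; pose F x := a * x + b.
have dF x : is_derive (x : R) 1 (F : R -> R) a.
  by apply: is_derive_eq; rewrite addr0 /GRing.scale/= mulr1.
have F'E : F^`()%classic = cst a.
  by apply/funext => x; rewrite derive1E derive_val.
rewrite (increasing_ge0_integration_by_substitutionT (F := F))//.
- by apply: eq_integral => x _; rewrite F'E.
- by move=> x y xy; rewrite /F ltrD2r ltr_pM2l.
- by rewrite F'E => x; exact: cvg_cst.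
- by rewrite F'E; exact: is_cvg_cst.
- by rewrite F'E; exact: is_cvg_cst.
- by apply: cvg_comp (cvg_addrr_Ny b); apply: gt0_cvgMrNy => //; exact: cvg_id.
- by apply: cvg_comp (cvg_addrr b); apply: gt0_cvgMry => //; exact: cvg_id.
Qed.

(** For independent standard Gaussians y and z, and w = a y + b z, both sides are the joint density
    of (w, z). On the right it is factored into the density of w, of deviation c, and that of z
    given w, of mean w b / c^2 and deviation a / c. *)
Lemma normal_pdfM (a b w z : R) : 0 < a -> 0 < b ->
  let c := Num.sqrt (a ^+ 2 + b ^+ 2) in
  normal_pdf 0 1 ((w - b * z) / a) / a * normal_pdf 0 1 z =
  normal_pdf 0 1 (w / c) / c * normal_pdf (w * b / c ^+ 2) (a / c) z.
Proof.
move=> a0 b0 c.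
have cc : c ^+ 2 = a ^+ 2 + b ^+ 2 by rewrite sqr_sqrtr// addr_ge0 ?sqr_ge0.
have c0 : 0 < c by rewrite sqrtr_gt0 addr_gt0 ?exprn_gt0.
have ac0 : 0 < a / c by rewrite divr_gt0.
have peakE (s : R) : 0 < s -> normal_peak s = normal_peak 1 / s.
  move=> s0; rewrite /normal_peak expr1n mul1r -mulrnAr sqrtrM ?sqr_ge0//.
  by rewrite sqrtr_sqr gtr0_norm// invfM mulrC.
rewrite !normal_pdf1E normal_pdfE ?gt_eqF// (peakE _ ac0) !subr0 /normal_fun.
have expE : expR (- ((w - b * z) / a) ^+ 2 / 2) * expR (- z ^+ 2 / 2) =
    expR (- (w / c) ^+ 2 / 2) * expR (- (z - w * b / c ^+ 2) ^+ 2 / ((a / c) ^+ 2 *+ 2)).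
  rewrite -!expRD; congr expR; rewrite mulr2n !exprMn !exprVn cc.
  have cc0 : a ^+ 2 + b ^+ 2 != 0 by rewrite -cc gt_eqF ?exprn_gt0.
  by field; rewrite cc0 gt_eqF.
rewrite [LHS](_ : _ = normal_peak 1 * normal_peak 1 / a *
  (expR (- ((w - b * z) / a) ^+ 2 / 2) * expR (- z ^+ 2 / 2))); last by ring.
by rewrite expE; field; rewrite !gt_eqF.
Qed.

(** After the substitution w = a y + b z and an exchange of integrals, [normal_pdfM] leaves in z the
    integral of a density, which is 1. A zero scale is treated apart, since the substitution divides
    by [a]. *)
Lemma gauss_convolution (f : R -> R) (a b : R) : continuous f -> (forall x, 0 <= f x <= 1) ->
  0 <= a -> 0 <= b ->
  \int[gauss]_z \int[gauss]_y f (a * y + b * z) =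
  \int[gauss]_z f (Num.sqrt (a ^+ 2 + b ^+ 2) * z).
Proof.
move=> cf f01 a_ge0 b_ge0.
have mf : measurable_fun [set: R] f by exact: continuous_measurable_fun.
have mfl (u v : R) : measurable_fun [set: TR] (fun y : TR => f (u * y + v)).
  by apply: measurableT_comp => //; apply: measurable_funD => //; exact: measurable_funM.
have f0 x : 0 <= f x by have /andP[] := f01 x.
have If (u v : R) : gauss.-integrable setT (EFin \o (fun y : TR => f (u * y + v))).
  apply: (@integrable_bounded _ _ _ _ _ 1) => // y.
  by have /andP[h1 h2] := f01 (u * y + v); rewrite ger0_norm.
have [->|a_neq0] := eqVneq a 0.
  rewrite expr0n/= add0r sqrtr_sqr ger0_norm//; apply: eq_Rintegral => z _.
  by rewrite -[RHS](Rintegral_cstT gauss); apply: eq_Rintegral => y _; rewrite mul0r add0r.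
have [->|b_neq0] := eqVneq b 0.
  rewrite expr0n/= addr0 sqrtr_sqr ger0_norm// -[RHS](Rintegral_cstT gauss).
  by apply: eq_Rintegral => z _; apply: eq_Rintegral => y _; rewrite mul0r addr0.
have a0 : 0 < a by rewrite lt_neqAle eq_sym a_neq0.
have b0 : 0 < b by rewrite lt_neqAle eq_sym b_neq0.
pose c := Num.sqrt (a ^+ 2 + b ^+ 2); rewrite -/c.
have c0 : 0 < c by rewrite sqrtr_gt0 addr_gt0 ?exprn_gt0.
have cpdf : continuous (normal_pdf (0 : R) 1) by apply: continuous_normal_pdf; rewrite oner_neq0.
have inner (u v : R) : 0 < u -> (\int[gauss]_y f (u * y + v))%:E =
    (\int[mu]_w (f w * (normal_pdf 0 1 ((w - v) / u) / u))%:E)%E.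
  move=> u0; rewrite EFin_Rintegral// unlock integral_normal_prob; last 2 first.
  - by apply/measurable_EFinP.
  - by move=> y; rewrite lee_fin.
  rewrite [RHS](integral_affine v u0)//.
  - apply: eq_integral => y _; rewrite addrK (_ : u * y / u = y); last by field; rewrite gt_eqF.
    by rewrite -EFinM -!mulrA mulVf ?mulr1// gt_eqF.
  - move=> x; apply: cvgM; first exact: cf.
    apply: cvgM; last exact: cvg_cst.
    apply: (@continuous_comp _ _ _ (fun w => (w - v) / u) (normal_pdf 0 1)) => //.
      by apply: cvgM; [apply: cvgB; [exact: cvg_id|exact: cvg_cst]|exact: cvg_cst].
    exact: cpdf.
  - by move=> x; rewrite mulr_ge0 ?divr_ge0 ?normal_pdf_ge0// ltW.
have mpdf : measurable_fun [set: R] (normal_pdf (0 : R) 1) by exact: continuous_measurable_fun.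
pose F (zw : TR * TR) : \bar R :=
  (f zw.2 * (normal_pdf 0 1 ((zw.2 - b * zw.1) / a) / a) * normal_pdf 0 1 zw.1)%:E.
have mF : measurable_fun [set: TR * TR] F.
  apply/measurable_EFinP; apply: measurable_funM; last exact: measurableT_comp.
  apply: measurable_funM; first exact: measurableT_comp.
  apply: measurable_funM => //; apply: measurableT_comp => //.
  apply: measurable_funM => //; apply: measurable_funB => //.
  exact: measurable_funM.
have F0 zw : (0 <= F zw)%E.
  by rewrite lee_fin !mulr_ge0 ?normal_pdf_ge0 ?invr_ge0// ltW.
have mH : measurable_fun [set: TR] (fun z : TR => \int[gauss]_y f (a * y + b * z)).
  apply/measurable_EFinP.
  pose H (zy : TR * TR) : \bar R := (f (a * zy.2 + b * zy.1))%:E.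
  rewrite (_ : _ \o _ = fubini_F gauss H).
    apply: measurable_fun_fubini_tonelli_F => [|zy]; last by rewrite lee_fin.
    apply/measurable_EFinP; apply: measurableT_comp => //.
    by apply: measurable_funD; exact: measurable_funM.
  by apply/funext => z; rewrite /= EFin_Rintegral// unlock.
have H01 z : 0 <= \int[gauss]_y f (a * y + b * z) <= 1.
  by apply: Rintegral_bounds.
apply: EFin_inj; rewrite [RHS](_ : _ = (\int[gauss]_z f (c * z + 0))%:E); last first.
  by congr EFin; apply: eq_Rintegral => z _; rewrite addr0.
rewrite inner// EFin_Rintegral; last first.
  apply: (@integrable_bounded _ _ _ _ _ 1) => // z.
  by have /andP[h1 h2] := H01 z; rewrite ger0_norm.
rewrite unlock integral_normal_prob; last 2 first.
- exact/measurable_EFinP.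
- by move=> z; rewrite lee_fin; have /andP[] := H01 z.
transitivity (\int[mu]_z \int[mu]_w F (z, w))%E.
  apply: eq_integral => z _; rewrite inner// -ge0_integralZr//.
  - apply/measurable_EFinP; apply: measurable_funM => //; apply: measurable_funM => //.
    apply: measurableT_comp => //; apply: measurable_funM => //.
    exact: measurable_funB.
  - by move=> w _; rewrite lee_fin !mulr_ge0 ?normal_pdf_ge0 ?invr_ge0// ltW.
  - by rewrite lee_fin normal_pdf_ge0.
rewrite fubini_tonelli//; apply: eq_integral => w _.
transitivity (\int[mu]_z ((f w * (normal_pdf 0 1 (w / c) / c))%:E *
    (normal_pdf (w * b / c ^+ 2) (a / c) z)%:E))%E.
  by apply: eq_integral => z _; rewrite /F/= -EFinM -!(mulrA (f w)) normal_pdfM.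
rewrite ge0_integralZl//.
- by rewrite integral_normal_pdf mule1 subr0.
- by apply/measurable_EFinP; exact: measurable_normal_pdf.
- by move=> x _; rewrite lee_fin normal_pdf_ge0.
- by rewrite lee_fin !mulr_ge0 ?normal_pdf_ge0 ?invr_ge0// ltW.
Qed.

End gaussian.

Section laws.
Variable R : realType.

Lemma Rintegral_eq_law d (T : measurableType d) (P : probability T R) (Y : T -> R)
    d' (T' : measurableType d') (Q : probability T' R) (X : T' -> R) (g : R -> R) :
  measurable_fun setT Y -> measurable_fun setT X ->
  (forall B, measurable B -> P (Y @^-1` B) = Q (X @^-1` B)) ->
  measurable_fun setT g -> (forall x, 0 <= g x) ->
  \int[P]_w g (Y w) = \int[Q]_w g (X w).
Proof.
move=> mY mX YX mg g0.
pose Y' : {RV P >-> R} := HB.pack Y (isMeasurableFun.Build _ _ _ _ _ mY).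
pose X' : {RV Q >-> R} := HB.pack X (isMeasurableFun.Build _ _ _ _ _ mX).
have mgE : measurable_fun setT (EFin \o g) by exact/measurable_EFinP.
have gE0 y : (0 <= (EFin \o g) y)%E by rewrite lee_fin.
congr fine.
rewrite -[LHS](ge0_integral_distribution Y' mgE gE0).
rewrite -[RHS](ge0_integral_distribution X' mgE gE0).
by apply: eq_measure_integral => B mB _; exact: YX.
Qed.

Section two_spaces.
Context d (T : measurableType d) (P : probability T R).
Context d' (T' : measurableType d') (Q : probability T' R).
Variable F : T * T' -> R.
Hypotheses (mF : measurable_fun setT F) (F01 : forall z, 0 <= F z <= 1).

Let mFE : measurable_fun setT (EFin \o F).
Proof. exact/measurable_EFinP. Qed.

Let F0 z : (0 <= (EFin \o F) z)%E.
Proof. by rewrite lee_fin; have /andP[] := F01 z. Qed.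

Let F1 z : `|F z| <= 1.
Proof. by have /andP[h1 h2] := F01 z; rewrite ger0_norm. Qed.

Lemma measurable_section1 x : measurable_fun setT (fun y => F (x, y)).
Proof. by apply: measurableT_comp => //; exact: measurable_fun_pair. Qed.

Lemma measurable_section2 y : measurable_fun setT (fun x => F (x, y)).
Proof. by apply: measurableT_comp => //; exact: measurable_fun_pair. Qed.

Lemma EFin_section1 x : (\int[Q]_y F (x, y))%:E = (\int[Q]_y (F (x, y))%:E)%E.
Proof.
rewrite EFin_Rintegral; first by rewrite unlock.
by apply: (@integrable_bounded _ _ _ _ _ 1) => //; exact: measurable_section1.
Qed.

Lemma EFin_section2 y : (\int[P]_x F (x, y))%:E = (\int[P]_x (F (x, y))%:E)%E.
Proof.
rewrite EFin_Rintegral; first by rewrite unlock.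
by apply: (@integrable_bounded _ _ _ _ _ 1) => //; exact: measurable_section2.
Qed.

Lemma measurable_partial_Rintegral : measurable_fun setT (fun x => \int[Q]_y F (x, y)).
Proof.
apply/measurable_EFinP; rewrite (_ : _ \o _ = fubini_F Q (EFin \o F)).
  exact: measurable_fun_fubini_tonelli_F.
by apply/funext => x; rewrite /= EFin_section1.
Qed.

Lemma Rintegral_swap :
  \int[P]_x \int[Q]_y F (x, y) = \int[Q]_y \int[P]_x F (x, y).
Proof.
congr fine.
under eq_integral do rewrite EFin_section1.
under [RHS]eq_integral do rewrite EFin_section2.
exact: (@fubini_tonelli _ _ _ _ _ P Q (EFin \o F)).
Qed.

End two_spaces.

(** The law of the pair (A, B) is a product measure because it is one on rectangles. The independent
    copy is expressed by integrating twice over the same [P], the form that the recursion on the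
    number of increments uses. *)
Lemma Rintegral_independent_sum d (T : measurableType d) (P : probability T R)
    (A B : T -> R) (g : R -> R) :
  measurable_fun setT A -> measurable_fun setT B ->
  (forall C D, measurable C -> measurable D ->
     P (A @^-1` C `&` B @^-1` D) = (P (A @^-1` C) * P (B @^-1` D))%E) ->
  measurable_fun setT g -> (forall x, 0 <= g x <= 1) ->
  \int[P]_w g (A w + B w) = \int[P]_v \int[P]_w g (A w + B v).
Proof.
move=> mA mB indAB mg g01.
pose A' : {RV P >-> R} := HB.pack A (isMeasurableFun.Build _ _ _ _ _ mA).
pose B' : {RV P >-> R} := HB.pack B (isMeasurableFun.Build _ _ _ _ _ mB).
have mAB : measurable_fun setT (fun w => (A w, B w)) by exact: measurable_fun_pair.
pose AB : {RV P >-> (R * R)%type} := HB.pack (fun w => (A w, B w))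
  (isMeasurableFun.Build _ _ _ _ _ mAB).
have mplus : measurable_fun setT (fun z : R * R => g (z.1 + z.2)).
  by apply: measurableT_comp => //; exact: measurable_funD.
have mplusE : measurable_fun setT (fun z : R * R => (g (z.1 + z.2))%:E).
  exact/measurable_EFinP.
have g0 (x : R) : (0 <= (g x)%:E)%E by rewrite lee_fin; have /andP[] := g01 x.
transitivity (\int[distribution P A']_x \int[distribution P B']_y g (x + y)).
  have mF := measurable_partial_Rintegral (distribution P B') mplus (fun z => g01 _).
  rewrite [RHS]/Rintegral; under [in RHS]eq_integral do
    rewrite (EFin_section1 (distribution P B') mplus (fun z => g01 _)).
  congr fine.
  rewrite -(@fubini_tonelli1 _ _ _ _ _ (distribution P A') (distribution P B')
    (fun z : R * R => (g (z.1 + z.2))%:E))//=.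
  rewrite -[LHS](ge0_integral_distribution AB mplusE (fun z => g0 _)).
  apply: eq_measure_integral => C mC _; apply/esym.
  exact: product_measure_unique.
transitivity (\int[P]_w \int[distribution P B']_y g (A w + y)).
  apply: (@Rintegral_eq_law _ _ (distribution P A') idfun _ _ P A
    (fun x => \int[distribution P B']_y g (x + y))) => //.
  - exact: measurable_id.
  - exact: (measurable_partial_Rintegral (distribution P B') mplus (fun z => g01 _)).
  - by move=> x; apply: Rintegral_ge0 => y _; have /andP[] := g01 (x + y).
transitivity (\int[P]_w \int[P]_v g (A w + B v)).
  apply: eq_Rintegral => w _.
  apply: (@Rintegral_eq_law _ _ (distribution P B') idfun _ _ P B (fun y => g (A w + y))) => //.
  - exact: measurable_id.
  - by apply: measurableT_comp => //; exact: measurable_funD.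
  - by move=> x; have /andP[] := g01 (A w + x).
have mF : measurable_fun setT (fun z : T * T => g (A z.1 + B z.2)).
  by apply: measurableT_comp => //; apply: measurable_funD; exact: measurableT_comp.
exact: (Rintegral_swap P P mF (fun z => g01 _)).
Qed.

End laws.

Section integrability.
Context d (T : measurableType d) (R : realType) (P : probability T R).
Implicit Types g h : T -> R.

Lemma integrable_cstT (b : R) : P.-integrable setT (EFin \o (fun=> b)).
Proof. by apply: (@integrable_bounded _ _ _ _ _ `|b|). Qed.

Lemma integrable_scale g (b : R) : P.-integrable setT (EFin \o g) ->
  P.-integrable setT (EFin \o (fun w => b * g w)).
Proof. by move=> Ig; rewrite /comp; under eq_fun do rewrite EFinM; exact: integrableZl. Qed.

Lemma integrable_add g h : P.-integrable setT (EFin \o g) ->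
  P.-integrable setT (EFin \o h) -> P.-integrable setT (EFin \o (fun w => g w + h w)).
Proof. by move=> Ig Ih; rewrite /comp; under eq_fun do rewrite EFinD; exact: integrableD. Qed.

Lemma integrable_sub g h : P.-integrable setT (EFin \o g) ->
  P.-integrable setT (EFin \o h) -> P.-integrable setT (EFin \o (fun w => g w - h w)).
Proof. by move=> Ig Ih; rewrite /comp; under eq_fun do rewrite EFinB; exact: integrableB. Qed.

Lemma integrable_fun01 g : measurable_fun setT g -> (forall w, 0 <= g w <= 1) ->
  P.-integrable setT (EFin \o g).
Proof.
move=> mg g01; apply: (@integrable_bounded _ _ _ _ _ 1) => // w.
by have /andP[h1 h2] := g01 w; rewrite ger0_norm.
Qed.

End integrability.

(** * Lindeberg replacement with an explicit error *)

Section test_functions.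
Variable R : realType.

(* Bounded functions with a uniform third-order Taylor estimate: exactly what
   the Lindeberg replacement consumes. *)
Definition test_function (f : R -> R) (M : R) : Prop :=
  [/\ forall x, 0 <= f x <= 1,
      forall x y, `|f x - f y| <= M * `|x - y| &
      exists alpha beta : R -> R,
        (forall x y, `|f (x + y) - f x - alpha x * y - beta x * y ^+ 2| <= M * `|y| ^+ 3) /\
        forall x, `|beta x| <= M].

Lemma lipschitz_continuous (f : R -> R) (M : R) :
  (forall x y, `|f x - f y| <= M * `|x - y|) -> continuous f.
Proof.
move=> fM x; apply/cvgrPdist_le => e e0.
have M1 : 0 < `|M| + 1 by rewrite ltr_wpDl.
near=> y.
apply: le_trans (fM x y) _; apply: (@le_trans _ _ ((`|M| + 1) * `|x - y|)).
  by rewrite ler_wpM2r// (le_trans (ler_norm M))// lerDl.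
rewrite -ler_pdivlMl//; near: y; apply: cvgr_dist_le; first exact: cvg_id.
by rewrite mulr_gt0 ?invr_gt0.
Unshelve. all: by end_near. Qed.

Variables (f : R -> R) (M : R).
Hypothesis tf : test_function f M.

Lemma test_function_ge0 : 0 <= M.
Proof. by have [_ /(_ 1 0)] := tf; rewrite subr0 normr1 mulr1 => h _; exact: le_trans h. Qed.

Lemma test_function_continuous : continuous f.
Proof. by have [_ h _] := tf; exact: lipschitz_continuous h. Qed.

Lemma test_function_measurable : measurable_fun setT f.
Proof. by apply: continuous_measurable_fun; exact: test_function_continuous. Qed.

Lemma taylor_expectation d (T : measurableType d) (P : probability T R) (Y : T -> R) :
  measurable_fun setT Y ->
  P.-integrable setT (EFin \o Y) ->
  P.-integrable setT (EFin \o (fun w => Y w ^+ 2)) ->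
  P.-integrable setT (EFin \o (fun w => `|Y w| ^+ 3)) ->
  forall (alpha beta : R -> R) x,
  (forall y, `|f (x + y) - f x - alpha x * y - beta x * y ^+ 2| <= M * `|y| ^+ 3) ->
  `|\int[P]_w f (x + Y w) - f x - alpha x * \int[P]_w Y w
      - beta x * \int[P]_w (Y w ^+ 2)| <= M * \int[P]_w (`|Y w| ^+ 3).
Proof.
move=> mY I1 I2 I3 alpha beta x taylor.
have [f01 _ _] := tf.
have mfY : measurable_fun setT (fun w => f (x + Y w)).
  by apply: measurableT_comp; [exact: test_function_measurable|exact: measurable_funD].
have If := integrable_fun01 P mfY (fun w => f01 _).
have Ic := integrable_cstT P (f x).
have I0 := integrable_sub If Ic.
have J1 := integrable_scale (alpha x) I1.
have J2 := integrable_scale (beta x) I2.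
have I01 := integrable_sub I0 J1.
have -> : \int[P]_w f (x + Y w) - f x - alpha x * \int[P]_w Y w
      - beta x * \int[P]_w (Y w ^+ 2) =
    \int[P]_w (f (x + Y w) - f x - alpha x * Y w - beta x * Y w ^+ 2).
  rewrite (RintegralB measurableT I01 J2) (RintegralB measurableT I0 J1).
  by rewrite (RintegralB measurableT If Ic) Rintegral_cstT !RintegralZl.
have I4 := integrable_sub I01 J2.
apply: le_trans (le_normr_Rintegral measurableT I4) _.
rewrite -RintegralZl//; apply: le_Rintegral => //.
- exact: (integrable_abse I4).
- exact: integrable_scale.
Qed.

End test_functions.

Section gauss_affine.
Variable R : realType.
Local Notation TR := (measurableTypeR R).
Local Notation gauss := (normal_prob (0 : R) 1 : probability TR R).

Lemma measurable_gauss_affine (m s : R) : measurable_fun setT (fun z : TR => m + s * (z : R)).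
Proof. by apply: measurable_funD => //; exact: measurable_funM. Qed.

Lemma integrable_gauss_affine_exp (m s b : R) :
  gauss.-integrable setT (EFin \o (fun z : TR => expR (b * (m + s * (z : R))))).
Proof.
rewrite (_ : _ \o _ = fun z : TR => ((expR (b * m))%:E * (expR (b * s * (z : R)))%:E)%E).
  by apply: integrableZl => //; exact: integrable_gauss_exp.
by apply/funext => z /=; rewrite -EFinM -expRD; congr (expR _)%:E; ring.
Qed.

Lemma integrable_gauss_affine_abs_pow (m s : R) n :
  gauss.-integrable setT (EFin \o (fun z : TR => `|m + s * (z : R)| ^+ n)).
Proof.
apply: (@integrable_abs_pow _ TR R gauss (fun z : TR => m + s * (z : R)) 1) => //.
  exact: measurable_gauss_affine.
by move=> b _; exact: integrable_gauss_affine_exp.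
Qed.

Lemma integrable_gauss_affine_pow (m s : R) n :
  gauss.-integrable setT (EFin \o (fun z : TR => (m + s * (z : R)) ^+ n)).
Proof.
apply: (@integrable_pow _ TR R gauss (fun z : TR => m + s * (z : R)) 1) => //.
  exact: measurable_gauss_affine.
by move=> b _; exact: integrable_gauss_affine_exp.
Qed.

Lemma integrable_gauss_id : gauss.-integrable setT (EFin \o (fun z : TR => (z : R))).
Proof.
by have := @integrable_gauss_pow R 1; rewrite /comp; under eq_fun do rewrite expr1.
Qed.

Lemma gauss_affine_mean (m s : R) : \int[gauss]_z (m + s * (z : R)) = m.
Proof.
have I1 := integrable_gauss_id; have Ic := integrable_cstT gauss m.
rewrite (RintegralD measurableT Ic (integrable_scale s I1)).
by rewrite Rintegral_cstT RintegralZl// gauss_mean mulr0 addr0.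
Qed.

Lemma gauss_affine_second_moment (m s : R) :
  \int[gauss]_z ((m + s * (z : R)) ^+ 2) = m ^+ 2 + s ^+ 2.
Proof.
have I2 := @integrable_gauss_pow R 2.
have I1 : gauss.-integrable setT (EFin \o (fun z : TR => m + s * (z : R))).
  have := integrable_gauss_affine_pow m s 1.
  by rewrite /comp; under eq_fun do rewrite expr1.
transitivity (\int[gauss]_z (- m ^+ 2 + (2 * m) * (m + s * (z : R)) + s ^+ 2 * (z : R) ^+ 2)).
  by apply: eq_Rintegral => z _; ring.
have Ic := integrable_cstT gauss (- m ^+ 2).
have J1 := integrable_scale (2 * m) I1.
rewrite (RintegralD measurableT (integrable_add Ic J1) (integrable_scale (s ^+ 2) I2)).
rewrite (RintegralD measurableT Ic J1).
rewrite Rintegral_cstT !RintegralZl// gauss_affine_mean gauss_second_moment.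
ring.
Qed.

End gauss_affine.

Section lindeberg.
Variable R : realType.
Local Notation TR := (measurableTypeR R).
Local Notation gauss := (normal_prob (0 : R) 1 : probability TR R).
Context d (T : measurableType d) (P : probability T R).
Variables (f : R -> R) (M : R) (X : T -> R) (U : nat -> T -> R) (a mean sd : R).
Hypotheses (tf : test_function f M) (mX : measurable_fun setT X)
  (mU : forall n, measurable_fun setT (U n)) (a_gt0 : 0 < a) (sd_ge0 : 0 <= sd).
Hypothesis integrable_powX : forall n, P.-integrable setT (EFin \o (fun w => X w ^+ n)).
Hypothesis integrable_cubeX : P.-integrable setT (EFin \o (fun w => `|X w| ^+ 3)).
Hypothesis meanX : \int[P]_w X w = mean.
Hypothesis U0 : {ae P, forall w, U 0 w = 0}.
(** The random walk [U] enters through its one-step law: the next value adds an independent copy of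
    [X]. *)
Hypothesis U_step : forall n (g : R -> R), measurable_fun setT g ->
  (forall x, 0 <= g x <= 1) ->
  \int[P]_w g (U n.+1 w) = \int[P]_v \int[P]_w g (U n w + X v).

Definition gauss_smoothing (m s x : R) : R := \int[gauss]_z f (x + m + s * (z : R)).

(* The cost of replacing one increment [X / a] by a Gaussian of mean [mean / a]
   and standard deviation [sd / a]; the first term is there because [sd ^+ 2]
   need not be the variance of [X] (it is 0 in the drift regime). *)
Definition lindeberg_error : R :=
  M * `|\int[P]_w (X w ^+ 2) - mean ^+ 2 - sd ^+ 2| / a ^+ 2 +
  M * (\int[P]_w (`|X w| ^+ 3) + \int[gauss]_z (`|mean + sd * (z : R)| ^+ 3)) / a ^+ 3.

(** Both expectations are expanded at the same [x]. The first-order terms cancel because the means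
    agree, the second-order terms differ by the mismatch of second moments, and the remainders are
    the third absolute moments. *)
Lemma one_step_error x :
  `|\int[P]_w f (x + X w / a) - gauss_smoothing (mean / a) (sd / a) x| <= lindeberg_error.
Proof.
have [_ _ [alpha [beta [taylor betaM]]]] := tf.
have M0 := test_function_ge0 tf.
have I1 : P.-integrable setT (EFin \o X).
  by have := integrable_powX 1; rewrite /comp; under eq_fun do rewrite expr1.
pose Y w := a^-1 * X w.
have Y1 : \int[P]_w Y w = a^-1 * mean by rewrite RintegralZl// meanX.
have Y2E w : Y w ^+ 2 = a ^- 2 * X w ^+ 2 by rewrite /Y exprMn exprVn.
have Y3E w : `|Y w| ^+ 3 = a ^- 3 * `|X w| ^+ 3.
  by rewrite /Y normrM exprMn normrV ?unitfE ?gt_eqF// gtr0_norm// exprVn.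
have mY : measurable_fun setT Y by exact: measurable_funM.
have IY1 : P.-integrable setT (EFin \o Y) by exact: integrable_scale.
have IY2 : P.-integrable setT (EFin \o (fun w => Y w ^+ 2)).
  by under eq_fun do rewrite Y2E; exact: integrable_scale.
have IY3 : P.-integrable setT (EFin \o (fun w => `|Y w| ^+ 3)).
  by under eq_fun do rewrite Y3E; exact: integrable_scale.
have tY := taylor_expectation tf mY IY1 IY2 IY3 (taylor x).
have Y2 : \int[P]_w (Y w ^+ 2) = a ^- 2 * \int[P]_w (X w ^+ 2).
  by under eq_Rintegral do rewrite Y2E; rewrite RintegralZl.
have Y3 : \int[P]_w (`|Y w| ^+ 3) = a ^- 3 * \int[P]_w (`|X w| ^+ 3).
  by under eq_Rintegral do rewrite Y3E; rewrite RintegralZl.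
pose V (z : TR) : R := mean / a + sd / a * (z : R).
have VE z : V z = a^-1 * (mean + sd * (z : R)) by rewrite /V; ring.
have V3E z : `|V z| ^+ 3 = a ^- 3 * `|mean + sd * (z : R)| ^+ 3.
  by rewrite VE normrM exprMn normrV ?unitfE ?gt_eqF// gtr0_norm// exprVn.
have mV : measurable_fun setT V by exact: measurable_gauss_affine.
have IV1 : gauss.-integrable setT (EFin \o V).
  have := integrable_gauss_affine_pow (mean / a) (sd / a) 1.
  by rewrite /comp; under eq_fun do rewrite expr1.
have IV2 := integrable_gauss_affine_pow (mean / a) (sd / a) 2.
have IV3 := integrable_gauss_affine_abs_pow (mean / a) (sd / a) 3.
have tV := taylor_expectation tf mV IV1 IV2 IV3 (taylor x).
have V3 : \int[gauss]_w (`|V w| ^+ 3) = a ^- 3 * \int[gauss]_z (`|mean + sd * (z : R)| ^+ 3).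
  under eq_Rintegral do rewrite V3E; rewrite RintegralZl//.
  exact: integrable_gauss_affine_abs_pow.
move: tY tV; rewrite Y1 Y2 Y3 V3 gauss_affine_mean gauss_affine_second_moment => tY tV.
have -> : \int[P]_w f (x + X w / a) = \int[P]_w f (x + Y w).
  by apply: eq_Rintegral => w _; rewrite /Y mulrC.
have -> : gauss_smoothing (mean / a) (sd / a) x = \int[gauss]_z f (x + V z).
  by apply: eq_Rintegral => z _; rewrite /V addrA.
set A := Rintegral _ _ _ in tY *; set B := Rintegral _ _ _ in tV *.
set m2 := Rintegral _ _ _ in tY *.
have bound : `|beta x * (a ^- 2 * (m2 - mean ^+ 2 - sd ^+ 2))| <=
    M * `|m2 - mean ^+ 2 - sd ^+ 2| / a ^+ 2.
  rewrite normrM normrM normfV normrX (gtr0_norm a_gt0) mulrA mulrAC.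
  by rewrite ler_wpM2r// ?invr_ge0 ?exprn_ge0 ?ler_wpM2r// ltW.
rewrite /lindeberg_error.
have -> : A - B = (A - f x - alpha x * (a^-1 * mean) - beta x * (a ^- 2 * m2))
   - (B - f x - alpha x * (mean / a) - beta x * ((mean / a) ^+ 2 + (sd / a) ^+ 2))
   + beta x * (a ^- 2 * (m2 - mean ^+ 2 - sd ^+ 2)).
  by rewrite !exprMn exprVn; ring.
apply: le_trans (ler_normD _ _) _; rewrite addrC.
apply: lerD bound _; apply: le_trans (ler_normB _ _) _.
by apply: le_trans (lerD tY tV) _; rewrite -!mulrDr -mulrA (mulrC (a ^- 3)).
Qed.

Let mf : measurable_fun setT f.
Proof. exact: test_function_measurable tf. Qed.

Let f01 x : 0 <= f x <= 1.
Proof. by have [] := tf. Qed.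

Lemma gauss_smoothing01 m s x : 0 <= gauss_smoothing m s x <= 1.
Proof.
apply: Rintegral_bounds => // .
by apply: measurableT_comp => //; exact: measurable_gauss_affine.
Qed.

Lemma gauss_smoothing_comp m1 s1 m2 s2 x : 0 <= s1 -> 0 <= s2 ->
  \int[gauss]_z gauss_smoothing m1 s1 (x + m2 + s2 * (z : R)) =
  gauss_smoothing (m1 + m2) (Num.sqrt (s1 ^+ 2 + s2 ^+ 2)) x.
Proof.
move=> s10 s20.
pose g y := f (x + m1 + m2 + y).
have cg : continuous g.
  have [_ lip _] := tf; apply: (@lipschitz_continuous _ _ M) => u v.
  by rewrite (le_trans (lip _ _))// /g opprD addrACA subrr add0r.
have := @gauss_convolution R g s1 s2 cg (fun y => f01 _) s10 s20.
rewrite /gauss_smoothing /g => h.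
transitivity (\int[gauss]_z f (x + m1 + m2 + Num.sqrt (s1 ^+ 2 + s2 ^+ 2) * (z : R))).
  rewrite -h; apply: eq_Rintegral => z _; apply: eq_Rintegral => y _.
  by congr f => /=; ring.
by apply: eq_Rintegral => z _; rewrite (addrA x).
Qed.

(** Induction on the number of increments: replace the first [n] by the induction hypothesis, then
    the last one by [one_step_error]. Bounds uniform in [x] are what allow integrating them over the
    other increments. *)
Lemma lindeberg n x :
  `|\int[P]_w f (x + U n w / a) -
    gauss_smoothing (n%:R * (mean / a)) (Num.sqrt n%:R * (sd / a)) x|
  <= n%:R * lindeberg_error.
Proof.
elim: n x => [|n IHn] x.
  rewrite !mul0r sqrtr0 !mul0r.
  rewrite (_ : _ - _ = 0) ?normr0//; apply/eqP; rewrite subr_eq0; apply/eqP.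
  transitivity (f x).
    rewrite -[RHS](Rintegral_cstT P); apply: ae_eq_Rintegral => //.
      by apply: measurableT_comp => //; apply: measurable_funD => //; exact: measurable_funM.
    by apply: filterS U0 => w ->; rewrite mul0r addr0.
  rewrite /gauss_smoothing -[LHS](Rintegral_cstT gauss); apply: eq_Rintegral => z _.
  by rewrite mul0r !addr0.
have s0 : 0 <= sd / a by rewrite divr_ge0// ltW.
pose m := n%:R * (mean / a); pose s := Num.sqrt n%:R * (sd / a).
have ss0 : 0 <= s by rewrite mulr_ge0// sqrtr_ge0.
have mg : measurable_fun setT (fun u : R => f (x + u / a)).
  by apply: measurableT_comp => //; apply: measurable_funD => //; exact: measurable_funM.
rewrite (U_step n mg (fun u => f01 _)).
pose u y := \int[P]_w f (y + U n w / a).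
pose v y := gauss_smoothing m s y.
have jm : measurable_fun setT (fun z : T * T => f (x + (U n z.2 + X z.1) / a)).
  apply: measurableT_comp => //; apply: measurable_funD => //.
  by apply: measurable_funM => //; apply: measurable_funD; exact: measurableT_comp.
have ufE v0 : \int[P]_w f (x + (U n w + X v0) / a) = u (x + X v0 / a).
  by apply: eq_Rintegral => w _; congr f => /=; ring.
have mu' : measurable_fun setT (fun w => u (x + X w / a)).
  have := measurable_partial_Rintegral P jm (fun z => f01 _).
  by under eq_fun do rewrite ufE.
have jv : measurable_fun setT (fun z : T * TR => f (x + X z.1 / a + m + s * (z.2 : R))).
  apply: measurableT_comp => //; apply: measurable_funD.
    apply: measurable_funD => //; apply: measurable_funD => //.
    by apply: measurable_funM => //; exact: measurableT_comp.
  by apply: measurable_funM => //; exact: measurable_snd.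
have mv' : measurable_fun setT (fun w => v (x + X w / a)).
  exact: (measurable_partial_Rintegral gauss jv (fun z => f01 _)).
have u01 y : 0 <= u y <= 1.
  apply: Rintegral_bounds => //; apply: measurableT_comp => //.
  by apply: measurable_funD => //; exact: measurable_funM.
have v01 y : 0 <= v y <= 1 by exact: gauss_smoothing01.
have Iu : P.-integrable setT (EFin \o (fun w => u (x + X w / a))).
  apply: (@integrable_bounded _ _ _ _ _ 1) => // w.
  by have /andP[h1 h2] := u01 (x + X w / a); rewrite ger0_norm.
have Iv : P.-integrable setT (EFin \o (fun w => v (x + X w / a))).
  apply: (@integrable_bounded _ _ _ _ _ 1) => // w.
  by have /andP[h1 h2] := v01 (x + X w / a); rewrite ger0_norm.
under eq_Rintegral do rewrite ufE.
have bnd1 : `|\int[P]_w u (x + X w / a) - \int[P]_w v (x + X w / a)| <= n%:R * lindeberg_error.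
  rewrite -RintegralB// ler_norml.
  apply: Rintegral_bounds; first exact: measurable_funB.
  by move=> w; rewrite -ler_norml; exact: IHn.
have vE : gauss_smoothing (n.+1%:R * (mean / a)) (Num.sqrt n.+1%:R * (sd / a)) x =
    \int[gauss]_z v (x + mean / a + sd / a * (z : R)).
  rewrite gauss_smoothing_comp//; congr gauss_smoothing.
    by rewrite -natr1 mulrDl mul1r.
  rewrite /s exprMn sqr_sqrtr// -{2}(mul1r ((sd / a) ^+ 2)) -mulrDl natr1.
  by rewrite sqrtrM// sqrtr_sqr ger0_norm.
have jG : measurable_fun setT (fun z : TR * TR =>
    f (x + mean / a + sd / a * (z.1 : R) + m + s * (z.2 : R))).
  apply: measurableT_comp => //; apply: measurable_funD; last first.
    by apply: measurable_funM => //; exact: measurable_snd.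
  apply: measurable_funD => //; apply: measurable_funD => //.
  by apply: measurable_funM => //; exact: measurable_fst.
(* [v] is a Gaussian average of translates of [f]. Exchanging the integrals brings the last
   replacement inside, where the one-step bound is applied to [f] itself. *)
have bnd2 : `|\int[P]_w v (x + X w / a) - \int[gauss]_z v (x + mean / a + sd / a * (z : R))|
    <= lindeberg_error.
  have -> : \int[P]_w v (x + X w / a) =
      \int[gauss]_z \int[P]_w f (x + m + s * (z : R) + X w / a).
    rewrite (Rintegral_swap P gauss jv (fun z => f01 _)).
    by apply: eq_Rintegral => z _; apply: eq_Rintegral => w _; congr f => /=; ring.
  have -> : \int[gauss]_z v (x + mean / a + sd / a * (z : R)) =
      \int[gauss]_z gauss_smoothing (mean / a) (sd / a) (x + m + s * (z : R)).
    rewrite (Rintegral_swap gauss gauss jG (fun z => f01 _)).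
    by apply: eq_Rintegral => z _; apply: eq_Rintegral => w _; congr f => /=; ring.
  have m1 : measurable_fun setT (fun z : TR => \int[P]_w f (x + m + s * (z : R) + X w / a)).
    have jX : measurable_fun setT (fun z : TR * T => f (x + m + s * (z.1 : R) + X z.2 / a)).
      apply: measurableT_comp => //; apply: measurable_funD.
        by apply: measurable_funD => //; apply: measurable_funM => //; exact: measurable_fst.
      by apply: measurable_funM => //; exact: measurableT_comp.
    exact: (measurable_partial_Rintegral P jX (fun z => f01 _)).
  have m2 : measurable_fun setT (fun z : TR =>
      gauss_smoothing (mean / a) (sd / a) (x + m + s * (z : R))).
    have jY : measurable_fun setT (fun z : TR * TR =>
        f (x + m + s * (z.1 : R) + mean / a + sd / a * (z.2 : R))).
      apply: measurableT_comp => //; apply: measurable_funD; last first.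
        by apply: measurable_funM => //; exact: measurable_snd.
      apply: measurable_funD => //; apply: measurable_funD => //.
      by apply: measurable_funM => //; exact: measurable_fst.
    exact: (measurable_partial_Rintegral gauss jY (fun z => f01 _)).
  have b1 z : 0 <= \int[P]_w f (x + m + s * z + X w / a) <= 1.
    apply: Rintegral_bounds => //; apply: measurableT_comp => //.
    by apply: measurable_funD => //; exact: measurable_funM.
  rewrite -RintegralB//.
  - rewrite ler_norml; apply: Rintegral_bounds; first exact: measurable_funB.
    by move=> z; rewrite -ler_norml; exact: one_step_error.
  - apply: (@integrable_bounded _ _ _ _ _ 1) => // z.
    by have /andP[h1 h2] := b1 z; rewrite ger0_norm.
  - apply: (@integrable_bounded _ _ _ _ _ 1) => // z.
    by have /andP[h1 h2] := gauss_smoothing01 (mean / a) (sd / a) (x + m + s * z); rewrite ger0_norm.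
rewrite vE -[n.+1%:R]natr1 mulrDl mul1r.
apply: le_trans (lerD bnd1 bnd2); apply: le_trans (ler_normD _ _).
by rewrite addrA subrK.
Qed.

End lindeberg.

(** * Path bounds and increments of Levy processes *)

Section cadlag_paths.
Variable R : realType.

Lemma cvg_locally_bounded (f : R -> R) (F : set_system R) (FF : Filter F) (l : R) :
  f y @[y --> F] --> l -> \forall y \near F, `|f y| <= `|l| + 1.
Proof.
move=> fl; have /cvgrPdist_le/(_ _ ltr01) := fl; apply: filterS => y h.
rewrite -lerBlDl (le_trans _ h)// distrC.
by rewrite (le_trans (ler_norm _))// ler_dist_dist.
Qed.

Lemma cadlag_locally_bounded (f : R -> R) : cadlag f -> forall x : R, 0 <= x ->
  exists K : R, \forall y \near x, 0 <= y -> `|f y| <= K.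
Proof.
move=> [fr fl] x x0.
have right : \forall y \near x, x < y -> `|f y| <= `|f x| + 1.
  exact: (cvg_locally_bounded _ (fr x x0)).
have [L left] : exists L : R, \forall y \near x, y < x -> 0 <= y -> `|f y| <= L.
  have [->|xp] := eqVneq x 0.
    by exists 0; apply: (@filterE _ (nbhs (0 : R))) => y y0; rewrite leNgt y0.
  have xgt0 : 0 < x by rewrite lt_neqAle eq_sym xp.
  have /cvg_ex[l cl] := fl x xgt0.
  exists (`|l| + 1); have := cvg_locally_bounded _ cl.
  rewrite /at_left /prop_near1 nbhs_nearE near_withinE => /(_ _) h.
  have {}h : \forall y \near x, y < x -> `|f y| <= `|l| + 1 by apply: h.
  by apply: filterS h => y h yx _; exact: h.
exists (Num.max (`|f x| + 1) L).
apply: filterS2 right left => y ry ly y0; rewrite le_max.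
have [yx|yx|->] := ltgtP y x; last by rewrite lerDl ler01.
  by rewrite ly ?orbT.
by rewrite ry.
Qed.

(** The local bounds glue by compactness of [0, 1], in the near-covering form with the bound itself
    as the parameter tending to infinity. *)
Lemma cadlag_bounded (f : R -> R) : cadlag f ->
  exists K : R, forall s, 0 <= s <= 1 -> `|f s| <= K.
Proof.
move=> cf.
have := @segment_compact R 0 1; rewrite compact_near_coveringP => cov.
have := cov R (pinfty_nbhs R) (fun K x => 0 <= x -> `|f x| <= K) _.
case.
  move=> x /=; rewrite in_itv/= => /andP[x0 x1].
  have [K0 h] := cadlag_locally_bounded cf x0.
  have hK : \forall K \near +oo, K0 <= K by apply: nbhs_pinfty_ge; exact: num_real.
  exists ([set y | 0 <= y -> `|f y| <= K0], [set K | K0 <= K]) => //=.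
  by move=> [y K]/= [hy K0K] y0; rewrite (le_trans (hy y0)).
move=> K [_ hK]; exists (K + 1) => s s01.
have /andP[s0 s1] := s01.
apply: (hK (K + 1)); [by rewrite ltrDl|by rewrite /= in_itv/=|exact: s0].
Qed.

End cadlag_paths.

Section levy_steps.
Variable R : realType.
Context d (T : measurableType d) (P : probability T R).
Variable S : R -> {RV P >-> R}.
Hypothesis S_levy : levy_process S.
Hypothesis S_mgf : \forall theta \near (0 : R), ('M_P (S 1%R) theta < +oo)%E.

Lemma mgf_integrable : exists2 e : R, 0 < e &
  forall a, `|a| < e -> P.-integrable setT (EFin \o (fun w => expR (a * S 1 w))).
Proof.
have /nbhs_ballP[e /= e0 h] := S_mgf; exists e => // a ae.
have := h a; rewrite /ball/= sub0r normrN => /(_ ae).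
rewrite /mmt_gen_fun unlock => hlt.
apply/integrableP; split.
  by apply/measurable_EFinP; apply: measurableT_comp => //; exact: measurable_funM.
apply: le_lt_trans hlt.
rewrite le_eqVlt; apply/orP; left; apply/eqP; apply: eq_integral => w _ /=.
by rewrite ger0_norm ?expR_ge0// mulrC.
Qed.

Lemma levy_step n (g : R -> R) : measurable_fun setT g -> (forall x, 0 <= g x <= 1) ->
  \int[P]_w g (S n.+1%:R w) = \int[P]_v \int[P]_w g (S n%:R w + S 1 v).
Proof.
move=> mg g01; have [S0 indS statS _] := S_levy.
have mgS (Y : T -> R) : measurable_fun setT Y -> measurable_fun setT (fun w => g (Y w)).
  by move=> mY; exact: measurableT_comp.
pose A w := S n%:R w - S 0 w; pose B w := S n.+1%:R w - S n%:R w.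
have mA : measurable_fun setT A by exact: measurable_funB.
have mB : measurable_fun setT B by exact: measurable_funB.
have AE : {ae P, forall w, A w = S n%:R w}.
  by apply: filterS S0 => w; rewrite /A => ->; rewrite subr0.
transitivity (\int[P]_w g (A w + B w)).
  apply: ae_eq_Rintegral; [exact: mgS|by apply: mgS => //; exact: measurable_funD|].
  by apply: filterS AE => w ->; rewrite /B addrC subrK.
have indAB C D : measurable C -> measurable D ->
    P (A @^-1` C `&` B @^-1` D) = (P (A @^-1` C) * P (B @^-1` D))%E.
  move=> mC mD.
  (* [independent_increments] takes an infinite nondecreasing sequence of times; the relevant ones
     are 0, n, n+1, and the rest merely continue the sequence. *)
  pose t (i : nat) : R := match i with 0 => 0 | 1 => n%:R | _ => n.+1%:R + (i - 2)%:R end.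
  have t0 : 0 <= t 0%N by [].
  have t_mono i : t i <= t i.+1.
    case: i => [|[|i]] //=; first by rewrite subnn addr0 ler_nat.
    by rewrite lerD2l ler_nat leq_sub2r.
  have := indS 2%N t t0 t_mono finset.setT
    (fun i : 'I_2 => if i == ord0 then A @^-1` C else B @^-1` D).
  rewrite (_ : \bigcap_(i in _) _ = A @^-1` C `&` B @^-1` D); last first.
    apply/seteqP; split => w /=.
      move=> h; split; first exact: (h ord0 (finset.in_setT _)).
      exact: (h ord_max (finset.in_setT _)).
    move=> [h1 h2] i _; case: ifP => //.
  move=> ->.
    by rewrite (eq_bigl xpredT) ?big_ord_recl ?big_ord0 ?mule1//= => i; rewrite inE.
  move=> i _; case: i => -[|[|//]] i2 /=.
    by exists C => //; rewrite setTI.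
  by rewrite subnn addr0; exists D => //; rewrite setTI.
rewrite (Rintegral_independent_sum mA mB indAB mg g01).
have mpair (Y : T -> R) : measurable_fun setT Y ->
    measurable_fun setT (fun z : R * T => g (Y z.2 + z.1)).
  move=> mY; apply: measurableT_comp => //; apply: measurable_funD => //.
  exact: measurableT_comp.
pose G y := \int[P]_w g (S n%:R w + y).
have mG : measurable_fun setT G.
  by apply: (measurable_partial_Rintegral P (mpair (S n%:R) _) (fun z => g01 _)).
have G0 y : 0 <= G y by apply: Rintegral_ge0 => w _; have /andP[] := g01 (S n%:R w + y).
transitivity (\int[P]_v G (B v)).
  apply: eq_Rintegral => v _; apply: ae_eq_Rintegral.
  - by apply: mgS => //; exact: measurable_funD.
  - by apply: mgS => //; exact: measurable_funD.
  - by apply: filterS AE => w ->.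
apply: (@Rintegral_eq_law _ _ _ _ _ _ _ _ _ G) => // D mD.
have := statS n%:R 1 (ler0n _ _) ler01 D mD.
by rewrite /pushforward /distribution /pushforward natr1.
Qed.

End levy_steps.

Lemma cvg_dist_squeeze (R : realType) (u v w : nat -> R) (l : R) :
  (forall n, `|u n - v n| <= w n) -> w n @[n --> \oo] --> 0 ->
  v n @[n --> \oo] --> l -> u n @[n --> \oo] --> l.
Proof.
move=> uvw w0 vl; apply: (@squeeze_cvgr _ _ _ _ (v \- w) (v \+ w)).
- by apply: nearW => n; have := uvw n; rewrite ler_distl.
- by rewrite -[l]subr0; exact: cvgB.
- by rewrite -[l]addr0; exact: cvgD.
Qed.

Section levy_limit.
Variable R : realType.
Local Notation TR := (measurableTypeR R).
Local Notation gauss := (normal_prob (0 : R) 1 : probability TR R).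
Context d (T : measurableType d) (P : probability T R).
Variable S : R -> {RV P >-> R}.
Hypothesis S_levy : levy_process S.
Variables (f : R -> R) (M : R).
Hypothesis tf : test_function f M.

Let f01 x : 0 <= f x <= 1.
Proof. by have [] := tf. Qed.

Let mf : measurable_fun setT f.
Proof. exact: test_function_measurable tf. Qed.

Let M_ge0 : 0 <= M.
Proof. exact: test_function_ge0 tf. Qed.

(** Dominates the change of f (S b) over an increment [x] of S: by the Lipschitz bound, and by 1 as
    [f] has values in [0, 1]. The cap permits bounded convergence. *)
Let g (b x : R) : R := Num.min 1 (M * (`|x| * b)).

Let mg (b : R) : measurable_fun setT (g b).
Proof.
apply: measurable_minr => //; apply: measurable_funM => //.
by apply: measurable_funM => //; exact: measurable_normr.
Qed.

Let g01 (b x : R) : 0 <= b -> 0 <= g b x <= 1.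
Proof. by move=> b0; rewrite le_min ler01 ge_min lexx !mulr_ge0. Qed.

Lemma levy_increment_error (b u v : R) : 0 <= b -> 0 <= u -> u <= v ->
  `|\int[P]_w f (S v w * b) - \int[P]_w f (S u w * b)| <= \int[P]_w g b (S (v - u) w).
Proof.
move=> b0 u0 uv.
have mS (x : R) : measurable_fun setT (fun w => f (S x w * b)).
  by apply: measurableT_comp => //; exact: measurable_funM.
have I1 := integrable_fun01 P (mS v) (fun w => f01 _).
have I2 := integrable_fun01 P (mS u) (fun w => f01 _).
have mD : measurable_fun setT (S v \- S u) by exact: measurable_funB.
have I3 : P.-integrable setT (EFin \o (fun w => g b ((S v \- S u) w))).
  by apply: integrable_fun01 => [|w]; [exact: measurableT_comp|exact: g01].
have -> : \int[P]_w g b (S (v - u) w) = \int[P]_w g b ((S v \- S u) w).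
  apply/esym; apply: (@Rintegral_eq_law _ _ _ _ _ _ _ _ _ (g b)) => //.
    move=> D mD'; have [_ _ statS _] := S_levy.
    have := statS u (v - u) u0 _ D mD'.
    by rewrite subr_ge0 addrC subrK => /(_ uv).
  by move=> x; have /andP[] := g01 x b0.
rewrite -RintegralB//.
apply: le_trans (le_normr_Rintegral measurableT (integrable_sub I1 I2)) _.
apply: le_Rintegral => //; first exact: (integrable_abse (integrable_sub I1 I2)).
move=> w _; rewrite /= le_min; apply/andP; split.
  have /andP[h1 h2] := f01 (S v w * b); have /andP[h3 h4] := f01 (S u w * b).
  by rewrite ler_norml; lra.
have [_ lip _] := tf; apply: le_trans (lip _ _) _.
by rewrite -mulrBl normrM (ger0_norm b0).
Qed.

Lemma levy_increment_vanish (b s : nat -> R) : (forall n, 0 <= b n) ->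
  b n @[n --> \oo] --> 0 -> (forall n, 0 <= s n <= 1) ->
  \int[P]_w g (b n) (S (s n) w) @[n --> \oo] --> 0.
Proof.
move=> b0 bcv s01; rewrite -[X in _ --> X](Rintegral_cstT P).
have [_ _ _ cS] := S_levy.
apply: (@bounded_convergence _ _ _ _ _ _ 1) => //.
- by move=> n; apply: measurableT_comp => //; exact: mg.
- by move=> n w; have /andP[h1 h2] := g01 (S (s n) w) (b0 n); rewrite ger0_norm.
apply: filterS cS => w /cadlag_bounded[K hK].
apply: (@squeeze_cvgr _ _ _ _ (fun=> 0) (fun n => M * (K * b n))).
- apply: nearW => n; have /andP[-> _] /= := g01 (S (s n) w) (b0 n).
  by rewrite ge_min ler_wpM2l ?orbT// ler_wpM2r// hK.
- exact: cvg_cst.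
- rewrite -(mulr0 M) -(mulr0 K); apply: cvgMr; exact: cvgMr.
Qed.



Hypothesis S_mgf : \forall theta \near (0 : R), ('M_P (S 1%R) theta < +oo)%E.

Lemma gauss_smoothing_limit (m s : nat -> R) (m0 s0 : R) (x : R) :
  m n @[n --> \oo] --> m0 -> s n @[n --> \oo] --> s0 ->
  gauss_smoothing f (m n) (s n) x @[n --> \oo] --> gauss_smoothing f m0 s0 x.
Proof.
move=> cm cs; have mV (a b : R) : measurable_fun setT (fun z : TR => f (x + a + b * (z : R))).
  by apply: measurableT_comp => //; exact: measurable_gauss_affine.
apply: (@bounded_convergence _ _ _ _ _ _ 1) => //.
- by move=> n z; have /andP[h1 h2] := f01 (x + m n + s n * z); rewrite ger0_norm.
- apply: (@aeW _ _ _ gauss) => z.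
  apply: continuous_cvg; first exact: (test_function_continuous tf (x := _)).
  by apply: cvgD; [apply: cvgD => //; exact: cvg_cst|exact: cvgMl].
Qed.

(* The Lindeberg bound applies at the integer part of [u n]; the remaining
   increment has the law of [S] at a time in [0, 1], where the paths are bounded
   because they are cadlag. *)
Lemma levy_limit (b u : nat -> R) (sd A B : R) : 0 <= sd ->
  (forall n, 0 < b n) -> (forall n, 0 <= u n) ->
  b n @[n --> \oo] --> 0 ->
  u n * (`|\int[P]_w (S 1 w ^+ 2) - (\int[P]_w S 1 w) ^+ 2 - sd ^+ 2| * b n ^+ 2)
    @[n --> \oo] --> 0 ->
  u n * b n ^+ 3 @[n --> \oo] --> 0 ->
  u n * (\int[P]_w S 1 w * b n) @[n --> \oo] --> A ->
  Num.sqrt (u n) * (sd * b n) @[n --> \oo] --> B ->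
  \int[P]_w f (S (u n) w * b n) @[n --> \oo] --> \int[gauss]_z f (A + B * (z : R)).
Proof.
set mean := \int[P]_w S 1 w => sd0 b_gt0 u_ge0 bcv cv2 cv3 cvA cvB.
have b0 n : 0 <= b n by exact: ltW.
pose N n := Num.truncn (u n).
have Nu n : (N n)%:R <= u n by have /andP[] := truncn_itv (u_ge0 n).
have uN n : u n <= (N n)%:R + 1.
  by have /andP[_ /ltW] := truncn_itv (u_ge0 n); rewrite natr1.
have cvmean : (N n)%:R * (mean * b n) @[n --> \oo] --> A.
  apply: (@cvg_dist_squeeze _ _ (fun n => u n * (mean * b n)) (fun n => `|mean| * b n)) => //.
    move=> n; have uNn : 0 <= u n - (N n)%:R by rewrite subr_ge0.
    rewrite -mulrBl !normrM (ger0_norm (b0 n)) distrC (ger0_norm uNn).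
    by rewrite ler_piMl ?mulr_ge0// lerBlDl.
  by rewrite -(mulr0 `|mean|); exact: cvgMr.
have cvsd : Num.sqrt (N n)%:R * (sd * b n) @[n --> \oo] --> B.
  (* The square roots of u and of its integer part N differ by at most 1, since u <= N + 1 <= (sqrt
     N + 1)^2; the factor b tends to 0. *)
  apply: (@squeeze_cvgr _ _ _ _ (fun n => Num.sqrt (u n) * (sd * b n) - sd * b n)
    (fun n => Num.sqrt (u n) * (sd * b n))) => //.
  - apply: nearW => n; have sb : 0 <= sd * b n by rewrite mulr_ge0.
    apply/andP; split; last by rewrite ler_wpM2r// ler_sqrt.
    rewrite -[X in _ - X]mul1r -mulrBl ler_wpM2r// lerBlDr.
    rewrite -(@ler_pXn2r _ 2)// ?nnegrE ?addr_ge0 ?sqrtr_ge0//.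
    rewrite sqr_sqrtr// sqrrD !sqr_sqrtr// expr1n mulr1.
    by rewrite (le_trans (uN n))// lerD2r lerDl mulrn_wge0// sqrtr_ge0.
  - rewrite -[B]subr0; apply: cvgB => //; rewrite -(mulr0 sd); exact: cvgMr.
have cvG := gauss_smoothing_limit (x := 0) cvmean cvsd.
pose K := \int[P]_w (`|S 1 w| ^+ 3) + \int[gauss]_z (`|mean + sd * (z : R)| ^+ 3).
pose V := `|\int[P]_w (S 1 w ^+ 2) - mean ^+ 2 - sd ^+ 2|.
have K0 : 0 <= K by rewrite addr_ge0//; apply: Rintegral_ge0 => w _; rewrite exprn_ge0.
have [e e0 Ie] := mgf_integrable S_mgf.
have [S0 _ _ _] := S_levy.
have main n : `|\int[P]_w f (S (u n) w * b n) -
    gauss_smoothing f ((N n)%:R * (mean * b n)) (Num.sqrt (N n)%:R * (sd * b n)) 0| <=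
    \int[P]_w g (b n) (S (u n - (N n)%:R) w) +
    (M * (u n * (V * b n ^+ 2)) + M * K * (u n * b n ^+ 3)).
  apply: le_trans (ler_distD (\int[P]_w f (S (N n)%:R w * b n)) _ _) _.
  apply: lerD; first exact: levy_increment_error.
  have := @lindeberg R d T P f M (S 1) (fun i => S i%:R) (b n)^-1 mean sd tf _ _ _ sd0 _ _ erefl
    S0 (levy_step S_levy) (N n) 0.
  rewrite /lindeberg_error invrK -/V -/K.
  under eq_Rintegral do rewrite add0r.
  move=> h; apply: le_trans (h _ _ _ _ _) _ => //.
  - by rewrite invr_gt0.
  - by move=> i; exact: integrable_pow Ie _.
  - exact: integrable_abs_pow Ie _.
  rewrite !exprVn !invrK mulrDr; apply: lerD.
    rewrite [leLHS](_ : _ = M * ((N n)%:R * (V * b n ^+ 2))); last by ring.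
    by rewrite ler_wpM2l// ler_wpM2r//; apply: mulr_ge0; [exact: normr_ge0|exact: exprn_ge0].
  rewrite [leLHS](_ : _ = M * K * ((N n)%:R * b n ^+ 3)); last by ring.
  by rewrite ler_wpM2l ?mulr_ge0// ler_wpM2r// exprn_ge0.
apply: (cvg_dist_squeeze main _ _).
  rewrite -[0]addr0; apply: cvgD.
    apply: levy_increment_vanish => // n; rewrite subr_ge0 Nu/= lerBlDl; exact: uN.
  rewrite -[0](addr0 0); apply: cvgD.
    by rewrite -(mulr0 M); exact: cvgMr.
  by rewrite -(mulr0 (M * K)); exact: cvgMr.
move: cvG; rewrite /gauss_smoothing.
by under [X in _ --> X -> _]eq_Rintegral do rewrite add0r.
Qed.

End levy_limit.

(** * Weak convergence from test functions *)

Section smooth_step.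
Variable R : realType.
Implicit Types (f g : R -> R) (x y : R).

(** Compared with [test_function], the range condition is dropped and the first-order coefficient is
    bounded, which makes the class stable under differences and affine changes of variable, as
    building splines requires. *)
Definition smooth_function f (M : R) : Prop := exists alpha beta : R -> R,
  [/\ forall x y, `|f (x + y) - f x - alpha x * y - beta x * y ^+ 2| <= M * `|y| ^+ 3,
      forall x, `|alpha x| <= M & forall x, `|beta x| <= M].

Lemma smooth_test_function f M : smooth_function f M -> (forall x, 0 <= f x <= 1) ->
  exists M', test_function f M'.
Proof.
move=> [alpha [beta [taylor alphaM betaM]]] f01.
have M0 : 0 <= M by exact: le_trans (alphaM 0).
(* For increments |z| <= 1 the remainder and the two Taylor terms are each at most M |z|; for longer
   ones [f] varies by at most 1 <= |z|. *)
exists (3 * M + 1); split => //.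
  move=> x y; pose z := y - x.
  have -> : y = x + z by rewrite /z addrC subrK.
  rewrite [`|x - _|](_ : _ = `|z|); last by rewrite opprD addrA subrr add0r normrN.
  rewrite distrC; have [z1|/ltW z1] := leP `|z| 1; last first.
    apply: (@le_trans _ _ 1).
      have /andP[h1 h2] := f01 x; have /andP[h3 h4] := f01 (x + z).
      by rewrite ler_norml; lra.
    by rewrite (le_trans z1)// ler_peMl// lerDr mulr_ge0.
  have -> : f (x + z) - f x = (f (x + z) - f x - alpha x * z - beta x * z ^+ 2) +
      (alpha x * z + beta x * z ^+ 2) by ring.
  apply: le_trans (ler_normD _ _) _.
  have z0 : 0 <= `|z| by [].
  have z2 : `|z| ^+ 2 <= `|z| by rewrite expr2 ler_piMl.
  have z3 : `|z| ^+ 3 <= `|z| by rewrite exprS (le_trans (ler_wpM2l z0 z2))// -expr2.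
  have h1 : `|alpha x * z| <= M * `|z| by rewrite normrM ler_wpM2r.
  have h2 : `|beta x * z ^+ 2| <= M * `|z|.
    by rewrite normrM normrX; apply: ler_pM => //; rewrite exprn_ge0.
  have h3 := le_trans (taylor x z) (ler_wpM2l M0 z3).
  have := lerD h3 (le_trans (ler_normD _ _) (lerD h1 h2)).
  by move/le_trans; apply; rewrite mulrDl mul1r; lra.
exists alpha, beta; split => [x y|x].
  by apply: le_trans (taylor x y) _; rewrite ler_wpM2r ?exprn_ge0//; lra.
by apply: le_trans (betaM x) _; lra.
Qed.

Lemma smooth_function_sub f g M N : smooth_function f M -> smooth_function g N ->
  smooth_function (fun x => f x - g x) (M + N).
Proof.
move=> [a1 [b1 [t1 A1 B1]]] [a2 [b2 [t2 A2 B2]]].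
exists (fun x => a1 x - a2 x), (fun x => b1 x - b2 x); split => [x y|x|x].
- rewrite [leRHS]mulrDl; apply: le_trans (lerD (t1 x y) (t2 x y)).
  apply: le_trans (ler_normB _ _); rewrite le_eqVlt; apply/orP; left; apply/eqP; congr `|_|; ring.
- exact: le_trans (ler_normB _ _) (lerD (A1 x) (A2 x)).
- exact: le_trans (ler_normB _ _) (lerD (B1 x) (B2 x)).
Qed.

Lemma smooth_function_affine f M (a b : R) : smooth_function f M ->
  smooth_function (fun x => f (a * x + b)) (M * (1 + `|a| ^+ 3)).
Proof.
move=> [al [be [t A B]]]; have M0 : 0 <= M by exact: le_trans (A 0).
have a0 : 0 <= `|a| by [].
have a3 : 0 <= `|a| ^+ 3 by rewrite exprn_ge0.
exists (fun x => al (a * x + b) * a), (fun x => be (a * x + b) * a ^+ 2); split => [x y|x|x].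
- rewrite (_ : a * (x + y) + b = a * x + b + a * y); last by ring.
  have := t (a * x + b) (a * y).
  rewrite [(a * y) ^+ 2]exprMn normrM [(_ * _) ^+ 3]exprMn 3!mulrA => /le_trans; apply.
  by rewrite mulrA ler_wpM2r ?exprn_ge0// ler_wpM2l//; lra.
- by rewrite normrM; apply: ler_pM => //; nra.
- by rewrite normrM normrX; apply: ler_pM => //; nra.
Qed.

Definition pospart x : R := Num.max x 0.

(** The second derivative 6 x_+ of the truncated cube is 6-Lipschitz, whence a remainder of at most
    |y|^3; it is checked directly on the signs of x and x + y. *)
Lemma pospart_cube_taylor x y :
  `|pospart (x + y) ^+ 3 - pospart x ^+ 3 - 3 * pospart x ^+ 2 * y - 3 * pospart x * y ^+ 2| <= `|y| ^+ 3.
Proof.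
rewrite /pospart -normrX; case: (leP x 0) => x0; case: (leP (x + y) 0) => xy0.
- by rewrite (_ : _ - _ = 0) ?normr0//; ring.
- rewrite (_ : _ - _ = (x + y) ^+ 3); last by ring.
  rewrite !ger0_norm ?exprn_ge0//; [|lra|lra].
  by rewrite lerXn2r// ?nnegrE; lra.
- rewrite (_ : _ - _ = y ^+ 3 - (x + y) ^+ 3); last by ring.
  have h : (- (x + y)) ^+ 3 <= (- y) ^+ 3 by rewrite lerXn2r// ?nnegrE; lra.
  have h0 : 0 <= (- (x + y)) ^+ 3 by rewrite exprn_ge0//; lra.
  have -> : y ^+ 3 = - (- y) ^+ 3 by ring.
  have -> : (x + y) ^+ 3 = - (- (x + y)) ^+ 3 by ring.
  by rewrite [leRHS]normrN (ger0_norm (le_trans h0 h)) ler_norml; lra.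
- by rewrite (_ : _ - _ = y ^+ 3)//; ring.
Qed.

(* The integral of the quadratic B-spline: 0 on the left of 0, 1 on the right of
   3, with Lipschitz second derivative. *)
Definition smooth_step x : R :=
  (pospart x ^+ 3 - 3 * pospart (x - 1) ^+ 3 + 3 * pospart (x - 2) ^+ 3 - pospart (x - 3) ^+ 3) / 6.

(** [al] is the first derivative and [be] half the second one. The four remainders add up to (1 + 3
    + 3 + 1) / 6, below the common bound 3. *)
Lemma smooth_stepP : smooth_function smooth_step 3.
Proof.
pose al x := (pospart x ^+ 2 - 3 * pospart (x - 1) ^+ 2 + 3 * pospart (x - 2) ^+ 2 - pospart (x - 3) ^+ 2) / 2.
pose be x := (pospart x - 3 * pospart (x - 1) + 3 * pospart (x - 2) - pospart (x - 3)) / 2.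
exists al, be; split => [x y|x|x].
- have := pospart_cube_taylor x y; have := pospart_cube_taylor (x - 1) y.
  have := pospart_cube_taylor (x - 2) y; have := pospart_cube_taylor (x - 3) y.
  rewrite !ler_norml /smooth_step /al /be.
  rewrite !(addrAC x y).
  have : 0 <= `|y| ^+ 3 by rewrite exprn_ge0.
  set Y := `|y| ^+ 3; lra.
- rewrite /al /pospart ler_norml.
  case: (leP x 0) => ?; case: (leP (x - 1) 0) => ?; case: (leP (x - 2) 0) => ?;
    case: (leP (x - 3) 0) => ?; nra.
- rewrite /be /pospart ler_norml.
  case: (leP x 0) => ?; case: (leP (x - 1) 0) => ?; case: (leP (x - 2) 0) => ?;
    case: (leP (x - 3) 0) => ?; lra.
Qed.

Lemma smooth_step_le0 x : x <= 0 -> smooth_step x = 0.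
Proof.
move=> x0; rewrite /smooth_step /pospart !(max_idPr _); [|lra|lra|lra|lra].
by rewrite expr0n/=; ring.
Qed.

Lemma smooth_step_ge3 x : 3 <= x -> smooth_step x = 1.
Proof.
move=> x0; rewrite /smooth_step /pospart !(max_idPl _); [|lra|lra|lra|lra].
by field.
Qed.

(** The difference is the cubic B-spline supported on [0, 4], nonnegative on each of its four
    pieces. The polynomial in [B] serves both middle pieces, exchanged by x -> 4 - x. *)
Lemma smooth_step_increment x : smooth_step (x - 1) <= smooth_step x.
Proof.
rewrite -subr_ge0.
have [x0|x0] := leP x 0; first by rewrite !smooth_step_le0 ?subrr//; lra.
have [x4|x4] := leP 4 x; first by rewrite !smooth_step_ge3 ?subrr//; lra.
have -> : smooth_step x - smooth_step (x - 1) =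
    (pospart x ^+ 3 - 4 * pospart (x - 1) ^+ 3 + 6 * pospart (x - 2) ^+ 3 - 4 * pospart (x - 3) ^+ 3) / 6.
  have e2 : x - 1 - 1 = x - 2 by ring.
  have e3 : x - 1 - 2 = x - 3 by ring.
  have e4 : pospart (x - 1 - 3) = 0 by apply/max_idPr; lra.
  by rewrite /smooth_step e2 e3 e4; field.
apply: divr_ge0 => //; rewrite /pospart (max_l (ltW x0)).
have B (u : R) : 0 <= u <= 1 -> 0 <= 1 + 3 * u + 3 * u ^+ 2 - 3 * u ^+ 3.
  move=> /andP[u0 u1]; have u2 : 0 <= u ^+ 2 by exact: exprn_ge0.
  have u3 : u ^+ 3 <= u ^+ 2 by rewrite exprS ler_piMl.
  by lra.
have [x1|/ltW x1] := leP x 1.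
  rewrite !max_r; [|lra|lra|lra].
  by rewrite (_ : _ - _ = x ^+ 3); [rewrite exprn_ge0// ltW|ring].
have p1 : 0 <= x - 1 by lra.
have [x2|/ltW x2] := leP x 2.
  rewrite (max_l p1) !max_r; [|lra|lra].
  rewrite (_ : _ - _ = 1 + 3 * (x - 1) + 3 * (x - 1) ^+ 2 - 3 * (x - 1) ^+ 3); last by ring.
  by apply: B; lra.
have p2 : 0 <= x - 2 by lra.
have [x3|/ltW x3] := leP x 3.
  rewrite (max_l p1) (max_l p2) max_r; last lra.
  rewrite (_ : _ - _ = 1 + 3 * (3 - x) + 3 * (3 - x) ^+ 2 - 3 * (3 - x) ^+ 3); last by ring.
  by apply: B; lra.
have p3 : 0 <= x - 3 by lra.
rewrite (max_l p1) (max_l p2) (max_l p3).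
rewrite (_ : _ - _ = (4 - x) ^+ 3); last by ring.
by rewrite exprn_ge0// subr_ge0 ltW.
Qed.

(** For x in [0, 3], shifting by 3 to either side reaches the constant parts 0 and 1, and unit
    shifts are monotone. *)
Lemma smooth_step01 x : 0 <= smooth_step x <= 1.
Proof.
have [x0|/ltW x0] := leP x 0; first by rewrite smooth_step_le0// lexx ler01.
have [x3|/ltW x3] := leP 3 x; first by rewrite smooth_step_ge3// ler01 lexx.
have down y : smooth_step (y - 3) <= smooth_step y.
  rewrite (_ : y - 3 = y - 1 - 1 - 1); last by ring.
  do 2 (apply: le_trans (smooth_step_increment _) _); exact: smooth_step_increment.
have h1 := down x; have := down (x + 3); rewrite addrK.
by rewrite (@smooth_step_ge3 (x + 3)) ?(smooth_step_le0 (x := x - 3)) in h1 *; lra.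
Qed.

End smooth_step.

(** * Approximation by sums of products of splines *)

Section product_approximation.
Variables (R : realType) (h : nat).
Implicit Types (f : 'rV[R]_h -> R) (x y : 'rV[R]_h).

(** Heine-Cantor on a box, in which [y] may leave the box, as the nodes of the sampling grid can. *)
Lemma box_uniform_continuity f (A e : R) : continuous f -> 0 < e ->
  exists2 delta : R, 0 < delta & forall x y, (forall i, `|x ord0 i| <= A) ->
    (forall i, `|x ord0 i - y ord0 i| <= delta) -> `|f x - f y| <= e.
Proof.
move=> cf e0.
pose K := [set x : 'rV[R]_h | forall i, [set` `[- A, A]%R] (x ord0 i)].
have cK : compact K by exact: (@rV_compact R h (fun=> [set` `[- A, A]%R]) (fun=> @segment_compact R (- A) A)).
pose good (delta : R) x := forall y, (forall i, `|x ord0 i - y ord0 i| <= delta) ->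
  `|f x - f y| <= e.
have cov : \forall delta \near (0 : R)^'+, K `<=` good delta.
  move/compact_near_coveringP: cK; apply => x _.
  have e2 : 0 < e / 2 by rewrite divr_gt0.
  have /cvgrPdist_le/(_ _ e2)/nbhs_ballP[r /= r0 hr] := cf x.
  have r2 : 0 < r / 2 by rewrite divr_gt0.
  exists (ball x (r / 2), [set delta : R | delta < r / 2]) => /=.
    by split; [exact: nbhsx_ballx|exact: nbhs_right_lt].
  move=> [x' delta] /= [xx' dr] y x'y.
  have fx' : `|f x - f x'| <= e / 2.
    by apply: hr; apply: le_ball xx'; lra.
  have fy : `|f x - f y| <= e / 2.
    apply: hr; move: xx' => [_ xx'].
    split=> // i j; rewrite (ord1 i) /ball/=.
    rewrite (splitr r); apply: le_lt_trans (ler_distD (x' ord0 j) _ _) _.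
    apply: ltrD; first exact: xx'.
    exact: le_lt_trans (x'y j) dr.
  apply: le_trans (ler_distD (f x) _ _) _; rewrite (splitr e) distrC.
  exact: lerD.
have [delta [delta0 hd]] := filter_ex (filterI (nbhs_right_gt (0 : R)) cov).
exists delta => // x y xA; apply: hd => i /=.
by rewrite in_itv/= -ler_norml; exact: xA.
Qed.


(** In the variable a x + b this is a plateau of height 1 on [3, n], vanishing off [0, n + 3]; for n
    = 1 it is a cubic B-spline. Telescoping makes [n] consecutive B-splines add up to the
    plateau. *)
Definition bump (a b : R) (n : nat) (x : R) : R :=
  smooth_step (a * x + b) - smooth_step (a * x + b - n%:R).

Lemma smooth_step_subn (x : R) n : smooth_step (x - n%:R) <= smooth_step x.
Proof.
elim: n => [|n IHn]; first by rewrite subr0.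
apply: le_trans IHn; rewrite -natr1 opprD addrA; exact: smooth_step_increment.
Qed.

Lemma bump01 (a b : R) n (x : R) : 0 <= bump a b n x <= 1.
Proof.
have := smooth_step_subn (a * x + b) n.
have /andP[h1 h2] := smooth_step01 (a * x + b).
by have /andP[h3 h4] := smooth_step01 (a * x + b - n%:R); rewrite /bump; lra.
Qed.

Lemma bump_test a b n : exists M, test_function (bump a b n) M.
Proof.
have h1 := smooth_function_affine a b (smooth_stepP R).
have h2 := smooth_function_affine a (b - n%:R) (smooth_stepP R).
apply: (smooth_test_function (M := 3 * (1 + `|a| ^+ 3) + 3 * (1 + `|a| ^+ 3))).
  have := smooth_function_sub h1 h2.
  by under eq_fun do rewrite [_ + (b - _)]addrA.
exact: bump01.
Qed.

Lemma bump_eq0 (a b : R) n (x : R) : a * x + b <= 0 -> bump a b n x = 0.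
Proof.
move=> ab; rewrite /bump !smooth_step_le0 ?subrr//.
by rewrite (le_trans _ ab)// lerBlDr lerDl.
Qed.

Lemma bump_eq0r (a b : R) n (x : R) : 3 + n%:R <= a * x + b -> bump a b n x = 0.
Proof.
move=> ab; rewrite /bump !smooth_step_ge3 ?subrr//; first by rewrite lerBrDr.
by rewrite (le_trans _ ab)// lerDl.
Qed.

Lemma bump_eq1 (a b : R) n (x : R) : 3 <= a * x + b -> a * x + b <= n%:R -> bump a b n x = 1.
Proof.
by move=> h1 h2; rewrite /bump smooth_step_ge3// smooth_step_le0 ?subr0// subr_le0.
Qed.

Lemma sum_bump (a b : R) n (x : R) : \sum_(j < n) bump a (b - j%:R) 1 x = bump a b n x.
Proof.
rewrite /bump -[X in _ = smooth_step X - _]subr0 -[0]/(0%:R).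
rewrite -(big_mkord xpredT (fun j => smooth_step (a * x + (b - j%:R)) -
  smooth_step (a * x + (b - j%:R) - 1%:R))).
rewrite -[RHS]opprK opprB -(telescope_sumr (fun j => smooth_step (a * x + b - j%:R)))//.
rewrite -sumrN; apply: eq_bigr => j _; rewrite opprB; congr (_ - _); congr smooth_step.
  by rewrite addrA.
by rewrite -[j.+1]addn1 natrD; ring.
Qed.

(* The bumps form a partition of unity, so that [f] is sampled on a grid. *)
Lemma product_approximation f (M A e : R) : continuous f ->
  (forall x, `|f x| <= M) -> 0 < e ->
  exists (Q : finType) (c : Q -> R) (psi : Q -> 'I_h -> R -> R),
    [/\ forall q i, exists M', test_function (psi q i) M',
        forall x, `|\sum_q c q * \prod_i psi q i (x ord0 i)| <= M &
        forall x, (forall i, `|x ord0 i| <= A) ->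
          `|f x - \sum_q c q * \prod_i psi q i (x ord0 i)| <= e].
Proof.
move=> cf fM e0; have [delta delta0 hdelta] := box_uniform_continuity A cf e0.
(* A B-spline has support of length 4 in the variable a x + b, hence of length delta in x. The node
   [p q] is the left end of the support, and [N] is large enough to put the whole box on the plateau
   of the sum. *)
pose a := 4 / delta; have a0 : 0 < a by rewrite divr_gt0.
pose N := (Num.truncn (a * `|A| + 3)).+1.
have AN : a * `|A| + 3 <= N%:R.
  have A0 : 0 <= a * `|A| + 3 by rewrite addr_ge0// mulr_ge0// ltW.
  by have /andP[_ /ltW] := truncn_itv A0.
pose K := (N + N)%N.
pose psi (q : {ffun 'I_h -> 'I_K}) i := bump a (N%:R - (q i)%:R) 1.
pose p (q : {ffun 'I_h -> 'I_K}) : 'rV[R]_h := \row_i (((q i)%:R - N%:R) / a).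
have sum_psi x : \sum_q \prod_i psi q i (x ord0 i) = \prod_i bump a N%:R K (x ord0 i).
  under [RHS]eq_bigr do rewrite -sum_bump.
  by rewrite bigA_distr_bigA.
have psi0 q x : 0 <= \prod_i psi q i (x ord0 i).
  by apply: prodr_ge0 => i _; have /andP[] := bump01 a (N%:R - (q i)%:R) 1 (x ord0 i).
exists {ffun 'I_h -> 'I_K}, (fun q => f (p q)), psi; split.
- by move=> q i; exact: bump_test.
- move=> x; apply: (@le_trans _ _ (\sum_q M * \prod_i psi q i (x ord0 i))).
    apply: le_trans (ler_norm_sum _ _ _) _; apply: ler_sum => q _.
    by rewrite normrM (ger0_norm (psi0 _ _)) ler_wpM2r.
  have M0 : 0 <= M by exact: le_trans (fM 0).
  rewrite -mulr_sumr sum_psi ler_piMr//.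
  by apply: prodr_ile1 => i _; exact: bump01.
- move=> x xA.
  have w1 i : bump a N%:R K (x ord0 i) = 1.
    have xi : `|a * x ord0 i| <= a * `|A|.
      by rewrite normrM (gtr0_norm a0) ler_wpM2l ?(ltW a0)// (le_trans (xA i))// ler_norm.
    move: xi; rewrite ler_norml => /andP[h1 h2].
    by apply: bump_eq1; rewrite ?natrD; lra.
  have fE : f x = \sum_q f x * \prod_i psi q i (x ord0 i).
    by rewrite -mulr_sumr sum_psi big1 ?mulr1.
  rewrite {1}fE -sumrB.
  apply: (@le_trans _ _ (\sum_q e * \prod_i psi q i (x ord0 i))); last first.
    by rewrite -mulr_sumr sum_psi big1 ?mulr1.
  apply: le_trans (ler_norm_sum _ _ _) _; apply: ler_sum => q _.
  rewrite -mulrBl normrM (ger0_norm (psi0 _ _)).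
  (* Either the node is close to [x], or some coordinate of [x] is off the support of its bump and
     the term vanishes. *)
  have [near|/existsNP[i far]] := pselect (forall i, `|x ord0 i - p q ord0 i| <= delta).
    by rewrite ler_wpM2r//; exact: hdelta.
  rewrite (bigD1 i)//= (_ : psi q i _ = 0) ?mul0r ?mulr0//.
  move/negP: far; rewrite mxE.
  set y := x ord0 i; rewrite /psi => far.
  have yE : a * y + (N%:R - (q i)%:R) = a * (y - ((q i)%:R - N%:R) / a).
    by rewrite mulrBr [a * (_ / a)]mulrC divfK ?gt_eqF//; ring.
  have ad : a * delta = 4 by rewrite /a divfK ?gt_eqF.
  have [le0|gt0] := leP (y - ((q i)%:R - N%:R) / a) 0.
    by apply: bump_eq0; rewrite yE mulr_ge0_le0// ltW.
  apply: bump_eq0r; rewrite yE (_ : _ + _ = a * delta); last by rewrite ad; ring.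
  move: far; rewrite -ltNge (gtr0_norm gt0) => far.
  by rewrite ler_wpM2l ?(ltW a0)// ltW.
Qed.

End product_approximation.

Section weak_convergence.
Variables (R : realType) (h : nat).
Implicit Types (f : 'rV[R]_h -> R) (x y : 'rV[R]_h).

Lemma nbhs_infty_box x (b : R) : \forall n \near \oo, forall i, `|x ord0 i| + b <= n%:R.
Proof.
have := nbhs_infty_ger (\sum_i `|x ord0 i| + b); apply: filterS => n h0 i.
by apply: le_trans h0; rewrite lerD2r (bigD1 i)//= lerDl sumr_ge0.
Qed.

Section random_vector.
Context d (T : measurableType d) (P : probability T R).
Variable X : T -> 'rV[R]_h.
Hypothesis mX : forall i, measurable_fun setT (fun w => X w ord0 i).

Lemma measurable_test_product (g : 'I_h -> R -> R) :
  (forall i, exists M, test_function (g i) M) ->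
  measurable_fun setT (fun w => \prod_i g i (X w ord0 i)).
Proof.
move=> tg; apply: measurable_prodr => i; have [M tM] := tg i.
by apply: measurableT_comp => //; exact: test_function_measurable tM.
Qed.

(** Only the coordinates of [X] are known to be measurable; [f] is a pointwise limit of sums of
    products of functions of single coordinates. *)
Lemma measurable_continuous_row f (M : R) : continuous f -> (forall x, `|f x| <= M) ->
  measurable_fun setT (f \o X).
Proof.
move=> cf fM.
have approx (n : nat) : exists F : 'rV[R]_h -> R, measurable_fun setT (F \o X) /\
    forall x, (forall i, `|x ord0 i| <= n%:R) -> `|f x - F x| <= n.+1%:R^-1.
  have n0 : 0 < (n.+1%:R : R)^-1 by rewrite invr_gt0.
  have [Q [c [psi [tpsi _ fF]]]] := product_approximation n%:R cf fM n0.
  exists (fun x => \sum_q c q * \prod_i psi q i (x ord0 i)); split => //.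
  apply: measurable_sum => q; apply: measurable_funM => //.
  exact: measurable_test_product.
have [F hF] := choice approx.
apply: (@measurable_fun_cvg _ _ _ _ (fun n => F n \o X)) => [n|w _]; first by have [] := hF n.
apply/cvgrPdist_le => e e0; near=> n.
have [_ Fn] := hF n; apply: (@le_trans _ _ (n.+1%:R^-1)).
  apply: Fn => i; rewrite -[leLHS]addr0; move: i; near: n; exact: nbhs_infty_box.
by near: n; have := near_infty_natSinv_lt (PosNum e0); apply: filterS => n /ltW.
Unshelve. all: by end_near. Qed.

(** A smooth substitute for the indicator of a box, 1 where all coordinates are at most n - 3 in
    absolute value. Being a product of test functions, its expectation is covered by the assumed
    convergence. *)
Definition box_weight (n : nat) x : R := \prod_i bump 1 n%:R (n + n) (x ord0 i).

Lemma box_weight01 n x : 0 <= box_weight n x <= 1.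
Proof.
rewrite prodr_ge0/= ?prodr_ile1// => i _; first exact: bump01.
by have /andP[] := bump01 1 n%:R (n + n) (x ord0 i).
Qed.

Lemma box_weight_eq0 n x : ~ (forall i, `|x ord0 i| <= n%:R + 3) -> box_weight n x = 0.
Proof.
move=> /existsNP[i /negP]; rewrite -ltNge => far.
rewrite /box_weight (bigD1 i)//= (_ : bump _ _ _ _ = 0) ?mul0r//.
have [x0|x0] := leP 0 (x ord0 i).
  move: far; rewrite ger0_norm// => far.
  by apply: bump_eq0r; rewrite natrD; lra.
move: far; rewrite ltr0_norm// => far.
by apply: bump_eq0; lra.
Qed.

Lemma measurable_box_weight n : measurable_fun setT (box_weight n \o X).
Proof. exact: (measurable_test_product (fun i => bump_test 1 n%:R (n + n))). Qed.

Lemma cvg_box_weight : \int[P]_w box_weight n (X w) @[n --> \oo] --> (1 : R).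
Proof.
rewrite -[X in _ --> X](Rintegral_cstT P).
apply: (@bounded_convergence _ _ _ _ _ _ 1) => //.
- exact: measurable_box_weight.
- by move=> n w; have /andP[h0 h1] := box_weight01 n (X w); rewrite ger0_norm.
apply: aeW => w; apply: cvg_near_cst.
have := nbhs_infty_box (X w) 3; apply: filterS => n nbox.
rewrite /box_weight big1// => i _; have := nbox i => {}nbox.
have : `|X w ord0 i| <= n%:R - 3 by lra.
rewrite ler_norml => /andP[h1 h2].
by apply: bump_eq1; rewrite ?natrD; lra.
Qed.

Lemma approximation_error f (F : 'rV[R]_h -> R) (M e : R) n :
  0 <= M -> 0 <= e -> measurable_fun setT (f \o X) -> measurable_fun setT (F \o X) ->
  (forall x, `|f x| <= M) -> (forall x, `|F x| <= M) ->
  (forall x, (forall i, `|x ord0 i| <= n%:R + 3) -> `|f x - F x| <= e) ->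
  `|\int[P]_w f (X w) - \int[P]_w F (X w)| <=
    e + 2 * M * (1 - \int[P]_w box_weight n (X w)).
Proof.
move=> M0 e0 mf mF fM FM fF.
have If : P.-integrable setT (EFin \o (f \o X)).
  exact: (@integrable_bounded _ _ _ _ (f \o X) M mf (fun w => fM (X w))).
have IF : P.-integrable setT (EFin \o (F \o X)).
  exact: (@integrable_bounded _ _ _ _ (F \o X) M mF (fun w => FM (X w))).
have IW : P.-integrable setT (EFin \o (box_weight n \o X)).
  by apply: integrable_fun01 => [|w]; [exact: measurable_box_weight|exact: box_weight01].
have IC := integrable_cstT P (e + 2 * M).
rewrite -(RintegralB measurableT If IF).
apply: le_trans (le_normr_Rintegral measurableT (integrable_sub If IF)) _.
have -> : e + 2 * M * (1 - \int[P]_w box_weight n (X w)) =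
    \int[P]_w (e + 2 * M - 2 * M * box_weight n (X w)).
  rewrite (RintegralB measurableT IC (integrable_scale (2 * M) IW)).
  by rewrite Rintegral_cstT RintegralZl//; ring.
apply: le_Rintegral => //.
- exact: (integrable_abse (integrable_sub If IF)).
- exact: (integrable_sub IC (integrable_scale (2 * M) IW)).
move=> w _ /=; have /andP[h0 h1] := box_weight01 n (X w).
have [box|out] := pselect (forall i, `|X w ord0 i| <= n%:R + 3).
  by apply: le_trans (fF _ box) _; nra.
rewrite box_weight_eq0// mulr0 subr0.
apply: le_trans (ler_normB _ _) _.
by have := fM (X w); have := FM (X w); lra.
Qed.

End random_vector.

Section portmanteau.
Context d (T : measurableType d) (P : probability T R).
Context d' (T' : measurableType d') (P' : probability T' R).
Variables (V : R -> 'I_h -> {RV P >-> R}) (Y : T' -> 'rV[R]_h).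
Hypothesis mY : forall i, measurable_fun setT (fun w => Y w ord0 i).
Hypothesis cvg_test : forall g : 'I_h -> R -> R,
  (forall i, exists M, test_function (g i) M) ->
  \int[P]_w \prod_i g i (V t i w) @[t --> +oo] --> \int[P']_w \prod_i g i (Y w ord0 i).

Let X t w : 'rV[R]_h := \row_i V t i w.

Let mX t i : measurable_fun setT (fun w => X t w ord0 i).
Proof.
rewrite (_ : (fun w => _) = V t i)//.
by apply/funext => w; rewrite mxE.
Qed.

Let cvg_testX g : (forall i, exists M, test_function (g i) M) ->
  \int[P]_w \prod_i g i (X t w ord0 i) @[t --> +oo] --> \int[P']_w \prod_i g i (Y w ord0 i).
Proof.
move=> /cvg_test; rewrite (_ : (fun t => _) = fun t => \int[P]_w \prod_i g i (X t w ord0 i))//.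
apply/funext => t; apply: eq_Rintegral => w _; apply: eq_bigr => i _.
by rewrite mxE.
Qed.

Lemma cvg_expectation_product_sum (Q : finType) (c : Q -> R) (psi : Q -> 'I_h -> R -> R) :
  (forall q i, exists M, test_function (psi q i) M) ->
  \int[P]_w (\sum_q c q * \prod_i psi q i (X t w ord0 i)) @[t --> +oo] -->
  \int[P']_w (\sum_q c q * \prod_i psi q i (Y w ord0 i)).
Proof.
move=> tpsi.
have psi01 q i u : 0 <= psi q i u <= 1 by have [M [h0 _ _]] := tpsi q i.
have prod01 q (u : 'rV[R]_h) : 0 <= \prod_i psi q i (u ord0 i) <= 1.
  by rewrite prodr_ge0/= ?prodr_ile1// => i _; have /andP[] := psi01 q i (u ord0 i).
have E dO (O : measurableType dO) (Pr : probability O R) (Z : O -> 'rV[R]_h) :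
    (forall i, measurable_fun setT (fun w => Z w ord0 i)) ->
    \int[Pr]_w (\sum_q c q * \prod_i psi q i (Z w ord0 i)) =
    \sum_q c q * \int[Pr]_w \prod_i psi q i (Z w ord0 i).
  move=> mZ.
  have I q : Pr.-integrable setT (EFin \o (fun w => \prod_i psi q i (Z w ord0 i))).
    by apply: integrable_fun01 => //; exact: measurable_test_product.
  rewrite Rintegral_sum => [|q]; last exact: integrable_scale.
  by apply: eq_bigr => q _; rewrite RintegralZl.
rewrite E//; rewrite [fun t => _](_ : _ = fun t =>
  \sum_q c q * \int[P]_w \prod_i psi q i (X t w ord0 i)); last first.
  by apply/funext => t; exact: E (mX t).
apply: cvg_big => [|q _]; first exact: add_continuous.
by apply: cvgMr; exact: cvg_testX.
Qed.

(** Convergence on products already contains tightness: the box is chosen for the limit [Y], and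
    convergence of the mean of [box_weight] controls the mass of [X t] outside it for all large
    t. *)
Lemma portmanteau f (M : R) : continuous f -> (forall x, `|f x| <= M) ->
  \int[P]_w f (\row_i V t i w) @[t --> +oo] --> \int[P']_w f (Y w).
Proof.
move=> cf fM; have M0 : 0 <= M by exact: le_trans (fM 0).
(* The budget is 2 e for approximating under [Y], e for the convergence of the approximant, and 3 e
   for approximating under [X t], whose outside mass term is at most 2 e. *)
apply/cvgrPdist_le => eta eta0; pose e := eta / 6.
have e0 : 0 < e by rewrite divr_gt0.
have weight0 : 2 * M * (1 - \int[P']_w box_weight n (Y w)) @[n --> \oo] --> 0.
  rewrite [X in _ --> X](_ : _ = 2 * M * (1 - 1)); last by rewrite subrr mulr0.
  apply: cvgMr; apply: cvgB.
    exact: cvg_cst.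
  exact: cvg_box_weight.
have /cvgrPdist_le/(_ _ e0)/filter_ex[n] := weight0.
rewrite distrC subr0 => /(le_trans (ler_norm _)) hn.
have [Q [c [psi [tpsi FM fF]]]] := product_approximation (n%:R + 3) cf fM e0.
pose F (x : 'rV[R]_h) := \sum_q c q * \prod_i psi q i (x ord0 i).
have mF dO (O : measurableType dO) (Z : O -> 'rV[R]_h) :
    (forall i, measurable_fun setT (fun w => Z w ord0 i)) -> measurable_fun setT (F \o Z).
  move=> mZ; apply: measurable_sum => q; apply: measurable_funM => //.
  exact: measurable_test_product.
have cF := cvg_expectation_product_sum (c := c) tpsi.
have cW : 2 * M * (1 - \int[P]_w box_weight n (X t w)) @[t --> +oo] -->
    2 * M * (1 - \int[P']_w box_weight n (Y w)).
  apply: cvgMr; apply: cvgB; first exact: cvg_cst.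
  exact: (cvg_testX (fun i => bump_test 1 n%:R (n + n))).
move/cvgrPdist_le : cF => /(_ _ e0); move/cvgrPdist_le : cW => /(_ _ e0).
apply: filterS2 => t /= hW hF.
have {}hF : `|\int[P']_w F (Y w) - \int[P]_w F (X t w)| <= e by exact: hF.
have errY := approximation_error P' mY M0 (ltW e0) (measurable_continuous_row mY cf fM) (mF _ _ _ mY)
  fM FM fF.
have errX := approximation_error P (mX t) M0 (ltW e0) (measurable_continuous_row (mX t) cf fM)
  (mF _ _ _ (mX t)) fM FM fF.
have eE : eta = 6 * e by rewrite /e; field.
rewrite eE; move: hn hW hF errY errX; rewrite !ler_norml.
move: (e) (_ * (1 - \int[P']_w _)) (_ * (1 - \int[P]_w _)) => e' wY wX.
move: (\int[P']_w f (Y w)) (\int[P]_w f (X t w)) (\int[P']_w F (Y w)) (\int[P]_w F (X t w)).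
move=> fY fX FY FX a0 /andP[a1 a2] /andP[a3 a4] /andP[a5 a6] /andP[a7 a8].
lra.
Qed.

End portmanteau.

End weak_convergence.

(** * Averaging out the processes at random clocks *)

Section decoupling.
Variables (R : realType) (h k : nat) (c : 'I_h -> 'I_k -> R).
Hypotheses (k_gt0 : (0 < k)%N) (c_gt0 : forall i j, 0 < c i j).

Lemma mean_right_continuous d (T : measurableType d) (P : probability T R) (Y : R -> T -> R) :
  (forall s, 0 <= s -> measurable_fun setT (Y s)) ->
  (forall s w, 0 <= Y s w <= 1) ->
  {ae P, forall w s, 0 <= s -> Y x w @[x --> s^'+] --> Y s w} ->
  forall s, 0 <= s -> \int[P]_w Y x w @[x --> s^'+] --> \int[P]_w Y s w.
Proof.
move=> mY Y01 Yr s s0; apply/cvg_at_rightP => u [us cu].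
apply: (@bounded_convergence _ _ _ _ (fun n => Y (u n)) (Y s) 1).
- by move=> n; apply: mY; exact: le_trans (ltW (us n)).
- exact: mY.
- by move=> n w; have /andP[h0 h1] := Y01 (u n) w; rewrite ger0_norm.
- by apply: filterS Yr => w /(_ s s0)/cvg_at_rightP; apply.
Qed.

Section versions.
Context d (T : measurableType d) (P : probability T R).
Variable L : 'I_k -> T -> R.
Hypotheses (mL : forall j, measurable_fun setT (L j))
  (L_ge0 : forall j, {ae P, forall w, 0 <= L j w}).

Lemma ae_clock_cvg : {ae P, forall w i,
  clock (c i) (clock_bin (fun j => L j w) n) @[n --> \oo] --> (\sum_j c i j * L j w)^'+}.
Proof.
have L0 : {ae P, forall w, forall j, 0 <= L j w} by exact: filter_forall.
by apply: filterS L0 => w Lw i; exact: clock_cvg_right.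
Qed.

(** [Y] at a discretized clock is measurable, and by right continuity it converges almost surely to
    [Y] at the clock. *)
Lemma time_change_version (Y : R -> T -> R) i :
  (forall s, 0 <= s -> measurable_fun setT (Y s)) ->
  {ae P, forall w s, 0 <= s -> Y x w @[x --> s^'+] --> Y s w} ->
  exists2 V : T -> R, measurable_fun setT V &
    {ae P, forall w, V w = Y (\sum_j c i j * L j w) w}.
Proof.
move=> mY Yr; pose X n w := Y (clock (c i) (clock_bin (fun j => L j w) n)) w.
apply: (measurable_version_of_limit (X := X)).
  by move=> n; exact: measurable_time_change.
have L0 : {ae P, forall w, forall j, 0 <= L j w} by exact: filter_forall.
apply: filterS3 Yr ae_clock_cvg L0 => w Yr cc L0.
have tau0 : 0 <= \sum_j c i j * L j w.
  by apply: sumr_ge0 => j _; rewrite mulr_ge0// ltW.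
exact: (@cvg_comp _ _ _ _ (fun s => Y s w) _ _ _ (cc i) (Yr _ tau0)).
Qed.

Lemma time_change_product_version (y : 'I_h -> R -> R) :
  (forall i s, 0 <= y i s <= 1) ->
  (forall i s, 0 <= s -> y i x @[x --> s^'+] --> y i s) ->
  exists W : T -> R, [/\ measurable_fun setT W, forall w, 0 <= W w <= 1 &
    {ae P, forall w, W w = \prod_i y i (\sum_j c i j * L j w)}].
Proof.
move=> y01 yr.
have /choice[V hV] i : exists V : T -> R, measurable_fun setT V /\
    {ae P, forall w, V w = y i (\sum_j c i j * L j w)}.
  have [||V mV VE] := @time_change_version (fun s _ => y i s) i.
  - by move=> s _; exact: measurable_cst.
  - by apply: aeW => w s s0; exact: yr.
  by exists V.
(* The versions [V i] agree with the values of [y i] only almost everywhere; clamping restores the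
   bounds at every point. *)
exists (fun w => Num.min 1 (Num.max 0 (\prod_i V i w))); split.
- apply: measurable_minr => //; apply: measurable_maxr => //.
  by apply: measurable_prodr => i; have [] := hV i.
- by move=> w; rewrite le_min ler01 le_max lexx ge_min lexx.
have VE : {ae P, forall w, forall i, V i w = y i (\sum_j c i j * L j w)}.
  by apply: filter_forall => i; have [] := hV i.
apply: filterS VE => w VE.
have -> : \prod_i V i w = \prod_i y i (\sum_j c i j * L j w) by apply: eq_bigr.
rewrite max_r ?min_r//; last by apply: prodr_ge0 => i _; have /andP[] := y01 i (\sum_j c i j * L j w).
by apply: prodr_ile1 => i _.
Qed.

End versions.

(* Replaces the random [Y i] by their means, and the [L j] by variables with the
   same laws, possibly on another space. *)
Lemma decoupling d (T : measurableType d) (P : probability T R)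
    d' (T' : measurableType d') (P' : probability T' R)
    (Y : 'I_h -> R -> T -> R) (L : 'I_k -> T -> R) (L' : 'I_k -> T' -> R)
    (GY : 'I_h -> set (set T)) (GL : 'I_k -> set (set T))
    (GY' : 'I_h -> set (set T')) (GL' : 'I_k -> set (set T')) (W : T -> R) (W' : T' -> R) :
  mutually_independent P (fun a : 'I_h + 'I_k => match a with
    | inl i => GY i | inr j => GL j end) ->
  mutually_independent P' (fun a : 'I_h + 'I_k => match a with
    | inl i => GY' i | inr j => GL' j end) ->
  (forall j, measurable_fun setT (L j)) ->
  (forall j B, measurable B -> GL j (L j @^-1` B)) ->
  (forall j, {ae P, forall w, 0 <= L j w}) ->
  (forall j, measurable_fun setT (L' j)) ->
  (forall j B, measurable B -> GL' j (L' j @^-1` B)) ->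
  (forall j, {ae P', forall w, 0 <= L' j w}) ->
  (forall i, GY' i set0 /\ GY' i setT) ->
  (forall j s, fine (P [set w | L j w < s]) = fine (P' [set w | L' j w < s])) ->
  (forall i s, 0 <= s -> measurable_fun setT (Y i s)) ->
  (forall i s B, 0 <= s -> measurable B -> GY i (Y i s @^-1` B)) ->
  (forall i s w, 0 <= Y i s w <= 1) ->
  (forall i, {ae P, forall w s, 0 <= s -> Y i x w @[x --> s^'+] --> Y i s w}) ->
  measurable_fun setT W -> {ae P, forall w, W w = \prod_i Y i (\sum_j c i j * L j w) w} ->
  measurable_fun setT W' ->
  {ae P', forall w, W' w = \prod_i \int[P]_v Y i (\sum_j c i j * L' j w) v} ->
  \int[P]_w W w = \int[P']_w W' w.
Proof.
move=> ind ind' mL GLL L0 mL' GLL' L0' GY0 lawL mY GYY Y01 Yr mW WE mW' WE'.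
have y01 i s : 0 <= s -> 0 <= \int[P]_w Y i s w <= 1.
  by move=> s0; apply: Rintegral_bounds => //; exact: mY.
have lim1 := time_change_limit k_gt0 c_gt0 ind mL GLL L0 mY GYY Y01 Yr mW WE.
(* The mean viewed as a deterministic process on the second space; negative times are sent to 0
   because [Y i s] is known to be measurable only for s >= 0. *)
pose Y' i s (w : T') : R := \int[P]_v Y i (Num.max 0 s) v.
have Y'E i s w : 0 <= s -> Y' i s w = \int[P]_v Y i s v by move=> s0; rewrite /Y' max_r.
have lim2 : time_change_sum c (fun i s => \int[P']_w Y' i s w)
    (fun j s => fine (P' [set w | L' j w < s])) n @[n --> \oo] --> \int[P']_w W' w.
  apply: (time_change_limit k_gt0 c_gt0 ind' mL' GLL' L0') => //.
  - by move=> i s s0; exact: measurable_cst.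
  (* A constant pulls every set back to the empty or the full set, which is all that [GY'] is asked
     to contain. *)
  - move=> i s B s0 mB; have [G0 G1] := GY0 i.
    have [Bs|Bs] := pselect (B (\int[P]_v Y i s v)).
      rewrite (_ : _ @^-1` _ = setT)//.
      by apply/seteqP; split => // w _ /=; rewrite Y'E.
    rewrite (_ : _ @^-1` _ = set0)//.
    by apply/seteqP; split => // w /=; rewrite Y'E.
  - by move=> i s w; apply: y01; rewrite le_max lexx.
  - move=> i; apply: aeW => w s s0; rewrite Y'E//.
    have := mean_right_continuous (mY i) (Y01 i) (Yr i) s0.
    apply: cvg_trans; apply: near_eq_cvg; near=> x; rewrite Y'E//.
    by apply: le_trans s0 _; near: x; exact: nbhs_right_ge.
  - have L0s : {ae P', forall w, forall j, 0 <= L' j w} by exact: filter_forall.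
    apply: filterS2 WE' L0s => w -> L0w; apply: eq_bigr => i _; rewrite Y'E//.
    by apply: sumr_ge0 => j _; rewrite mulr_ge0// ltW.
apply: (cvg_unique (@Rhausdorff R) lim1).
apply: cvg_trans lim2; apply: near_eq_cvg; apply: nearW => n.
rewrite /time_change_sum; apply: eq_bigr => q _; congr (_ * _).
  apply: eq_bigr => i _; rewrite -[RHS](Rintegral_cstT P').
  by apply: eq_Rintegral => w _; rewrite Y'E// clock_ge0.
by apply: eq_bigr => j _; rewrite /bin_weight !lawL.
Unshelve. all: by end_near. Qed.

End decoupling.

(** * Time-changed Levy processes *)

Section generated_sigma_algebras.
Context d (T : measurableType d) (R : realType).
Implicit Types (X : R -> T -> R) (B : set R).

Lemma sigma_of_process_preimage X t B : 0 <= t -> measurable B ->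
  sigma_of_process X (X t @^-1` B).
Proof.
move=> t0 mB; apply: sub_sigma_algebra; exists t => //.
by exists B => //; rewrite setTI.
Qed.

Lemma sigma_of_process0 X : sigma_of_process X set0.
Proof. exact: sigma_algebra0. Qed.

Lemma sigma_of_processT X : sigma_of_process X setT.
Proof. by have := sigma_algebraCD (sigma_of_process0 (X := X)); rewrite setD0. Qed.

End generated_sigma_algebras.

Lemma random_variable_of_measurable d (T : measurableType d) (R : realType)
    (P : probability T R) (f : T -> R) :
  measurable_fun setT f -> exists X : {RV P >-> R}, X = f :> (T -> R).
Proof.
move=> mf; pose m := isMeasurableFun.Build _ _ _ _ f mf.
pose X : {RV P >-> R} := HB.pack f m.
by exists X.
Qed.

Lemma ae_space_extension (R : realType) d (T : measurableType d) (P : probability T R)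
    d' (T' : measurableType d') (P' : probability T' R) (pi : T' -> T) (A : T -> Prop) :
  space_extension P P' pi -> {ae P, forall w, A w} -> {ae P', forall w, A (pi w)}.
Proof.
move=> [mpi piE] [N [mN N0 AN]]; exists (pi @^-1` N); split.
- by rewrite -[_ @^-1` _]setTI; exact: mpi.
- by rewrite piE.
- by move=> w /= h; exact: (AN (pi w)).
Qed.

Lemma cvg_weakly_test_products (R : realType) (h : nat)
    d (T : measurableType d) (P : probability T R) (X : R -> T -> 'rV[R]_h)
    d' (T' : measurableType d') (P' : probability T' R) (Y : T' -> 'rV[R]_h)
    (V : R -> 'I_h -> {RV P >-> R}) :
  (forall i, measurable_fun setT (fun w => Y w ord0 i)) ->
  (\forall t \near +oo, {ae P, forall w, X t w = \row_i V t i w}) ->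
  (forall g : 'I_h -> R -> R, (forall i, exists M, test_function (g i) M) ->
    \int[P]_w \prod_i g i (V t i w) @[t --> +oo] -->
    \int[P']_w \prod_i g i (Y w ord0 i)) ->
  cvg_weakly P X P' Y.
Proof.
move=> mY XV cvg_test; split=> //; exists V; split=> // f cf [M fM].
have mV t : measurable_fun setT (f \o (fun w => \row_i V t i w)).
  apply: (measurable_continuous_row _ cf fM) => i.
  rewrite (_ : (fun w => _) = V t i)//.
  by apply/funext => w; rewrite mxE.
have IV t : P.-integrable setT (EFin \o (f \o (fun w => \row_i V t i w))).
  exact: (@integrable_bounded _ _ _ _ _ M (mV t) (fun w => fM _)).
have IY : P'.-integrable setT (EFin \o (f \o Y)).
  exact: (@integrable_bounded _ _ _ _ _ M (measurable_continuous_row mY cf fM) (fun w => fM _)).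
rewrite -(EFin_Rintegral IY).
rewrite (_ : (fun t => _) = fun t => (\int[P]_w f (\row_i V t i w))%:E); last first.
  by apply/funext => t; rewrite -(EFin_Rintegral (IV t)).
apply/cvg_EFin; first exact: nearW.
exact: (portmanteau mY cvg_test cf fM).
Qed.

Section time_changed_levy.
Variables (R : realType) (d : measure_display) (T : measurableType d) (P : probability T R).
Variables (h k : nat) (k_gt0 : (0 < k)%N) (c : 'I_h -> 'I_k -> R).
Hypothesis c_gt0 : forall i j, 0 < c i j.
Variables (nu : R) (S : 'I_h -> R -> {RV P >-> R}) (L : 'I_k -> R -> {RV P >-> R}).
Hypotheses (S_levy : forall i, levy_process (S i))
  (L_inverse : forall j, inverse_stable_subordinator nu (L j))
  (SL_independent : mutually_independent P
       (fun a : 'I_h + 'I_k => match a with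
          | inl i => sigma_of_process (S i)
          | inr j => sigma_of_process (L j)
          end)).

Let tau i (w : T) : R := \sum_j c i j * L j 1 w.

Lemma inverse_ge0 t j : 0 <= t -> {ae P, forall w, 0 <= L j t w}.
Proof.
move=> t0; have := inverse_stable_subordinator_ge0 (L_inverse j).
by apply: filterS => w; exact.
Qed.

Lemma clock_one_ge0 : {ae P, forall w, forall i, 0 <= tau i w}.
Proof.
have L0 : {ae P, forall w, forall j, 0 <= L j 1 w}.
  by apply: filter_forall => j; exact: inverse_ge0.
apply: filterS L0 => w L0 i; apply: sumr_ge0 => j _.
by rewrite mulr_ge0// ltW.
Qed.

Lemma levy_right_continuous i (f : R -> R) (b : R) : continuous f ->
  {ae P, forall w s, 0 <= s -> f (S i x w * b) @[x --> s^'+] --> f (S i s w * b)}.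
Proof.
move=> cf; have [_ _ _ cS] := S_levy i; apply: filterS cS => w [cr _] s s0.
apply: continuous_cvg; first exact: cf.
by apply: cvgMl; exact: cr.
Qed.

Lemma time_changed_levy_version t b i : 0 <= t ->
  exists V : {RV P >-> R}, {ae P, forall w, V w = S i (\sum_j c i j * L j t w) w * b}.
Proof.
move=> t0.
have mLt j : measurable_fun setT (L j t) by [].
have L0 j := inverse_ge0 j t0.
have mY s : 0 <= s -> measurable_fun setT (fun w => S i s w * b).
  by move=> _; exact: measurable_funM.
have Yr := levy_right_continuous i b (fun x => @cvg_id _ (nbhs x)).
have [V mV VE] := time_change_version k_gt0 c_gt0 mLt L0 i mY Yr.
have [X XV] := random_variable_of_measurable P mV.
by exists X; rewrite XV.
Qed.

Variables (f : 'I_h -> R -> R).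
Hypothesis f_test : forall i, exists M, test_function (f i) M.

Let f01 i x : 0 <= f i x <= 1.
Proof. by have [M [h0 _ _]] := f_test i. Qed.

Let mf i : measurable_fun setT (f i).
Proof. by have [M tM] := f_test i; exact: test_function_measurable tM. Qed.

Let cf i : continuous (f i).
Proof. by have [M tM] := f_test i; exact: test_function_continuous tM. Qed.

Let y (b : R) i s : R := \int[P]_w f i (S i s w * b).

Let mfS b i s : measurable_fun setT (fun w => f i (S i s w * b)).
Proof. by apply: measurableT_comp => //; exact: measurable_funM. Qed.

Let y01 b i s : 0 <= y b i s <= 1.
Proof. by apply: Rintegral_bounds => //; exact: mfS. Qed.

(** [decoupling] with the same space twice: the second clocks are t^nu L_j(1), equal in law to
    L_j(t) for each j, which suffices since the clocks are independent. All randomness now sits in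
    L_j(1), so that t enters through deterministic functions. *)
Lemma decoupled_expectation t b (V : 'I_h -> T -> R) : 0 < t ->
  (forall i, measurable_fun setT (V i)) ->
  (forall i, {ae P, forall w, V i w = S i (\sum_j c i j * L j t w) w * b}) ->
  exists W : T -> R, [/\ measurable_fun setT W, forall w, 0 <= W w <= 1,
    {ae P, forall w, W w = \prod_i y b i (t `^ nu * tau i w)} &
    \int[P]_w \prod_i f i (V i w) = \int[P]_w W w].
Proof.
move=> t0 mV VE.
have mL' j : measurable_fun setT (fun w => t `^ nu * L j 1 w) by exact: measurable_funM.
have L'0 j : {ae P, forall w, 0 <= t `^ nu * L j 1 w}.
  by apply: filterS (inverse_ge0 j ler01) => w L0; rewrite mulr_ge0// powR_ge0.
have yr i s : 0 <= s -> y b i x @[x --> s^'+] --> y b i s.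
  apply: (@mean_right_continuous _ _ _ P (fun s w => f i (S i s w * b))) => //.
  exact: levy_right_continuous.
have [W [mW W01 WE]] := time_change_product_version k_gt0 c_gt0 mL' L'0 (y01 b) yr.
have WtauE : {ae P, forall w, W w = \prod_i y b i (t `^ nu * tau i w)}.
  apply: filterS WE => w ->; apply: eq_bigr => i _; congr y.
  by rewrite /tau mulr_sumr; apply: eq_bigr => j _; rewrite mulrCA.
exists W; split => //.
have VE' : {ae P, forall w, forall i, V i w = S i (\sum_j c i j * L j t w) w * b}.
  exact: filter_forall.
apply: (decoupling k_gt0 c_gt0 SL_independent SL_independent (L := fun j => L j t)
  (L' := fun j w => t `^ nu * L j 1 w) (Y := fun i s w => f i (S i s w * b))) => //.
- by move=> j B mB; apply: sigma_of_process_preimage => //; exact: ltW.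
- by move=> j; apply: inverse_ge0; exact: ltW.
- move=> j B mB; rewrite (_ : _ @^-1` B = L j 1 @^-1` ((fun x => t `^ nu * x) @^-1` B))//.
  apply: sigma_of_process_preimage => //; apply: measurable_preimage => //.
  exact: measurable_funM.
- by move=> i; split; [exact: sigma_of_process0|exact: sigma_of_processT].
- by move=> j s; exact: inverse_stable_subordinator_scaling.
- move=> i s B s0 mB; rewrite (_ : _ @^-1` B = S i s @^-1` ((fun x => f i (x * b)) @^-1` B))//.
  apply: sigma_of_process_preimage => //; apply: measurable_preimage => //.
  by apply: measurableT_comp => //; exact: measurable_funM.
- by move=> i; exact: levy_right_continuous.
- by apply: measurable_prodr => i; exact: measurableT_comp.
- by apply: filterS VE' => w VE'; apply: eq_bigr => i _; rewrite VE'.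
Qed.

Lemma time_changed_levy_limit (t b : nat -> R) (V : nat -> 'I_h -> T -> R)
    (g : 'I_h -> R -> R) (G : T -> R) :
  (forall n, 0 < t n) ->
  (forall n i, measurable_fun setT (V n i)) ->
  (forall n i, {ae P, forall w, V n i w = S i (\sum_j c i j * L j (t n) w) w * b n}) ->
  (forall i s, 0 <= s -> \int[P]_w f i (S i (t n `^ nu * s) w * b n) @[n --> \oo] --> g i s) ->
  measurable_fun setT G -> {ae P, forall w, G w = \prod_i g i (tau i w)} ->
  \int[P]_w \prod_i f i (V n i w) @[n --> \oo] --> \int[P]_w G w.
Proof.
move=> t0 mV VE yg mG GE.
have /choice[W hW] n := decoupled_expectation (t0 n) (mV n) (VE n).
rewrite (_ : (fun n => _) = fun n => \int[P]_w W n w); last first.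
  by apply/funext => n; have [] := hW n.
apply: (@bounded_convergence _ _ _ _ W G 1) => //.
- by move=> n; have [] := hW n.
- by move=> n w; have [_ /(_ w)/andP[h0 h1] _ _] := hW n; rewrite ger0_norm.
have WE : {ae P, forall w, forall n, W n w = \prod_i y (b n) i (t n `^ nu * tau i w)}.
  by apply: ae_foralln => n; have [] := hW n.
apply: filterS3 WE GE clock_one_ge0 => w WE -> tau0.
rewrite (_ : (fun n => _) = fun n => \prod_i y (b n) i (t n `^ nu * tau i w)); last first.
  by apply/funext => n.
by apply: cvg_prodr => i; exact: yg.
Qed.

End time_changed_levy.

Section power_scaling.
Variable R : realType.

Lemma powR_rescale (t p : R) : 0 < t -> t `^ (1 - p) / t = t `^ (- p).
Proof.
move=> t0; rewrite powRD ?(gt_eqF t0) ?implybT// powRr1 ?(ltW t0)//.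
by rewrite mulrAC divff ?gt_eqF// mul1r.
Qed.

Lemma powR_mulN (t p : R) : 0 < t -> t `^ p * t `^ (- p) = 1.
Proof. by move=> t0; rewrite -powRD ?(gt_eqF t0) ?implybT// subrr powRr0. Qed.

Lemma powR_half_sqr (t p : R) : 0 < t -> t `^ (- (p / 2)) ^+ 2 = t `^ (- p).
Proof.
move=> t0; rewrite expr2 -powRD ?(gt_eqF t0) ?implybT//.
by congr (_ `^ _); field.
Qed.

Lemma cvg_powRN (t : nat -> R) (p : R) : 0 < p -> (forall n, 0 < t n) ->
  t n @[n --> \oo] --> +oo -> t n `^ (- p) @[n --> \oo] --> 0.
Proof.
move=> p0 t0 cvt.
have -> : (fun n => t n `^ (- p)) = (fun n => (t n `^ p)^-1).
  by apply/funext => n; rewrite powRN.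
apply/gtr0_cvgV0; first by apply: nearW => n; exact: powR_gt0.
apply/cvgryPge => A; move/cvgryPge : cvt => /(_ (`|A| `^ p^-1)).
apply: filterS => n h; apply: le_trans (ler_norm A) _.
have -> : `|A| = (`|A| `^ p^-1) `^ p by rewrite -powRrM mulVf ?gt_eqF// powRr1.
apply: ge0_ler_powR => //; first exact: ltW.
- by rewrite nnegrE powR_ge0.
- by rewrite nnegrE ltW.
Qed.

End power_scaling.

Section two_regimes.
Variable R : realType.
Local Notation TR := (measurableTypeR R).
Local Notation gauss := (normal_prob (0 : R) 1 : probability TR R).
Context d (T : measurableType d) (P : probability T R).
Variable S : R -> {RV P >-> R}.
Hypotheses (S_levy : levy_process S)
  (S_mgf : \forall theta \near (0 : R), ('M_P (S 1%R) theta < +oo)%E).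
Variables (f : R -> R) (M : R) (nu : R) (t : nat -> R).
Hypotheses (tf : test_function f M) (nu_gt0 : 0 < nu) (t_gt0 : forall n, 0 < t n)
  (cvt : t n @[n --> \oo] --> +oo).
Let mean := \int[P]_w S 1 w.

(** With u = t^nu s and b = t^(-nu/2) one has u b^2 = s. Matching the variance exactly makes the
    second-order error vanish, and u b^3 = s b tends to 0. *)
Lemma levy_limit_centered (s : R) : 0 <= s -> mean = 0 ->
  \int[P]_w f (S (t n `^ nu * s) w * t n `^ (- (nu / 2))) @[n --> \oo] -->
  \int[gauss]_z f (Num.sqrt (s * \int[P]_w (S 1 w ^+ 2)) * (z : R)).
Proof.
move=> s0 mean0; pose v := \int[P]_w (S 1 w ^+ 2).
have v0 : 0 <= v by apply: Rintegral_ge0 => w _; exact: sqr_ge0.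
have b0 n : 0 < t n `^ (- (nu / 2)) by exact: powR_gt0.
have cb : t n `^ (- (nu / 2)) @[n --> \oo] --> 0 by apply: cvg_powRN => //; rewrite divr_gt0.
have ub n : t n `^ nu * s * t n `^ (- (nu / 2)) ^+ 2 = s.
  by rewrite powR_half_sqr// mulrAC powR_mulN// mul1r.
have u0 n : 0 <= t n `^ nu * s by rewrite mulr_ge0// powR_ge0.
have := @levy_limit R d T P S S_levy f M tf S_mgf (fun n => t n `^ (- (nu / 2)))
  (fun n => t n `^ nu * s) (Num.sqrt v) 0 (Num.sqrt (s * v)) (sqrtr_ge0 v) b0 u0 cb.
rewrite -/mean mean0 expr0n subr0 sqr_sqrtr// -/v subrr normr0.
under [X in _ -> _ -> _ -> _ -> _ --> X]eq_Rintegral do rewrite add0r.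
apply.
- by under eq_fun do rewrite mul0r mulr0; exact: cvg_cst.
- under eq_fun do rewrite exprSr mulrA ub.
  by rewrite -(mulr0 s); exact: cvgMr.
- by under eq_fun do rewrite mul0r mulr0; exact: cvg_cst.
- rewrite (_ : (fun n => _) = fun=> Num.sqrt (s * v)); first exact: cvg_cst.
  apply/funext => n.
  have su : Num.sqrt (t n `^ nu * s) * t n `^ (- (nu / 2)) = Num.sqrt s.
    by rewrite -[in RHS](ub n) [RHS]sqrtrM// sqrtr_sqr (gtr0_norm (b0 n)).
  by rewrite mulrCA su sqrtrM// mulrC.
Qed.

(** Here b = t^(-nu), so u b = s, and the Gaussian substitute is the constant drift. The full
    variance is left as second-order mismatch, but it comes with u b^2 = s b, which tends to 0. *)
Lemma levy_limit_drift (s : R) : 0 <= s ->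
  \int[P]_w f (S (t n `^ nu * s) w * t n `^ (- nu)) @[n --> \oo] --> f (mean * s).
Proof.
move=> s0.
have b0 n : 0 < t n `^ (- nu) by exact: powR_gt0.
have cb : t n `^ (- nu) @[n --> \oo] --> 0 by exact: cvg_powRN.
have ub n : t n `^ nu * s * t n `^ (- nu) = s by rewrite mulrAC powR_mulN// mul1r.
have u0 n : 0 <= t n `^ nu * s by rewrite mulr_ge0// powR_ge0.
have := @levy_limit R d T P S S_levy f M tf S_mgf (fun n => t n `^ (- nu))
  (fun n => t n `^ nu * s) 0 (mean * s) 0 (lexx _) b0 u0 cb.
have -> : \int[gauss]_z f (mean * s + 0 * (z : R)) = f (mean * s).
  rewrite -[RHS](Rintegral_cstT gauss); apply: eq_Rintegral => z _.
  by rewrite mul0r addr0.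
set V := `|_|; apply.
- rewrite (_ : (fun n => _) = fun n => s * V * t n `^ (- nu)).
    by rewrite -(mulr0 (s * V)); exact: cvgMr.
  by apply/funext => n; rewrite -[in RHS](ub n) expr2; ring.
- rewrite (_ : (fun n => _) = fun n => s * (t n `^ (- nu) * t n `^ (- nu))).
    rewrite [X in _ --> X](_ : _ = s * (0 * 0)); last by rewrite !mulr0.
    by apply: cvgMr; exact: cvgM.
  by apply/funext => n; rewrite -[in RHS](ub n) exprS expr2; ring.
- rewrite (_ : (fun n => _) = fun n => mean * s); first exact: cvg_cst.
  by apply/funext => n; rewrite -[in RHS](ub n) /mean; ring.
- by under eq_fun do rewrite mul0r mulr0; exact: cvg_cst.
Qed.

End two_regimes.

Section weak_limit.
Variables (R : realType) (d : measure_display) (T : measurableType d) (P : probability T R).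
Variables (h k : nat) (k_gt0 : (0 < k)%N) (c : 'I_h -> 'I_k -> R).
Hypothesis c_gt0 : forall i j, 0 < c i j.
Variables (nu : R) (S : 'I_h -> R -> {RV P >-> R}) (L : 'I_k -> R -> {RV P >-> R}).
Hypotheses (S_levy : forall i, levy_process (S i))
  (L_inverse : forall j, inverse_stable_subordinator nu (L j))
  (SL_independent : mutually_independent P
       (fun a : 'I_h + 'I_k => match a with
          | inl i => sigma_of_process (S i)
          | inr j => sigma_of_process (L j)
          end)).
Context d' (T' : measurableType d') (P' : probability T' R).

(** Common frame of both regimes: it remains to find the limit [g] of each mean at a fixed clock
    value, and to identify the expectation of the product of the [g i] at the clocks with that of
    the proposed limit vector. *)
Lemma rescaled_time_change_cvg (p : R) (Y : T' -> 'rV[R]_h) :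
  (forall i, measurable_fun setT (fun w => Y w ord0 i)) ->
  (forall f : 'I_h -> R -> R, (forall i, exists M, test_function (f i) M) ->
    exists (g : 'I_h -> R -> R) (G : T -> R), [/\ measurable_fun setT G,
      {ae P, forall w, G w = \prod_i g i (\sum_j c i j * L j 1 w)},
      forall t : nat -> R, (forall n, 0 < t n) -> t n @[n --> \oo] --> +oo ->
        forall i s, 0 <= s ->
        \int[P]_w f i (S i (t n `^ nu * s) w * t n `^ (- p)) @[n --> \oo] --> g i s &
      \int[P]_w G w = \int[P']_w \prod_i f i (Y w ord0 i)]) ->
  cvg_weakly P (rescaled_time_change c (1 - p) (fun i t => S i t) (fun j t => L j t)) P' Y.
Proof.
move=> mY limits.
have /choice[V hV] (a : R * 'I_h) : exists V : {RV P >-> R}, 0 < a.1 ->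
    {ae P, forall w, V w = S a.2 (\sum_j c a.2 j * L j a.1 w) w * a.1 `^ (- p)}.
  (* Versions are chosen for all times at once; at nonpositive times any random variable will do, as
     only large times count. *)
  have [a0|a0] := ltP 0 a.1; last by exists (S a.2 0).
  have [V VE] := time_changed_levy_version k_gt0 c_gt0 S_levy L_inverse
    (a.1 `^ (- p)) a.2 (ltW a0).
  by exists V.
apply: (cvg_weakly_test_products (V := fun t i => V (t, i))) => //.
  near=> t; have t0 : 0 < t by near: t; exact: nbhs_pinfty_gt.
  have VE : {ae P, forall w, forall i,
      V (t, i) w = S i (\sum_j c i j * L j t w) w * t `^ (- p)}.
    by apply: filter_forall => i; exact: hV.
  apply: filterS VE => w VE; apply/rowP => i; rewrite !mxE VE -powR_rescale//.
  by rewrite mulrCA.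
move=> f /[dup] tf /limits[g [G [mG GE fg <-]]].
(* Makes all times positive while changing only finitely many terms. *)
apply/cvg_pinftyP => u cu; pose t n := Num.max 1 (u n).
have t0 n : 0 < t n by rewrite lt_max ltr01.
have ut : \forall n \near \oo, u n = t n.
  by move/cvgryPge : cu => /(_ 1); apply: filterS => n u1; rewrite /t max_r.
have ct : t n @[n --> \oo] --> +oo.
  by apply: cvg_trans cu; apply: near_eq_cvg; apply: filterS ut => n ->.
have mVt n i : measurable_fun setT (V (t n, i)) by [].
have := time_changed_levy_limit k_gt0 c_gt0 S_levy L_inverse SL_independent tf
  (V := fun n i => V (t n, i)) (b := fun n => t n `^ (- p)) t0 mVt
  (fun n i => hV (t n, i) (t0 n)) (fg t t0 ct) mG GE.
apply: cvg_trans.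
by apply: near_eq_cvg; apply: filterS ut => n ->.
Unshelve. all: by end_near. Qed.

End weak_limit.

Section random_scale.
Variables (R : realType) (d : measure_display) (T : measurableType d) (P : probability T R).
Variables (h k : nat) (k_gt0 : (0 < k)%N) (c : 'I_h -> 'I_k -> R).
Hypothesis c_gt0 : forall i j, 0 < c i j.
Variables (L : 'I_k -> T -> R) (GS : 'I_h -> set (set T)) (GL : 'I_k -> set (set T)).
Hypotheses (mL : forall j, measurable_fun setT (L j))
  (GLL : forall j B, measurable B -> GL j (L j @^-1` B))
  (L_ge0 : forall j, {ae P, forall w, 0 <= L j w})
  (GS0 : forall i, GS i set0 /\ GS i setT)
  (SL_independent : mutually_independent P
    (fun a : 'I_h + 'I_k => match a with inl i => GS i | inr j => GL j end)).
Context d' (T' : measurableType d') (P' : probability T' R).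
Variables (pi : T' -> T) (Z : 'I_h -> {RV P' >-> R}) (GL' : 'I_k -> set (set T')).
Hypotheses (pi_extension : space_extension P P' pi)
  (GLL' : forall j B, measurable B -> GL' j ((L j \o pi) @^-1` B))
  (ZL_independent : mutually_independent P'
    (fun a : 'I_h + 'I_k => match a with inl i => sigma_of_variable (Z i) | inr j => GL' j end)).
Variables (v : 'I_h -> R) (f : 'I_h -> R -> R).
Hypothesis f_test : forall i, exists M, test_function (f i) M.

(** Decoupling read backwards: s -> f_i (sqrt (s v_i) Z_i) plays the part of the process and is
    averaged out. The product of means is a function of the clocks alone, hence lives on the
    original space, where the limit of the rescaled process is computed. *)
Lemma random_scale_expectation :
  exists G : T -> R, [/\ measurable_fun setT G,
    {ae P, forall w, G w = \prod_i \int[P']_x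
      f i (Num.sqrt ((\sum_j c i j * L j w) * v i) * Z i x)} &
    \int[P]_w G w = \int[P']_x \prod_i
      f i (Num.sqrt (\sum_j c i j * L j (pi x) * v i) * Z i x)].
Proof.
have [mpi piE] := pi_extension.
have f01 i x : 0 <= f i x <= 1 by have [M [h0 _ _]] := f_test i.
have cf i : continuous (f i).
  by have [M tM] := f_test i; exact: test_function_continuous tM.
have mf i : measurable_fun setT (f i) by exact: continuous_measurable_fun.
have csqrt i (x : R) : continuous (fun s : R => f i (Num.sqrt (s * v i) * x)).
  move=> s; have c1 : {for s, continuous (fun s : R => s * v i)} by apply: cvgMl; exact: cvg_id.
  have c2 := continuous_comp c1 (@sqrt_continuous R _).
  have c3 : {for s, continuous (fun s : R => Num.sqrt (s * v i) * x)} by exact: cvgMl.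
  exact: (continuous_comp c3 (cf i _)).
pose Y i (s : R) x := f i (Num.sqrt (s * v i) * Z i x).
have mY i s : measurable_fun setT (Y i s).
  by apply: measurableT_comp => //; exact: measurable_funM.
have Y01 i s x : 0 <= Y i s x <= 1 by exact: f01.
have Yr i : {ae P', forall x s, 0 <= s -> Y i u x @[u --> s^'+] --> Y i s x}.
  by apply: aeW => x s _; apply: cvg_at_right_filter; exact: csqrt.
pose y i s := \int[P']_x Y i s x.
have y01 i s : 0 <= y i s <= 1 by exact: Rintegral_bounds.
have yr i s : 0 <= s -> y i u @[u --> s^'+] --> y i s.
  by apply: mean_right_continuous.
have [G [mG _ GE]] := time_change_product_version k_gt0 c_gt0 mL L_ge0 y01 yr.
exists G; split => //; apply/esym.
have mL' j : measurable_fun setT (L j \o pi) by exact: measurableT_comp.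
apply: (decoupling k_gt0 c_gt0 ZL_independent SL_independent (L := fun j => L j \o pi)
  (L' := L) (Y := Y)) => //.
- by move=> j; exact: (ae_space_extension pi_extension (L_ge0 j)).
- move=> j s; congr fine; rewrite -piE//.
  rewrite (_ : [set w | _] = L j @^-1` [set x | x < s])//.
  by apply: measurable_preimage => //; rewrite -set_itvNyo.
- move=> i s B s0 mB; exists ((fun z => f i (Num.sqrt (s * v i) * z)) @^-1` B).
    by apply: measurable_preimage => //; apply: measurableT_comp => //; exact: measurable_funM.
  by rewrite setTI.
- apply: measurable_prodr => i; apply: measurableT_comp => //; apply: measurable_funM => //.
  apply: measurableT_comp; first by apply: continuous_measurable_fun; exact: sqrt_continuous.
  apply: measurable_sum => j; apply: measurable_funM => //; apply: measurable_funM => //.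
  exact: mL'.
- by apply: aeW => x; apply: eq_bigr => i _; rewrite /Y mulr_suml.
Qed.

End random_scale.

Theorem proposition5p2 (R : realType) (d : measure_display)
    (T : measurableType d) (P : probability T R)
    (h k : nat) (h_ge1 : (1 <= h)%N) (k_ge1 : (1 <= k)%N)
    (c : 'I_h -> 'I_k -> R) (c_gt0 : forall i j, 0 < c i j)
    (nu : R) (nu_gt0 : 0 < nu) (nu_lt1 : nu < 1)
    (S : 'I_h -> R -> {RV P >-> R}) (L : 'I_k -> R -> {RV P >-> R})
    (S_levy : forall i, levy_process (S i))
    (S_mgf : forall i, \forall theta \near (0 : R),
       ('M_P (S i 1%R) theta < +oo)%E)
    (L_inverse : forall j, inverse_stable_subordinator nu (L j))
    (SL_independent : mutually_independent P
       (fun a : 'I_h + 'I_k => match a with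
          | inl i => sigma_of_process (S i)
          | inr j => sigma_of_process (L j)
          end)) :
  let kappa i := cumulant_gen_fun P (S i 1) in
  let m : 'rV[R]_h := \row_i ((kappa i)^`())%classic 0 in
  let X := rescaled_time_change c (index_alpha m nu)
             (fun i t => S i t) (fun j t => L j t) in
  (m = 0 ->
     forall (d' : measure_display) (T' : measurableType d')
       (P' : probability T' R) (pi : T' -> T) (Z : 'I_h -> {RV P' >-> R}),
     space_extension P P' pi ->
     (forall i, has_law P' (Z i) (normal_prob 0 1)) ->
     mutually_independent P'
       (fun a : 'I_h + ('I_h + 'I_k) => match a with
          | inl i => sigma_of_variable (Z i)
          | inr (inl i) => sigma_of_process (fun t => S i t \o pi)
          | inr (inr j) => sigma_of_process (fun t => L j t \o pi)
          end) ->
     cvg_weakly P X P' (fun w =>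
       \row_i (Num.sqrt (\sum_j c i j * L j 1 (pi w) * ((kappa i)^`(2))%classic 0)
               * Z i w))) /\
  (m <> 0 ->
     cvg_weakly P X P (fun w =>
       \row_i (m ord0 i * \sum_j c i j * L j 1 w))).
Proof.
move=> kappa m X.
have mean_kappa i : ((kappa i)^`())%classic 0 = \int[P]_w S i 1 w.
  by have [e e0 Ie] := mgf_integrable (S_mgf i); exact: cumulant_mean Ie.
split => [m0|mN0].
- move=> d' T' P' pi Z pi_extension Z_law ZSL_independent.
  have mean0 i : \int[P]_w S i 1 w = 0.
    by have /rowP/(_ i) := m0; rewrite !mxE mean_kappa.
  pose v i := ((kappa i)^`(2))%classic 0.
  (* With zero mean the second cumulant is the second moment, the form in which
     [levy_limit_centered] gives the scale. *)
  have vE i : v i = \int[P]_w (S i 1 w ^+ 2).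
    have [e e0 Ie] := mgf_integrable (S_mgf i).
    by rewrite /v (cumulant_variance _ e0 Ie)// mean0 expr0n subr0.
  have ZL_independent : mutually_independent P'
      (fun a : 'I_h + 'I_k => match a with
        | inl i => sigma_of_variable (Z i)
        | inr j => sigma_of_process (fun t => L j t \o pi)
        end).
    (* Restricts the independence to the variables of the limit vector, the [Z i] and the clocks. *)
    pose phi (a : 'I_h + 'I_k) : 'I_h + ('I_h + 'I_k) :=
      match a with inl i => inl i | inr j => inr (inr j) end.
    have phi_inj : injective phi by move=> [i|j] [i'|j'] //= [->].
    have := mutually_independent_inj phi_inj ZSL_independent.
    by congr mutually_independent; apply/funext => -[].
  rewrite /X /index_alpha m0 eqxx.
  apply: (rescaled_time_change_cvg k_ge1 c_gt0 S_levy L_inverse SL_independent (p := nu / 2)).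
    move=> i; under eq_fun do rewrite mxE.
    apply: measurable_funM => //; apply: measurableT_comp.
      by apply: continuous_measurable_fun; exact: sqrt_continuous.
    apply: measurable_sum => j; apply: measurable_funM => //; apply: measurable_funM => //.
    by apply: measurableT_comp => //; exact: pi_extension.1.
  move=> f tf.
  have mL j : measurable_fun setT (L j 1) by [].
  have GLL j B : measurable B -> sigma_of_process (L j) (L j 1 @^-1` B).
    by move=> mB; exact: sigma_of_process_preimage.
  have L0 j : {ae P, forall w, 0 <= L j 1 w} by exact: (inverse_ge0 L_inverse j ler01).
  have GS0 i : sigma_of_process (S i) set0 /\ sigma_of_process (S i) setT.
    by split; [exact: sigma_of_process0|exact: sigma_of_processT].
  have GLL' j B : measurable B ->
      sigma_of_process (fun t => L j t \o pi) ((L j 1 \o pi) @^-1` B).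
    exact: (sigma_of_process_preimage (X := fun t => L j t \o pi)).
  have [G [mG GE GY]] := random_scale_expectation k_ge1 c_gt0 mL GLL L0 GS0
    SL_independent pi_extension GLL' ZL_independent v tf.
  (* The Gaussian integrals are written through [Z i], so that their product at the clocks is the
     [G] already identified with the limit. *)
  exists (fun i s => \int[P']_x f i (Num.sqrt (s * v i) * Z i x)), G; split => //.
    move=> t t0 ct i s s0; have [M tM] := tf i.
    have := levy_limit_centered (S_levy i) (S_mgf i) tM nu_gt0 t0 ct s0 (mean0 i).
    rewrite -vE; set l := Rintegral _ _ _; rewrite (_ : l = \int[P']_x f i (Num.sqrt (s * v i) * Z i x))//.
    have mfi := test_function_measurable tM; have [f01 _ _] := tM.
    pose g (z : R) := f i (Num.sqrt (s * v i) * z).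
    apply/esym/(@Rintegral_eq_law _ _ _ P' (Z i) _ _ (normal_prob (0 : R) 1) id g) => //.
    - by move=> B mB; exact: Z_law.
    - by apply: measurableT_comp => //; exact: measurable_funM.
    - by move=> z; have /andP[] := f01 (Num.sqrt (s * v i) * z).
  rewrite GY; apply: eq_Rintegral => x _; apply: eq_bigr => i _.
  by rewrite mxE.
- rewrite /X /index_alpha (introF eqP mN0).
  have mY i : measurable_fun setT (fun w => m ord0 i * \sum_j c i j * L j 1 w).
    apply: measurable_funM => //; apply: measurable_sum => j.
    exact: measurable_funM.
  apply: (rescaled_time_change_cvg k_ge1 c_gt0 S_levy L_inverse SL_independent (p := nu)).
    by move=> i; under eq_fun do rewrite mxE; exact: (mY i).
  move=> f tf; exists (fun i s => f i (m ord0 i * s)),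
    (fun w => \prod_i f i (m ord0 i * \sum_j c i j * L j 1 w)); split.
  + apply: measurable_prodr => i; have [M tM] := tf i.
    by apply: measurableT_comp => //; exact: test_function_measurable tM.
  + exact: aeW.
  + move=> t t0 ct i s s0; have [M tM] := tf i.
    rewrite mxE mean_kappa.
    exact: (levy_limit_drift (S_levy i) (S_mgf i) tM nu_gt0 t0 ct s0).
  + by apply: eq_Rintegral => w _; apply: eq_bigr => i _; rewrite [in RHS]mxE.
Qed.
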